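(* For every $f\in C([0,1])$, $$\lim_{T\to\infty}\frac{\sum_{\omega\in Q_F(T)}\omega f(\omega)}{\sum_{\omega\in Q_F(T)}\omega}=\int_0^1 f(x)\,dx .$$ In other words, if $m_T$ denotes the probability measure on $[0,1]$ given by $\int_{[0,1]} f\,dm_T:=\dfrac{\sum_{\omega\in Q_F(T)}\omega f(\omega)}{\sum_{\omega\in Q_F(T)}\omega}$ for $f\in C([0,1])$, then $\lim_{T\to\infty}\int_{[0,1]}f\,dm_T=\int_0^1f(x)\,dx$, i.e. the weighted set of periodic points of the Farey map $F$ given by $m_T$ equidistributes with respect to Lebesgue measure on $[0,1]$.
   Context: Continued fractions: for positive integers $a_j$, $[a_1,a_2,\ldots]=\cfrac{1}{a_1+\cfrac{1}{a_2+\cdots}}$; an overline denotes periodic repetition, e.g. $[\overline{a_1,\ldots,a_n}]=[a_1,\ldots,a_n,a_1,\ldots,a_n,\ldots]$. The Gauss map $G:[0,1]\to[0,1]$ is $G(x)=\{1/x\}$ (fractional part) for $x\neq0$, $G(0)=0$. The Farey map $F:[0,1]\to[0,1]$ is $F(x)=\frac{x}{1-x}$ for $0\le x\le \frac12$ and $F(x)=\frac{1-x}{x}$ for $\frac12<x\le1$. $Q_G$ is the set of nonzero periodic points of $G$; these are exactly the numbers $[\overline{a_1,\ldots,a_n}]$ with $a_j\in\mathbb{N}$ ($\mathbb N$ = positive integers). $Q_F$ is the set of nonzero periodic points of $F$; these are exactly the numbers $F^k(\omega)$ with $\omega\in Q_G$ and $k\ge0$ an integer. Length function: for $\omega\in Q_G$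 with minimal even periodic expansion $\omega=[\overline{a_1,\ldots,a_{2n}}]$ (i.e. $2n$ is the smallest even period of the continued fraction expansion), $\ell(\omega):=-2\sum_{j=1}^{2n}\log(G^j(\omega))$. This is extended to $Q_F$ by $\ell(F^k(\omega)):=\ell(\omega)$ for $\omega\in Q_G$, $k\in\mathbb{N}$. For $T>0$, $Q_F(T):=\{\omega\in Q_F:\ell(\omega)\le T\}$ (nonempty for all sufficiently large $T$). *)

(* Defs.v *)
From HB Require Import structures.
From mathcomp Require Import all_boot all_order all_algebra.
From mathcomp Require Import all_classical all_reals all_analysis.
Set Implicit Arguments.
Unset Strict Implicit.
Unset Printing Implicit Defensive.
Import Order.TTheory GRing.Theory Num.Theory.
Import numFieldNormedType.Exports.
Local Open Scope classical_set_scope.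
Local Open Scope ring_scope.

(* The maps are total functions on R; points are restricted to [0, 1], which
   both maps preserve, in QG and QF below. *)
Definition gauss (R : realType) (x : R) : R :=
  if x == 0 then 0 else x^-1 - (Num.floor x^-1)%:~R.

Definition farey (R : realType) (x : R) : R :=
  if x <= 2^-1 then x / (1 - x) else (1 - x) / x.

Definition periodic_pt (R : realType) (F : R -> R) (x : R) : Prop :=
  exists2 n : nat, (0 < n)%N & iter n F x = x.

Definition QG (R : realType) : set R :=
  [set x | [/\ x \in `[0, 1], x != 0 & periodic_pt (@gauss R) x]].

Definition QF (R : realType) : set R :=
  [set x | [/\ x \in `[0, 1], x != 0 & periodic_pt (@farey R) x]].

(* [a_1, ..., a_n] = 1 / (a_1 + 1 / (a_2 + ... + 1 / a_n)) *)
Definition cfrac_fin (R : realType) (s : seq nat) : R :=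
  foldr (fun (a : nat) (y : R) => (a%:R + y)^-1) 0 s.

(* x = [a_1, a_2, ...]; the digit a_(j+1) is [a j]. *)
Definition is_cfrac (R : realType) (a : nat -> nat) (x : R) : Prop :=
  (forall j, 0 < a j)%N /\
  (cfrac_fin R (mkseq a n) @[n --> \oo] --> x).

(* x = [overline(a_1, ..., a_m)] for some digits; m need not be minimal. *)
Definition cfrac_period (R : realType) (x : R) (m : nat) : Prop :=
  (0 < m)%N /\
  exists a : nat -> nat, is_cfrac a x /\ forall j, a (j + m)%N = a j.

Definition min_even_period (R : realType) (x : R) (n : nat) : Prop :=
  cfrac_period x (2 * n) /\
  forall m : nat, cfrac_period x (2 * m) -> (n <= m)%N.

Definition half_min_period (R : realType) (x : R) : nat :=
  xget 0%N [set n | min_even_period x n].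

Definition lengthG (R : realType) (x : R) : R :=
  - 2 * \sum_(1 <= j < (2 * half_min_period x).+1) ln (iter j (@gauss R) x).

(* The length of F^k(w), w in QG, is that of w.  The chosen w does not matter:
   the points of QG on one Farey cycle form a single Gauss cycle, on which
   lengthG is constant. *)
Definition lengthF (R : realType) (x : R) : R :=
  lengthG (xget 0 [set w | QG w /\ exists k : nat, iter k (@farey R) w = x]).

Definition QFT (R : realType) (T : R) : set R :=
  [set x | QF x /\ lengthF x <= T].

(* QFT T is a finite set, so these \sum_(_ \in _) are genuine finite sums (the
   library's value 0 for sums of infinite support plays no role). *)
Definition QFT_mean (R : realType) (T : R) (f : R -> R) : R :=
  (\sum_(w \in QFT T) w * f w) / (\sum_(w \in QFT T) w).

(* mu is the probability measure m_T on [0, 1]; it is carried by [0, 1], as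
   g = 1 shows. *)
Definition is_mT (R : realType) (T : R)
    (mu : probability (measurableTypeR R) R) : Prop :=
  forall g : R -> R, {within `[0, 1], continuous g} ->
    \int[mu]_(x in `[0, 1]) g x = QFT_mean T g.

(* Main.v *)
(* Put X = exp(T/2).  For w in QG with minimal even period word s, the product
   of the 1 / G^j(w) over the period is q + q' w, where p/q is the value of s as
   a finite continued fraction; hence lengthG w <= T means q + q' w <= X.

   Write L_X for the finite set of these w.  The map w |-> p/q is injective and
   |w - p/q| <= q^-2, so at most 2 r X^2 + 3 X points of L_X lie in an interval
   of radius r.  Conversely every p/q comes from a periodic point, and all but
   O(X^(3/2)) of them from its minimal word, so L_X has at least X^2 / 128
   elements.

   G permutes L_X, so sums over L_X do not change when the summand is replaced
   by its Birkhoff averages.  By the upper bound, the sum over L_X of the square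
   of such an average is at most X^2 times its Lebesgue integral, up to a
   constant, and this is small for a function of mean zero: the Gauss transfer
   operator contracts Lipschitz constants by the factor 7/8 (Kuzmin).  So L_X
   equidistributes with respect to the Gauss measure.

   Each Farey cycle is obtained from its Gauss cycle by putting the points
   1 / (b + G w), 1 <= b <= a_1(w), over w.  The sum of x f(x) over them has the
   integral of f as its Gauss mean, up to the mass of 1 / (1 + x); the ratio
   with the sum of x then converges to the integral of f. *)
Require Import Defs.
From HB Require Import structures.
From mathcomp Require Import all_boot all_order all_algebra.
From mathcomp Require Import all_classical all_reals all_analysis.
From mathcomp Require Import zify ring lra.
Import Order.TTheory GRing.Theory Num.Theory.
Import numFieldNormedType.Exports.
Set Implicit Arguments.
Unset Strict Implicit.
Unset Printing Implicit Defensive.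
Local Open Scope classical_set_scope.
Local Open Scope ring_scope.

(** * Continuants *)

(** The upper bound on intervals says that limits of the uniform measures on L_X have bounded
    density; being G-invariant, they must be the Gauss measure, by ergodicity. The proof is a
    quantitative form of this: up to truncation errors, the second moment over L_X of a Birkhoff sum
    of length n grows like n X^2 and not like n^2 X^2, so dividing by n makes the mean small. The
    lower bound then absorbs the errors eps X^2 into the size of L_X. Two infinities have to be cut
    off. A Gauss branch exists for every digit, so the transfer operator is truncated to the digits
    up to K. The sum of the weights over a Farey segment is about log a_1, hence unbounded, so it is
    truncated to N terms. What is left out is controlled by the bound X^2 / k for the points of L_X
    with first digit at least k and by estimates of order 1/K for the operator. The weight x is what
    makes Lebesgue measure appear: the Farey map preserves the infinite measure dx / x, and x times
    its density is 1. *)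

(** The matrices with rows (0, 1) and (1, a), for a running through s, multiplied in order and
    applied to the column u. *)
Fixpoint continuant (u : nat * nat) (s : seq nat) : nat * nat :=
  if s is a :: s' then
    let v := continuant u s' in (v.2, a * v.2 + v.1)%N
  else u.

(* The branch of the inverse of the k-th iterate of the Gauss map along the
   word s is y |-> (cnum s + cnum' s * y) / (cden s + cden' s * y). *)
Definition cnum s := (continuant (0, 1)%N s).1.
Definition cden s := (continuant (0, 1)%N s).2.
Definition cnum' s := (continuant (1, 0)%N s).1.
Definition cden' s := (continuant (1, 0)%N s).2.

Notation positive_word := (all (fun a : nat => (0 < a)%N)).

Section Words.
Local Open Scope nat_scope.

Lemma cnum_cons a s : cnum (a :: s) = cden s. Proof. by []. Qed.
Lemma cden_cons a s : cden (a :: s) = a * cden s + cnum s. Proof. by []. Qed.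
Lemma cnum'_cons a s : cnum' (a :: s) = cden' s. Proof. by []. Qed.
Lemma cden'_cons a s : cden' (a :: s) = a * cden' s + cnum' s. Proof. by []. Qed.
Definition cont_consE := (cnum_cons, cden_cons, cnum'_cons, cden'_cons).

Lemma cden_gt0 s : positive_word s -> 0 < cden s.
Proof.
elim: s => //= a s IH /andP[a0 /IH s0].
by rewrite cden_cons addn_gt0 muln_gt0 a0 s0.
Qed.

Lemma cnum_le_cden s : positive_word s -> cnum s <= cden s.
Proof.
case: s => //= a s /andP[a0 _]; rewrite cnum_cons cden_cons.
by rewrite (leq_trans (leq_pmull _ a0)) // leq_addr.
Qed.

Lemma cden'_le_cden s : positive_word s -> cden' s <= cden s.
Proof.
(* The recursion for [cden'] involves [cnum'], so both inequalities are carried along; the one for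
   numerators fails at the empty word, where [cnum'] is 1 and [cnum] is 0. *)
suff: positive_word s -> cden' s <= cden s /\ (0 < size s -> cnum' s <= cnum s).
  by move=> /[apply] -[].
elim: s => //= a s IH /andP[a0 ps]; have [h1 h2] := IH ps.
rewrite !cont_consE; split => //.
case: s {IH} ps h1 h2 => [|b s] ps h1 h2.
  by rewrite /cden' /cden /cnum' /cnum /= muln0 muln1 add0n addn0.
by rewrite leq_add ?leq_mul // h2.
Qed.

(** Each matrix factor has determinant -1; the two parities are separated in order to stay in
    [nat]. *)
Lemma continuant_det s :
  if odd (size s) then cnum s * cden' s = cnum' s * cden s + 1
  else cnum' s * cden s = cnum s * cden' s + 1.
Proof.
elim: s => //= a s; rewrite !cont_consE.
by case: (odd (size s)) => /= ?; nia.
Qed.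

Lemma cnum_eq0 s : positive_word s -> (cnum s == 0) = (s == [::]).
Proof.
by case: s => //= a s /andP[_ /cden_gt0 h]; rewrite cnum_cons eqn0Ngt h.
Qed.

Lemma cnum_eq_cden s : positive_word s -> cnum s = cden s -> s = [:: 1].
Proof.
case: s => //= a s /andP[a0 ps]; rewrite !cont_consE => e.
have h := cden_gt0 ps.
have /eqP : cnum s = 0 by nia.
rewrite cnum_eq0 // => /eqP s0; rewrite s0 in e *.
by congr (_ :: _); move: e; rewrite /cden /cnum /=; lia.
Qed.

Lemma cden_gt1 s : positive_word s -> 1 < size s -> 1 < cden s.
Proof.
case: s => [//|a [//|b s]] /= /and3P[a0 b0 ps] _; rewrite !cont_consE.
have := cden_gt0 ps; nia.
Qed.

(* A rational has one expansion of each parity, differing in whether the last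
   digit is 1. *)
Lemma continuant_inj s t : positive_word s -> positive_word t ->
  odd (size s) = odd (size t) -> cnum s = cnum t -> cden s = cden t -> s = t.
Proof.
elim: s t => [|a s IH] [|b t] //=.
- by move=> _ /andP[_ /cden_gt0 h] _; rewrite cnum_cons => e; rewrite -e in h.
- by move=> /andP[_ /cden_gt0 h] _ _; rewrite cnum_cons => e; rewrite e in h.
move=> /andP[a0 ps] /andP[b0 pt] /negb_inj o; rewrite !cont_consE => e1.
have := cnum_le_cden ps; have := cnum_le_cden pt.
have := cden_gt0 ps; have := cden_gt0 pt; rewrite -e1 => _ h ht hs e2.
have [ab|ab] := eqVneq a b.
  by subst b; congr (_ :: _); apply: IH => //; lia.
(* The values of the two tails lie in [0, 1] and differ by the nonzero integer b - a, so one is 0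
   and the other 1: the tails are empty and [[:: 1]], of different parity. *)
have [[n1 n2]|[n1 n2]] :
    (cnum s = cden s /\ cnum t = 0) \/ (cnum s = 0 /\ cnum t = cden t).
  by rewrite -e1; case: (ltngtP a b) ab => // ab _; nia.
- by move/eqP: n2 o; rewrite cnum_eq0 // => /eqP ->; rewrite (cnum_eq_cden ps n1).
- by move/eqP: n1 o; rewrite cnum_eq0 // => /eqP ->; rewrite (cnum_eq_cden pt n2).
Qed.

(** Euclid's algorithm. The parity is adjusted at the last step, where 1/q is expanded as [q] or as
    [q - 1, 1]. *)
Lemma word_of_fraction p q (b : bool) : 0 < p < q -> coprime p q ->
  exists s, [/\ positive_word s, odd (size s) = b, cnum s = p & cden s = q].
Proof.
elim/ltn_ind: q p b => q IH p b /andP[p0 pq] cpq.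
have e := divn_eq q p; have a0 : 0 < q %/ p by rewrite divn_gt0 // ltnW.
have [r0|r0] := eqVneq (q %% p) 0.
  have p1 : p = 1.
    by move: cpq; rewrite /coprime gcdnC -gcdn_modl r0 gcd0n => /eqP.
  subst p; case: b.
    by exists [:: q]; split => //=; rewrite ?p0 ?andbT //; rewrite /cden /=; lia.
  exists [:: q.-1; 1]; split => //=; first by rewrite andbT; lia.
  by rewrite /cden /=; lia.
have [||s [ps os ns ds]] := IH p pq (q %% p) (~~ b).
- by rewrite lt0n r0 ltn_mod.
- by rewrite /coprime gcdn_modl gcdnC.
exists (q %/ p :: s); split => /=; first by rewrite a0.
- by rewrite os negbK.
- by rewrite cnum_cons.
- by rewrite cden_cons ds ns -e.
Qed.

End Words.

(** * Inverse branches of the iterates of the Gauss map *)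

Section Branches.
Variable R : realType.
Implicit Types (s : seq nat) (x y : R).

Definition branch s y : R := foldr (fun (a : nat) z => (a%:R + z)^-1) y s.
Definition bden s y : R := (cden s)%:R + (cden' s)%:R * y.
Definition bnum s y : R := (cnum s)%:R + (cnum' s)%:R * y.

Lemma branch_cons a s y : branch (a :: s) y = (a%:R + branch s y)^-1.
Proof. by []. Qed.

Lemma bnum_cons a s y : bnum (a :: s) y = bden s y.
Proof. by []. Qed.

Lemma bden_cons a s y : bden (a :: s) y = a%:R * bden s y + bnum s y.
Proof. by rewrite /bden /bnum !cont_consE !natrD !natrM; ring. Qed.

Lemma bden_gt0 s y : positive_word s -> 0 <= y -> 0 < bden s y.
Proof.
move=> ps y0; rewrite /bden ltr_pwDl ?ltr0n ?cden_gt0 //.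
by rewrite mulr_ge0.
Qed.

Lemma bnum_ge0 s y : 0 <= y -> 0 <= bnum s y.
Proof. by move=> y0; rewrite /bnum addr_ge0 ?mulr_ge0. Qed.

Lemma branchE s y : positive_word s -> 0 <= y ->
  branch s y = bnum s y / bden s y.
Proof.
elim: s => [|a s IH] /=.
  by rewrite /bden /bnum /cden /cden' /cnum /cnum' /= => _ _; field.
move=> /andP[a0 ps] y0; rewrite IH // bnum_cons bden_cons.
have h := bden_gt0 ps y0; have n0 := bnum_ge0 s y0.
have a1 : 0 < a%:R :> R by rewrite ltr0n.
have ? : 0 < a%:R * bden s y by rewrite mulr_gt0.
field; rewrite !gt_eqF //.
by rewrite ltr_pwDl.
Qed.

Lemma branch_ge0 s y : 0 <= y -> 0 <= branch s y.
Proof. by move=> y0; elim: s => //= a s IH; rewrite invr_ge0 addr_ge0. Qed.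

Lemma branch_le1 s y : positive_word s -> 0 <= y <= 1 -> branch s y <= 1.
Proof.
case: s => [|a s] /=; first by move=> _ /andP[].
move=> /andP[a0 ps] /andP[y0 y1]; rewrite invf_le1.
  have := branch_ge0 s y0; have : 1 <= a%:R :> R by rewrite ler1n.
  lra.
by rewrite ltr_pwDl ?branch_ge0 ?ltr0n.
Qed.

Lemma branch_oo s y : positive_word s -> 0 < y < 1 -> 0 < branch s y < 1.
Proof.
elim: s => //= a s IH /andP[a0 ps] /(IH ps) /andP[h0 h1].
have a1 : 1 <= a%:R :> R by rewrite ler1n.
by rewrite invr_gt0 invf_lt1; lra.
Qed.

(** An exact formula, because the Moebius map of a word has determinant 1 or -1. *)
Lemma branch_dist s x y : positive_word s -> 0 <= x -> 0 <= y ->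
  `|branch s x - branch s y| = `|x - y| / (bden s x * bden s y).
Proof.
move=> ps x0 y0; rewrite !branchE //.
have h := bden_gt0 ps x0; have h' := bden_gt0 ps y0.
have -> : bnum s x / bden s x - bnum s y / bden s y =
  ((cnum' s)%:R * (cden s)%:R - (cnum s)%:R * (cden' s)%:R) * (x - y)
   / (bden s x * bden s y).
  rewrite /bnum; rewrite /bden in h h' *; field.
  by rewrite !gt_eqF.
rewrite normrM normrM normfV [`|bden s x * _|]gtr0_norm ?mulr_gt0 //.
have := continuant_det s; case: ifP => _ e.
  by rewrite -!natrM e natrD opprD addrA subrr sub0r normrN normr1 mul1r.
by rewrite -!natrM e natrD addrAC subrr add0r normr1 mul1r.
Qed.

Lemma branch_dist0 s y : positive_word s -> 0 <= y <= 1 ->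
  `|branch s y - (cnum s)%:R / (cden s)%:R| <= (cden s)%:R ^- 2.
Proof.
move=> ps /andP[y0 y1]; have h := bden_gt0 ps y0.
have h0 : 0 < (cden s)%:R :> R by rewrite ltr0n cden_gt0.
have -> : (cnum s)%:R / (cden s)%:R = branch s 0 :> R.
  by rewrite branchE // /bnum /bden !mulr0 !addr0.
rewrite branch_dist // subr0 ger0_norm // ler_pdivrMr ?mulr_gt0 ?bden_gt0 //.
rewrite /bden mulr0 addr0 mulrCA mulrC expr2 invfM -!mulrA.
rewrite (mulrA _ _ (_ + _)) mulVf ?gt_eqF // mul1r.
rewrite mulrDr mulVf ?gt_eqF //.
have : 0 <= (cden s)%:R^-1 * ((cden' s)%:R * y) :> R.
  by rewrite mulr_ge0 ?invr_ge0 ?mulr_ge0.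
lra.
Qed.

Lemma branch_contract s x y : positive_word s ->
  0 <= x <= 1 -> 0 <= y <= 1 ->
  `|branch s x - branch s y| <= 2 * 2 ^- (size s).
Proof.
move=> ps /andP[x0 x1] /andP[y0 y1].
(* A single branch 1 / (a + y) need not contract (a = 1, y = 0), but two in a row contract by 1/4.
   The induction therefore carries two consecutive lengths. *)
suff [h1 h2] : `|branch s x - branch s y| <= 2 * 2 ^- (size s) /\
   forall a, (0 < a)%N -> `|branch (a :: s) x - branch (a :: s) y|
     <= 2 * 2 ^- (size s).+1 by [].
elim: s ps => [_|b s IH /andP[b0 ps]]; last first.
  have [h1 h2] := IH ps; split; first by apply: h2.
  move=> a a0; rewrite !branch_cons.
  have := branch_ge0 s x0; have := branch_ge0 s y0; move: h1.
  move: (branch s x) (branch s y) => u v h1 v0 u0.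
  have b1 : 1 <= b%:R :> R by rewrite ler1n.
  have a1 : 1 <= a%:R :> R by rewrite ler1n.
  have bu : 1 <= b%:R + u by lra.
  have bv : 1 <= b%:R + v by lra.
  have au : 2 <= a%:R * (b%:R + u) + 1 by nra.
  have av : 2 <= a%:R * (b%:R + v) + 1 by nra.
  have -> : (a%:R + (b%:R + u)^-1)^-1 - (a%:R + (b%:R + v)^-1)^-1 =
     (u - v) / ((a%:R * (b%:R + u) + 1) * (a%:R * (b%:R + v) + 1)).
    by field; rewrite !gt_eqF //; lra.
  rewrite normrM normfV [X in _ / X <= _]ger0_norm; last by rewrite mulr_ge0; lra.
  rewrite ler_pdivrMr; last by rewrite mulr_gt0; lra.
  apply: (le_trans h1); rewrite /= !exprS !invfM -mulrA ler_pM2l //.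
  set e := 2^- _; have e0 : 0 < e by rewrite invr_gt0 exprn_gt0.
  have : 4 <= (a%:R * (b%:R + u) + 1) * (a%:R * (b%:R + v) + 1).
    by rewrite (_ : 4 = 2 * 2) ?ler_pM //; ring.
  by move: (_ * _) => z z4; nra.
split=> [|a a0] /=.
  by rewrite expr0 invr1 mulr1 ler_norml; apply/andP; split; lra.
rewrite expr1 mulfV // ler_norml.
have h (z : R) : 0 <= z -> 0 <= (a%:R + z)^-1 <= 1.
  move=> z0; have a1 : 1 <= a%:R :> R by rewrite ler1n.
  by apply/andP; split; [rewrite invr_ge0|rewrite invf_le1]; lra.
have /andP[? ?] := h _ x0; have /andP[? ?] := h _ y0.
by apply/andP; split; lra.
Qed.

End Branches.

(** * The Gauss map *)

Section GaussMap.
Variable R : realType.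
Implicit Types (x y z : R) (n m : nat).
Local Notation G := (@gauss R).

Definition dig x : nat := Num.truncn x^-1.

Fixpoint digits n x : seq nat :=
  if n is m.+1 then dig x :: digits m (G x) else [::].

Lemma gauss_ge0 x : 0 <= G x.
Proof.
rewrite /gauss; case: eqP => // _; rewrite subr_ge0.
by have /andP[] := floor_itv x^-1.
Qed.

Lemma gauss_lt1 x : G x < 1.
Proof.
rewrite /gauss; case: eqP => // _; rewrite ltrBlDr.
by have /andP[_] := floor_itv x^-1; rewrite intrD addrC.
Qed.

Lemma gauss0 : G 0 = 0. Proof. by rewrite /gauss eqxx. Qed.

Lemma inv_dig_gauss x : 0 < x -> x^-1 = (dig x)%:R + G x.
Proof.
move=> x0; rewrite /gauss gt_eqF // /dig truncn_floor invr_ge0 ltW //.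
have : 0 <= Num.floor x^-1 by rewrite floor_ge0 invr_ge0 ltW.
by case: (Num.floor x^-1) => //= n _; rewrite addrC -pmulrn subrK.
Qed.

Lemma branch1K x : 0 < x -> ((dig x)%:R + G x)^-1 = x.
Proof. by move=> x0; rewrite -inv_dig_gauss // invrK. Qed.

Lemma dig_gt0 x : 0 < x <= 1 -> (0 < dig x)%N.
Proof. by move=> /andP[x0 x1]; rewrite truncn_gt0 invf_ge1. Qed.

Lemma dig_branch (a : nat) z : 0 <= z < 1 -> dig (a%:R + z)^-1 = a.
Proof.
move=> /andP[z0 z1]; rewrite /dig invrK; apply: truncn_def.
by rewrite lerDl z0 /= -natr1 ltrD2l.
Qed.

Lemma gauss_branch (a : nat) z : (0 < a)%N -> 0 <= z < 1 ->
  G (a%:R + z)^-1 = z.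
Proof.
move=> a0 /[dup] zz /andP[z0 _].
have p0 : 0 < (a%:R + z)^-1 :> R by rewrite invr_gt0 ltr_pwDl ?ltr0n.
by have := inv_dig_gauss p0; rewrite dig_branch // invrK => /addrI.
Qed.

(** These are the irrational points of (0, 1): a rational one reaches 0, where the expansion
    stops. *)
Definition nonterminating x := forall n, 0 < iter n G x < 1.

Lemma nonterminating_gauss x : nonterminating x -> nonterminating (G x).
Proof. by move=> h n; rewrite -iterSr; apply: h. Qed.

Lemma iter_fix_mul (f : R -> R) n m x :
  iter n f x = x -> iter (m * n) f x = x.
Proof. by move=> e; elim: m => //= m IH; rewrite mulSn iterD IH. Qed.

(** An orbit through 0 stays at 0 and cannot return to x; and x, being itself a value of [gauss], is
    below 1. *)
Lemma QG_nonterminating x : QG x -> nonterminating x.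
Proof.
move=> [/[!in_itv]/= /andP[x0 x1] xN0 [n n0 e]].
have Gnz m : iter m G x != 0.
  apply: contra xN0 => /eqP zm; rewrite -(iter_fix_mul m.+1 e).
  have -> : (m.+1 * n = (m.+1 * n - m) + m)%N by rewrite subnK //; nia.
  by rewrite iterD zm iter_fix ?gauss0.
have pos m : (0 < m)%N -> 0 < iter m G x < 1.
  move=> m0; rewrite lt_neqAle eq_sym Gnz /=; case: m m0 => // m _.
  by rewrite iterS gauss_ge0 gauss_lt1.
by case=> [|m]; [rewrite /= -e|]; apply: pos.
Qed.

Lemma QG_oo x : QG x -> 0 < x < 1.
Proof. by move=> /QG_nonterminating/(_ 0%N). Qed.

Lemma QG_per x : QG x -> exists2 n, (0 < n)%N & iter n G x = x.
Proof. by case. Qed.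

Lemma QG_iff x : QG x <->
  0 < x < 1 /\ exists2 n, (0 < n)%N & iter n G x = x.
Proof.
split=> [h|[/andP[x0 x1] p]]; first by split; [apply: QG_oo|apply: QG_per].
by split => //; [rewrite in_itv /= !ltW|rewrite gt_eqF].
Qed.

Lemma QG_gauss x : QG x -> QG (G x).
Proof.
move=> Qx; apply/QG_iff; split.
  exact: (QG_nonterminating Qx 1).
by have [n n0 e] := QG_per Qx; exists n => //; rewrite -iterSr iterS e.
Qed.

Lemma QG_iter n x : QG x -> QG (iter n G x).
Proof. by elim: n => //= n IH /IH/QG_gauss. Qed.

(** If x and y have periods n and m, then nm is a common period, and G^(nm - 1) undoes G on both. *)
Lemma gauss_inj_QG x y : QG x -> QG y -> G x = G y -> x = y.
Proof.
move=> /QG_per[n n0 ex] /QG_per[m m0 ey] e.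
rewrite -(iter_fix_mul m ex) -(iter_fix_mul n ey) mulnC.
have : (0 < n * m)%N by rewrite muln_gt0 n0.
by case: (n * m)%N => // k _; rewrite !iterSr e.
Qed.

Lemma size_digits n x : size (digits n x) = n.
Proof. by elim: n x => //= n IH x; rewrite IH. Qed.

Lemma positive_digits n x : nonterminating x -> positive_word (digits n x).
Proof.
elim: n x => //= n IH x ntx; have /andP[x0 /ltW x1] := ntx 0%N.
by rewrite dig_gt0 ?x0 //= IH //; apply: nonterminating_gauss.
Qed.

Lemma branch_digits n x : nonterminating x ->
  branch (digits n x) (iter n G x) = x.
Proof.
elim: n x => // n IH x ntx; rewrite iterSr branch_cons IH ?branch1K //.
  by have /andP[] := ntx 0%N.
exact: nonterminating_gauss.
Qed.

(** Prepending a digit a multiplies [bden s y] by a + [branch s y], the inverse of the new point. *)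
Lemma bden_digits n x : nonterminating x ->
  bden (digits n x) (iter n G x) = \prod_(0 <= j < n) (iter j G x)^-1.
Proof.
elim: n x => [|n IH] x ntx.
  by rewrite big_geq // /bden /cden /cden' /= mul0r addr0.
have ntGx := nonterminating_gauss ntx.
rewrite big_nat_recl // -/(iter _ _ _) iterSr.
under eq_bigr do rewrite iterSr.
rewrite -IH //; set s := digits n _; set y := iter n _ _.
have y0 : 0 <= y by have /andP[/ltW] := ntGx n.
have h : 0 < bden s y by rewrite bden_gt0 // positive_digits.
have -> : digits n.+1 x = dig x :: s by [].
have eG : branch s y = G x by exact: branch_digits.
rewrite bden_cons (_ : iter 0 G x = x) // inv_dig_gauss; last first.
  by have /andP[] := ntx 0%N.
rewrite mulrDl; congr (_ + _).
by rewrite -eG branchE ?positive_digits // divfK // gt_eqF.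
Qed.

Lemma digits_branch s z : positive_word s -> 0 < z < 1 ->
  digits (size s) (branch s z) = s /\ iter (size s) G (branch s z) = z.
Proof.
elim: s => //= a s IH /andP[a0 ps] z01; have [e1 e2] := IH ps z01.
have /andP[b0 b1] := branch_oo ps z01.
rewrite dig_branch ?(ltW b0) //.
have eG : G (a%:R + branch s z)^-1 = branch s z.
  by rewrite gauss_branch ?(ltW b0).
by rewrite eG e1; split => //; rewrite -iterS iterSr eG.
Qed.

(** * Infinite expansions, minimal even periods and lengths *)

Lemma mkseq_digits n x : mkseq (fun j => dig (iter j G x)) n = digits n x.
Proof.
elim: n x => // n IH x; rewrite /mkseq /= -IH /mkseq.
rewrite -(addn0 1%N) iotaDl -map_comp; congr (_ :: _); apply: eq_map => j.
by rewrite /= -iterS iterSr.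
Qed.

Lemma nonterminating_cfrac x : nonterminating x ->
  is_cfrac (fun j => dig (iter j G x)) x.
Proof.
move=> ntx; split=> [j|].
  by have /andP[? /ltW ?] := ntx j; rewrite dig_gt0 //; apply/andP.
apply/cvgrPdist_le => e e0.
have : geometric (2 : R) 2^-1 n @[n --> \oo] --> 0.
  by apply: cvg_geometric; rewrite ger0_norm ?invr_ge0 // invf_lt1 // ltr1n.
move=> /cvgrPdist_le/(_ _ e0); apply: filterS => n /=.
rewrite sub0r normrN ger0_norm; last by rewrite mulr_ge0 // exprn_ge0 // invr_ge0.
apply: le_trans; rewrite mkseq_digits -{1}(branch_digits n ntx) exprVn.
have /andP[/ltW ? /ltW ?] := ntx n.
rewrite -{4}(size_digits n x) branch_contract ?positive_digits //; last by rewrite lexx ler01.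
by apply/andP.
Qed.

Lemma is_cfrac_itv a x : is_cfrac a x -> 0 < x <= 1.
Proof.
move=> [a0 h].
have h1 : cfrac_fin R (mkseq a n.+1) @[n --> \oo] --> x.
  by rewrite -cvg_shiftS in h.
have pa n : positive_word (mkseq a n) by apply/allP => _ /mapP[j _ ->].
have e n : cfrac_fin R (mkseq a n.+1) =
    ((a 0%N)%:R + cfrac_fin R (mkseq (fun j => a j.+1) n))^-1.
  rewrite /cfrac_fin /mkseq /= -(addn0 1%N) iotaDl -map_comp.
  by congr (_ + foldr _ _ _)^-1; apply: eq_map => j.
have p1 : 0 < (a 0%N)%:R :> R by rewrite ltr0n.
(* [cfrac_fin] is [branch] at 0, so the bounds for branches apply. *)
have b n : 0 <= cfrac_fin R (mkseq (fun j => a j.+1) n) <= 1.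
  rewrite (@branch_ge0 _ _ 0) // (@branch_le1 _ _ 0) ?lexx ?ler01 //.
  by apply/allP => _ /mapP[j _ ->].
apply/andP; split.
  apply: (@lt_le_trans _ _ ((a 0%N)%:R + 1)^-1).
    by rewrite invr_gt0 ltr_wpDr.
  apply: (cvgr_to_ge h1); apply: nearW => n; have /andP[b0 b1] := b n.
  by rewrite e lef_pV2 ?posrE ?lerD2l // ltr_wpDr.
apply: (cvgr_to_le h1); apply: nearW => n.
by apply: (@branch_le1 _ (mkseq a n.+1) 0) => //; rewrite lexx ler01.
Qed.

Lemma is_cfrac_tail a x : is_cfrac a x ->
  is_cfrac (fun j => a j.+1) (x^-1 - (a 0%N)%:R).
Proof.
move=> /[dup] /is_cfrac_itv/andP[x0 _] [a0 h]; split => //.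
have h1 : cfrac_fin R (mkseq a n.+1) @[n --> \oo] --> x.
  by rewrite -cvg_shiftS in h.
have -> : (fun n => cfrac_fin R (mkseq (fun j => a j.+1) n)) =
   (fun n => (cfrac_fin R (mkseq a n.+1))^-1 - (a 0%N)%:R).
  apply/funext => n; rewrite /cfrac_fin /mkseq /= invrK.
  rewrite addrC addKr -(addn0 1%N) iotaDl -map_comp.
  by congr (foldr _ _ _); apply: eq_map => j.
by apply: cvgB; [apply: cvgV => //; rewrite gt_eqF|exact: cvg_cst].
Qed.

(** As a limit, the tail y = 1/x - [a 0] is only known to lie in (0, 1]. The next tail is positive,
    so 1/y > [a 1] >= 1 and y < 1, which makes [a 0] the integer part of 1/x. *)
Lemma is_cfrac_gauss a x : is_cfrac a x -> is_cfrac (fun j => a j.+1) (G x).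
Proof.
move=> h; have h1 := is_cfrac_tail h; have h2 := is_cfrac_tail h1.
have /andP[x0 _] := is_cfrac_itv h; have /andP[y0 _] := is_cfrac_itv h1.
have /andP[z0 _] := is_cfrac_itv h2.
suff <- : x^-1 - (a 0%N)%:R = G x by [].
move: h1 h2 y0 z0; set y := _ - _; set z := _ - _ => h1 h2 y0 z0.
have -> : x = ((a 0%N)%:R + y)^-1 by rewrite addrC subrK invrK.
have a1 : 1 <= (a 1%N)%:R :> R by rewrite ler1n; case: h.
rewrite gauss_branch ?(ltW y0) //; first by case: h.
have : 1 < y^-1 by rewrite /z in z0; lra.
by rewrite invf_gt1.
Qed.

Lemma is_cfrac_iter m a x : is_cfrac a x ->
  is_cfrac (fun j => a (j + m)%N) (iter m G x).
Proof.
elim: m => [|m IH] h; first by under eq_fun do rewrite addn0.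
by under eq_fun do rewrite addnS -addSn; apply: is_cfrac_gauss (IH h).
Qed.

(** Iterating G shifts the digits, and the digits determine the point as a limit. *)
Lemma cfrac_periodE x m : QG x ->
  cfrac_period x m <-> (0 < m)%N /\ iter m G x = x.
Proof.
move=> Qx; split=> [[m0 [a [h per]]]|[m0 e]]; split => //.
  have := is_cfrac_iter m h.
  have -> : (fun j => a (j + m)%N) = a by apply/funext.
  by move=> [_ h1]; case: h => _ h; apply: cvg_unique h1 h.
exists (fun j => dig (iter j G x)); split.
  by apply: nonterminating_cfrac; apply: QG_nonterminating.
by move=> j; rewrite iterD e.
Qed.

Lemma half_min_periodP x : QG x ->
  [/\ (0 < half_min_period x)%N, iter (2 * half_min_period x) G x = x &
   forall m, (0 < m)%N -> iter (2 * m) G x = x -> (half_min_period x <= m)%N].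
Proof.
move=> Qx.
have [k k0 ek] := QG_per Qx.
(* Twice any period is an even period. *)
have ex : exists n, (0 < n)%N && (iter (2 * n) G x == x).
  by exists k; rewrite k0 iter_fix_mul ?ek ?eqxx.
case: (ex_minnP ex) => n /andP[n0 /eqP en] nmin.
have min_n : min_even_period x n.
  split; first by apply/cfrac_periodE => //; rewrite muln_gt0.
  move=> m /cfrac_periodE[] //; rewrite muln_gt0 /= => m0 em.
  by apply: nmin; rewrite m0 em eqxx.
have -> : half_min_period x = n.
  apply: xget_unique => // m [m1 m2]; apply/eqP; rewrite eqn_leq.
  rewrite m2; last by case: min_n.
  by case: min_n => _; apply.
by split => // m m0 em; apply: nmin; rewrite m0 em eqxx.
Qed.

Lemma half_min_period_gauss x : QG x ->
  half_min_period (G x) = half_min_period x.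
Proof.
move=> Qx; have QGx := QG_gauss Qx.
have [h0 e hmin] := half_min_periodP Qx.
have [h0' e' hmin'] := half_min_periodP QGx.
apply/eqP; rewrite eqn_leq hmin' //; last by rewrite -iterSr iterS e.
rewrite hmin //; apply: gauss_inj_QG => //; first exact: QG_iter.
by rewrite -iterS iterSr.
Qed.

(** This is exp([lengthG x] / 2). The index starts at 0 so that [bden_digits] applies; over a full
    period the product is the same as from index 1 on. *)
Definition lam x : R := \prod_(0 <= j < 2 * half_min_period x) (iter j G x)^-1.

Lemma lam_gauss x : QG x -> lam (G x) = lam x.
Proof.
move=> Qx; rewrite /lam half_min_period_gauss //.
have [] := half_min_periodP Qx; case: (half_min_period x) => // h _ e _.
have e2 : (2 * h.+1 = (2 * h).+2)%N by rewrite mulnS.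
rewrite e2 in e *; rewrite big_nat_recr // [RHS]big_nat_recl // mulrC.
have -> : iter (2 * h).+1 G (G x) = x by rewrite -iterSr.
by congr (_ * _); apply: eq_bigr => j _; rewrite iterSr.
Qed.

Lemma lengthGE x : QG x -> lengthG x = 2 * ln (lam x).
Proof.
move=> Qx; have ntx := QG_nonterminating Qx.
rewrite -lam_gauss // /lengthG /lam half_min_period_gauss //.
rewrite big_add1 /= mulNr -mulrN; congr (_ * _).
elim: (2 * _)%N => [|n IH]; first by rewrite !big_geq // ln1 oppr0.
have pos j : 0 < (iter j G (G x))^-1.
  by rewrite invr_gt0 -iterSr; have /andP[] := ntx j.+1.
rewrite !big_nat_recr // lnM ?posrE ?prodr_gt0 // opprD IH.
have p : 0 < iter n G (G x) by rewrite -invr_gt0.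
by rewrite lnV ?posrE // -iterS iterSr.
Qed.

Lemma lam_gt0 x : QG x -> 0 < lam x.
Proof.
move=> Qx; apply: prodr_gt0 => j _; rewrite invr_gt0.
by have /andP[] := QG_nonterminating Qx j.
Qed.

Lemma lengthG_le x (T : R) : QG x -> (lengthG x <= T) = (lam x <= expR (T / 2)).
Proof.
move=> Qx; rewrite lengthGE // mulrC -ler_pdivlMr //.
by rewrite -[in RHS](@lnK _ (lam x)) ?posrE ?lam_gt0 // ler_expR.
Qed.

End GaussMap.

(** * Counting periodic points by their convergents *)

Lemma size_partition (T : eqType) (key : T -> nat) (M : seq T) (m n : nat) :
  {in M, forall u, (m <= key u < n)%N} ->
  size M = (\sum_(m <= q < n) count (fun u => key u == q) M)%N.
Proof.
move=> h; under eq_bigr do rewrite -sum1_count big_mkcond.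
rewrite exchange_big /= -sum1_size; apply: eq_big_seq => u /h/= hu.
rewrite (bigD1_seq (key u)) /= ?iota_uniq ?mem_index_iota //.
by rewrite eqxx big1 // => q /negbTE; rewrite eq_sym => ->.
Qed.

Lemma size_uniq_near (R : realType) (a l : R) (s : seq nat) : 0 <= l -> uniq s ->
  {in s, forall p, a <= p%:R <= a + l} -> (size s)%:R <= l + 1.
Proof.
move=> l0 us h.
have [->|[p0 sp0]] : s = [::] \/ exists p, p \in s.
- by case: s {us h} => [|p s]; [left|right; exists p; rewrite mem_head].
- by rewrite addr_ge0.
case: (ex_minnP (ex_intro (fun p => p \in s) p0 sp0)) => m ms mmin.
have : (size s <= size (iota m (Num.truncn l).+1))%N.
  apply: uniq_leq_size => // p ps; rewrite mem_iota mmin //= addnS ltnS.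
  rewrite -leq_subLR truncn_ge_nat // natrB ?mmin //.
  have := h _ ps; have := h _ ms; lra.
rewrite size_iota -(ler_nat R) => /le_trans; apply.
by rewrite -natr1 lerD2r truncn_le.
Qed.

Section Counting.
Variable R : realType.
Implicit Types (w x : R) (X : R).
Local Notation G := (@gauss R).

Definition period_word w := digits (2 * half_min_period w) w.

Lemma lamE w : QG w -> lam w = bden (period_word w) w.
Proof.
move=> Qw; have [h0 e _] := half_min_periodP Qw.
by rewrite /lam -bden_digits ?e //; apply: QG_nonterminating.
Qed.

Lemma period_word_positive w : QG w -> positive_word (period_word w).
Proof. by move=> Qw; apply/positive_digits/QG_nonterminating. Qed.

Lemma branch_period_word w : QG w -> branch (period_word w) w = w.
Proof.
move=> Qw; have [h0 e _] := half_min_periodP Qw.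
by rewrite -{2}e /period_word branch_digits //; apply: QG_nonterminating.
Qed.

Lemma size_period_word w : size (period_word w) = (2 * half_min_period w)%N.
Proof. by rewrite size_digits. Qed.

Lemma cden_le_lam w : QG w -> (cden (period_word w))%:R <= lam w.
Proof.
move=> Qw; have /andP[w0 _] := QG_oo Qw.
by rewrite lamE // lerDl mulr_ge0 // ltW.
Qed.

Lemma lam_ge2 w : QG w -> 2 <= lam w.
Proof.
move=> Qw; apply: le_trans (cden_le_lam Qw); rewrite ler_nat.
apply: cden_gt1; first exact: period_word_positive.
by rewrite size_period_word; have [] := half_min_periodP Qw; lia.
Qed.

Lemma QG_near_fraction w : QG w ->
  `|w - (cnum (period_word w))%:R / (cden (period_word w))%:R|
     <= (cden (period_word w))%:R ^- 2.
Proof.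
move=> Qw; rewrite -{1}(branch_period_word Qw) branch_dist0 //.
  exact: period_word_positive.
by have /andP[/ltW -> /ltW ->] := QG_oo Qw.
Qed.

(** Both values of [bden] are at least 2, so the branch shrinks the distance of two fixed points by
    1/4. *)
Lemma fixed_branch_unique (s : seq nat) x y : positive_word s -> (1 < size s)%N ->
  0 < x < 1 -> 0 < y < 1 -> branch s x = x -> branch s y = y -> x = y.
Proof.
move=> ps s1 /andP[x0 _] /andP[y0 _] ex ey.
have := branch_dist ps (ltW x0) (ltW y0); rewrite ex ey.
have b (z : R) : 0 < z -> 2 <= bden s z.
  move=> z0; apply: (@le_trans _ _ (cden s)%:R).
    by rewrite ler_nat cden_gt1.
  by rewrite lerDl mulr_ge0 // ltW.
have := b x x0; have := b y y0; set u := bden s x; set v := bden s y => v2 u2.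
have uv : 4 <= u * v by rewrite (_ : 4 = 2 * 2) ?ler_pM //; ring.
move=> /eqP; rewrite eq_sym -subr_eq0 -{2}[`|_|]mulr1 -mulrBr mulf_eq0.
rewrite normr_eq0 subr_eq0 => /orP[/eqP //|]; rewrite subr_eq0 => /eqP e.
by have : (u * v)^-1 < 1 by [rewrite invf_lt1; lra]; rewrite e ltxx.
Qed.

(** Here the even period matters: words of equal parity are determined by their fraction, and the
    point is the only fixed point of the branch of its word. *)
Lemma period_fraction_inj x y : QG x -> QG y ->
  cnum (period_word x) = cnum (period_word y) ->
  cden (period_word x) = cden (period_word y) -> x = y.
Proof.
move=> Qx Qy e1 e2.
have e : period_word x = period_word y.
  apply: continuant_inj; rewrite ?period_word_positive ?size_period_word //.
  by rewrite !mul2n !odd_double.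
apply: (@fixed_branch_unique (period_word x)); rewrite ?QG_oo //.
- exact: period_word_positive.
- by rewrite size_period_word; have [] := half_min_periodP Qx; lia.
- exact: branch_period_word.
- by rewrite e branch_period_word.
Qed.

(** Common scheme of the counts: by injectivity, points are counted through fractions p/q with q <=
    X. [A q p] records what is known about p, and [c q] bounds the number of such p. *)
Lemma size_QG_le (L : seq R) X (A : nat -> nat -> Prop) (c : nat -> R) :
  uniq L ->
  {in L, forall w, [/\ QG w, lam w <= X &
     A (cden (period_word w)) (cnum (period_word w))]} ->
  (forall (q : nat) (s : seq nat), (0 < q)%N -> q%:R <= X -> uniq s ->
     {in s, forall p, A q p} -> (size s)%:R <= c q) ->
  (size L)%:R <= \sum_(1 <= q < (Num.truncn X).+1) c q.
Proof.
move=> uL hL hc.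
have [->|[w0 Lw0]] : L = [::] \/ exists w, w \in L.
- by case: L {uL hL} => [|p s]; [left|right; exists p; rewrite mem_head].
(* For the empty list the claim is that c is nonnegative; [hc] gives this at the empty list of
   numerators. *)
- rewrite big_nat_cond sumr_ge0 // => q /[!andbT] /andP[q1 qX].
  have [X0|/ltW/le_truncn] := leP 0 X; last by rewrite truncn0; lia.
  by apply: (hc q [::]) => //; rewrite -truncn_ge_nat.
have X0 : 0 <= X.
  by have [Qw h _] := hL _ Lw0; apply: le_trans h; apply/ltW/lam_gt0.
pose f w := (cnum (period_word w), cden (period_word w)).
have uM : uniq (map f L).
  rewrite map_inj_in_uniq // => x y /hL[Qx _ _] /hL[Qy _ _] [].
  exact: period_fraction_inj.
rewrite -(size_map f) (@size_partition _ snd _ 1 (Num.truncn X).+1); last first.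
  move=> _ /mapP[w /hL[Qw wX _] ->] /=; rewrite cden_gt0 ?period_word_positive //.
  by rewrite ltnS truncn_ge_nat // (le_trans (cden_le_lam Qw)).
rewrite natr_sum big_nat_cond [leRHS]big_nat_cond; apply: ler_sum => q.
rewrite andbT ltnS => /andP[q1 qX].
rewrite -size_filter -(size_map fst); apply: hc => //.
- by rewrite -truncn_ge_nat.
- rewrite map_inj_in_uniq ?filter_uniq // => -[a b] [a' b'].
  by rewrite !mem_filter /= => /andP[/eqP -> _] /andP[/eqP -> _] ->.
- move=> p /mapP[[a b]]; rewrite mem_filter /= => /andP[/eqP -> /mapP[w /hL[_ _ h]]].
  by move=> [-> ->] ->.
Qed.

Lemma sumr_nat_le X (c : nat -> R) (C : R) : 0 <= X ->
  (forall q : nat, q%:R <= X -> c q <= C) -> 0 <= C ->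
  \sum_(1 <= q < (Num.truncn X).+1) c q <= C * X.
Proof.
move=> X0 h C0.
apply: (@le_trans _ _ (\sum_(1 <= q < (Num.truncn X).+1) C)).
  rewrite big_nat_cond [leRHS]big_nat_cond; apply: ler_sum => q.
  by rewrite andbT ltnS => /andP[_ qX]; apply: h; rewrite -truncn_ge_nat.
rewrite big_const_nat iter_addr_0 subn1 /= -mulr_natr ler_wpM2l //.
by rewrite truncn_le.
Qed.

(** Since |w - p/q| <= q^-2, the numerator p lies within r q + 1 of c q, which leaves at most 2 r q
    + 3 integers for each q <= X. *)
Lemma size_QG_near (L : seq R) X c r : 0 <= r -> 0 <= X -> uniq L ->
  {in L, forall w, [/\ QG w, lam w <= X & `|w - c| <= r]} ->
  (size L)%:R <= 2 * r * X ^+ 2 + 3 * X.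
Proof.
move=> r0 X0 uL hL.
pose A q p := `|p%:R - c * q%:R| <= r * q%:R + 1.
apply: (@le_trans _ _ (\sum_(1 <= q < (Num.truncn X).+1) (2 * r * q%:R + 3))).
  apply: (@size_QG_le L X A) => // [w /hL[Qw wX wc]|q s q0 _ us sA].
    split=> //; rewrite /A; move: (QG_near_fraction Qw).
    have q1 : 1 <= (cden (period_word w))%:R :> R.
      by rewrite ler1n cden_gt0 ?period_word_positive.
    set q : R := (cden _)%:R in q1 *; set p : R := (cnum _)%:R => h.
    have {}h : `|w * q - p| <= 1.
      rewrite -[p](@divfK _ q) ?gt_eqF //; last by lra.
      rewrite -mulrBl normrM [`|q|]ger0_norm; last lra.
      apply: le_trans (ler_wpM2r _ h) _; first lra.
      by rewrite expr2 invfM -mulrA mulVf ?mulr1 ?invf_le1 ?gt_eqF //; lra.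
    have {}wc : `|w * q - c * q| <= r * q.
      by rewrite -mulrBl normrM [`|q|]ger0_norm ?ler_wpM2r //; lra.
    move: h wc; rewrite !ler_norml => /andP[? ?] /andP[? ?].
    by apply/andP; split; lra.
  have rq : 0 <= r * q%:R by rewrite mulr_ge0.
  have := @size_uniq_near R (c * q%:R - (r * q%:R + 1)) (2 * (r * q%:R + 1)) s.
  rewrite mulrDr mulrA => h; apply: le_trans (h _ us _) _; first by lra.
    by move=> p /sA; rewrite /A ler_norml => /andP[? ?]; apply/andP; split; lra.
  by lra.
apply: le_trans (@sumr_nat_le X _ (2 * r * X + 3) X0 _ _) _.
- by move=> q qX; rewrite lerD2r ler_wpM2l // mulr_ge0.
- by rewrite addr_ge0 // !mulr_ge0.
- by rewrite mulrDl expr2 mulrA.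
Qed.

(** A first digit at least k forces p k <= q, so each q <= X admits at most q / k numerators. Unlike
    in [size_QG_near], there is no term linear in X. *)
Lemma size_QG_dig (L : seq R) X (k : nat) : (0 < k)%N -> 0 <= X -> uniq L ->
  {in L, forall w, [/\ QG w, lam w <= X & (k <= dig w)%N]} ->
  (size L)%:R <= X ^+ 2 / k%:R.
Proof.
move=> k0 X0 uL hL.
have k1 : 0 < k%:R :> R by rewrite ltr0n.
pose A q p := (0 < p)%N /\ (p * k <= q)%N.
apply: (@le_trans _ _ (\sum_(1 <= q < (Num.truncn X).+1) (q%:R / k%:R))).
  apply: (@size_QG_le L X A) => // [w /hL[Qw wX wk]|q s q0 _ us sA].
    split=> //; have := period_word_positive Qw; rewrite /period_word.
    have [] := half_min_periodP Qw; case e : (2 * half_min_period w)%N => [|n].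
      by move=> h; move: e; lia.
    move=> _ _ _; have -> : digits n.+1 w = dig w :: digits n (G w) by [].
    move=> /andP[_ ps]; rewrite /A cnum_cons cden_cons cden_gt0 //.
    by split => //; nia.
  rewrite ler_pdivlMr // -natrM ler_nat.
  suff : (size s <= size (iota 1 (q %/ k)))%N by rewrite size_iota leq_divRL.
  apply: uniq_leq_size => // p /sA[p0 pk].
  by rewrite mem_iota p0 add1n ltnS leq_divRL.
apply: le_trans (@sumr_nat_le X _ (X / k%:R) X0 _ _) _.
- by move=> q qX; rewrite ler_pM2r // invr_gt0.
- by rewrite divr_ge0 // ltW.
- by rewrite expr2 mulrAC.
Qed.

Definition QGX X := [set w : R | QG w /\ lam w <= X].

Lemma finite_QGX X : finite_set (QGX X).
Proof.
apply: contrapT => inf; have [X0|X0] := leP 0 X; last first.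
  apply: inf; apply: (sub_finite_set _ (finite_set0 R)) => w [Qw wX].
  by have := le_lt_trans wX X0; rewrite ltNge ltW // lam_gt0.
(* A finite subset has at most X^2 elements, by [size_QG_dig] with k = 1. *)
have [B BQ sB] := infinite_set_fset (Num.truncn (X ^+ 2 / 1%:R)).+1 inf.
have : (size (finmap.enum_fset B))%:R <= X ^+ 2 / 1%:R :> R.
  apply: size_QG_dig => //; first exact: finmap.fset_uniq.
  move=> w wB; have [Qw wX] := BQ w wB.
  split => //; have /andP[? /ltW ?] := QG_oo Qw.
  by rewrite dig_gt0 //; apply/andP.
rewrite -truncn_ge_nat; last by rewrite divr_ge0 // exprn_ge0.
by move=> h; have := leq_trans sB h; rewrite ltnn.
Qed.

Definition LX X : seq R := finmap.enum_fset (fset_set (QGX X)).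

Lemma LX_uniq X : uniq (LX X).
Proof. exact: finmap.fset_uniq. Qed.

Lemma mem_LX X w : w \in LX X <-> QG w /\ lam w <= X.
Proof.
have := in_fset_set (finite_QGX X) w; rewrite /LX => ->.
by split => [/set_mem|]; [|move=> h; apply/mem_set].
Qed.

Lemma perm_LX_gauss X : perm_eq (map G (LX X)) (LX X).
Proof.
have u : uniq (map G (LX X)).
  rewrite map_inj_in_uniq ?LX_uniq // => x y /mem_LX[Qx _] /mem_LX[Qy _].
  exact: gauss_inj_QG.
apply: uniq_perm => //; first exact: LX_uniq.
have sub : {subset map G (LX X) <= LX X}.
  move=> _ /mapP[w /mem_LX[Qw wX] ->]; apply/mem_LX.
  by rewrite lam_gauss //; split => //; apply: QG_gauss.
have /(uniq_min_size u sub)[] // : (size (LX X) <= size (map G (LX X)))%N.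
by rewrite size_map.
Qed.

Lemma sum_LX_gauss X (F : R -> R) :
  \sum_(w <- LX X) F (G w) = \sum_(w <- LX X) F w.
Proof. by rewrite -(big_map G xpredT F); exact/perm_big/perm_LX_gauss. Qed.

Lemma size_LX_le X : 1 <= X -> (size (LX X))%:R <= X ^+ 2.
Proof.
move=> X1; rewrite -[leRHS]divr1 -[1]/1%:R; apply: size_QG_dig => //.
- lra.
- exact: LX_uniq.
move=> w /mem_LX[Qw wX]; split => //; have /andP[? /ltW ?] := QG_oo Qw.
by rewrite dig_gt0 //; apply/andP.
Qed.

End Counting.

(** * The Farey map *)

Section FareyMap.
Variable R : realType.
Implicit Types (w x z : R) (X T : R).
Local Notation G := (@gauss R).
Local Notation F := (@farey R).

Lemma farey0 : F 0 = 0.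
Proof. by rewrite /farey invr_ge0 ler0n mul0r. Qed.

Lemma farey_branchS (a : nat) z : 0 <= z ->
  F ((a.+2)%:R + z)^-1 = (a.+1%:R + z)^-1.
Proof.
move=> z0; have a0 : 0 <= a%:R :> R by [].
rewrite /farey -!natr1 lef_pV2 ?posrE; [|lra|lra].
case: ifP => [_|]; last by move/negbT; rewrite -ltNge; lra.
by field; rewrite !gt_eqF //; lra.
Qed.

Lemma farey_branch1 z : 0 <= z < 1 -> F (1%:R + z)^-1 = z.
Proof.
move=> /andP[z0 z1]; rewrite /farey lef_pV2 ?posrE; [|lra|lra].
case: ifP => [|_]; first lra.
by rewrite invrK; field; rewrite gt_eqF //; lra.
Qed.

Lemma farey_iter_branch (a b : nat) z : (b <= a)%N -> 0 <= z ->
  iter b F (a.+1%:R + z)^-1 = ((a - b).+1%:R + z)^-1.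
Proof.
move=> ba z0; elim: b ba => [|b IH] ba; first by rewrite subn0.
rewrite iterS IH; last exact: ltnW.
have -> : ((a - b).+1 = (a - b.+1).+2)%N by lia.
exact: farey_branchS.
Qed.

Lemma farey_iter_branch_last (a : nat) z : (0 < a)%N -> 0 <= z < 1 ->
  iter a F (a%:R + z)^-1 = z.
Proof.
case: a => // a _ /[dup] h /andP[z0 _].
by rewrite iterS farey_iter_branch // subnn farey_branch1.
Qed.

(** F lowers the first digit by one while it is at least 2, and acts as G when it is 1. *)
Lemma farey_iter_dig x : 0 < x <= 1 -> iter (dig x) F x = G x.
Proof.
move=> h; have /andP[x0 _] := h; rewrite -{2}(branch1K x0).
by rewrite farey_iter_branch_last ?dig_gt0 // gauss_ge0 gauss_lt1.
Qed.

(** The bound [n <= m] keeps a Farey period positive when it is derived from a Gauss period. *)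
Lemma gauss_iter_farey_iter n x : 0 <= x <= 1 ->
  exists2 m, (n <= m)%N & iter n G x = iter m F x.
Proof.
elim: n x => [|n IH] x x01; first by exists 0%N.
have [|m nm e] := IH (G x); first by rewrite gauss_ge0 ltW // gauss_lt1.
have [x0|x0] := eqVneq x 0.
  by exists n.+1 => //; rewrite x0 !iter_fix ?gauss0 ?farey0.
have h : 0 < x <= 1 by have /andP[? ->] := x01; rewrite lt_neqAle eq_sym x0 andbT.
exists (m + dig x)%N; first by have := dig_gt0 h; lia.
by rewrite iterSr e -farey_iter_dig // iterD.
Qed.

(** j counts the completed Gauss steps, b the steps inside the current segment. That one of them is
    positive rules out a trivial return in [QF_QG]. *)
Lemma farey_iter_decomp k x : nonterminating x ->
  exists j b, [/\ (b < dig (iter j G x))%N, (0 < k -> 0 < j + b)%N &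
    iter k F x = iter b F (iter j G x)].
Proof.
move=> ntx; have dg j : (0 < dig (iter j G x))%N.
  by have /andP[? /ltW ?] := ntx j; rewrite dig_gt0 //; apply/andP.
elim: k => [|k [j [b [bd _ e]]]]; first by exists 0%N, 0%N.
have [bd'|] := ltnP b.+1 (dig (iter j G x)).
  by exists j, b.+1; split; rewrite ?addnS //; apply: (congr1 F e).
move=> bd'; have db : dig (iter j G x) = b.+1 by apply/eqP; rewrite eqn_leq bd' bd.
exists j.+1, 0%N; split=> //.
rewrite [LHS](congr1 F e) -iterS -db farey_iter_dig //.
by have /andP[-> /ltW] := ntx j.
Qed.

Lemma farey_iter_lt_dig w b : 0 < w <= 1 -> (b < dig w)%N ->
  iter b F w = ((dig w - b)%:R + G w)^-1.
Proof.
move=> w01 bd; have /andP[w0 _] := w01; rewrite -{1}(branch1K w0).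
case: (dig w) bd => // a; rewrite ltnS => ba.
by rewrite farey_iter_branch ?gauss_ge0 // subSn.
Qed.

Lemma gauss_farey_iter w b : 0 < w <= 1 -> (b < dig w)%N ->
  G (iter b F w) = G w.
Proof.
move=> w01 bd; rewrite farey_iter_lt_dig // gauss_branch ?subn_gt0 //.
by rewrite gauss_ge0 gauss_lt1.
Qed.

Lemma QG_itv w : QG w -> 0 < w <= 1.
Proof. by move/QG_oo => /andP[-> /ltW]. Qed.

Lemma QG_QF w b : QG w -> (b < dig w)%N -> QF (iter b F w).
Proof.
move=> Qw bd; have w01 := QG_itv Qw.
have p : 1 <= (dig w - b)%:R :> R by rewrite ler1n subn_gt0.
have g0 := gauss_ge0 w.
have e := farey_iter_lt_dig w01 bd.
split.
- rewrite e in_itv /= invr_ge0 invf_le1; last lra.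
  by apply/andP; split; lra.
- by rewrite e gt_eqF // invr_gt0; lra.
have [n n0 en] := QG_per Qw.
have [|m nm em] := gauss_iter_farey_iter n (x := w).
  by have /andP[/ltW -> ->] := w01.
exists m; first exact: leq_trans nm.
by rewrite -iterD addnC iterD -em en.
Qed.

Lemma QF_nonterminating x : QF x -> nonterminating x.
Proof.
move=> [/[!in_itv]/= x01 xN0 [N N0 e]].
have Gnz m : iter m G x != 0.
  apply: contra xN0 => /eqP zm; have [k mk ek] := gauss_iter_farey_iter m x01.
  rewrite -(iter_fix_mul k.+1 e).
  have -> : (k.+1 * N = (k.+1 * N - k) + k)%N by rewrite subnK //; nia.
  by rewrite iterD -ek zm iter_fix ?farey0.
case=> [|m]; last by rewrite lt_neqAle eq_sym Gnz iterS gauss_ge0 gauss_lt1.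
have /andP[x0 x1] := x01; rewrite /= lt_neqAle eq_sym xN0 x0 /= lt_neqAle x1 andbT.
apply: contra (Gnz 1%N) => /eqP ->; apply/eqP => /=.
have := @gauss_branch R 1%N 0 isT; rewrite addr0 mulr1n invr1; apply.
by rewrite lexx ltr01.
Qed.

(** Write F^N x = x as b Farey steps after j Gauss steps. If j = 0, the first digit of x would drop
    by b > 0. Otherwise x and G^j x have the same image under G, so G x is Gauss-periodic, although
    x itself need not be, and w = G^j x works. *)
Lemma QF_QG x : QF x -> exists w b, [/\ QG w, (b < dig w)%N & x = iter b F w].
Proof.
move=> Qx; have ntx := QF_nonterminating Qx; have [_ _ [N N0 e]] := Qx.
have [j [b [bd /(_ N0) b0]]] := farey_iter_decomp N ntx; rewrite e => ex.
have itv m : 0 < iter m G x <= 1 by have /andP[-> /ltW] := ntx m.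
case: j bd b0 ex => [|j] /= bd b0 ex.

  have := farey_iter_lt_dig (itv 0%N) bd; rewrite /= -ex.
  have /= /andP[x0 _] := itv 0%N.
  move/(congr1 (fun y => y^-1)); rewrite invrK inv_dig_gauss // => /addIr/eqP.
  by rewrite eqr_nat; move: bd => /=; lia.
exists (iter j.+1 G x), b; split => //.
have eG : iter j.+1 G (G x) = G x.
  by rewrite -iterSr iterS -(gauss_farey_iter (itv j.+1) bd) /= -ex.
have QGx : QG (G x) by apply/QG_iff; split; [apply: (ntx 1%N)|exists j.+1].
by rewrite iterSr; apply: QG_iter.
Qed.

Lemma lengthG_iter j w : QG w -> lengthG (iter j G w) = lengthG w.
Proof.
elim: j => //= j IH Qw; have Qj := QG_iter j Qw.
by rewrite -(IH Qw) !lengthGE ?lam_gauss //; apply: QG_gauss.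
Qed.

(** Whatever w' the choice returns, w and some G^j w' have the same image under G, hence coincide,
    and [lengthG] is constant along a Gauss orbit. *)
Lemma lengthF_iter w b : QG w -> (b < dig w)%N ->
  lengthF (iter b F w) = lengthG w.
Proof.
move=> Qw bd; rewrite /lengthF; case: xgetP => [w' _ [Qw' [k e]]|]; last first.
  by move=> /(_ w); case; split => //; exists b.
have [j [b' [bd' _]]] := farey_iter_decomp k (QG_nonterminating Qw').
rewrite e => /(congr1 G); rewrite !gauss_farey_iter ?QG_itv //; last exact: QG_iter.
by move/(gauss_inj_QG Qw (QG_iter j Qw')) ->; rewrite lengthG_iter.
Qed.

Lemma QFT_iter T x : QFT T x <->
  exists w b, [/\ w \in LX (expR (T / 2)), (b < dig w)%N & x = iter b F w].
Proof.
split=> [[Qx]|[w [b [/mem_LX[Qw wX] bd ->]]]].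
  have [w [b [Qw bd ->]]] := QF_QG Qx; rewrite lengthF_iter // lengthG_le // => h.
  by exists w, b; split => //; apply/mem_LX.
by split; [apply: QG_QF|rewrite lengthF_iter // lengthG_le].
Qed.

(** F^(dig w - b) w has first digit b and tail G w. Distinct pairs (w, b) give distinct points: G
    recovers G w, hence w by injectivity on [QG], and then b. *)
Lemma sum_QFT T (psi : R -> R) :
  \sum_(x \in QFT T) psi x =
  \sum_(w <- LX (expR (T / 2))) \sum_(1 <= b < (dig w).+1) psi (b%:R + G w)^-1.
Proof.
set L := LX _.
pose s := [seq (b%:R + G w)^-1 | w <- L, b <- iota 1 (dig w)].
have us : uniq s.
  apply: allpairs_uniq_dep.
  - exact: LX_uniq.
  - by move=> w _; apply: iota_uniq.
  move=> [w b] [w' b'] /allpairsPdep[w1 [b1 [w1L b1d [-> ->]]]].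
  move=> /allpairsPdep[w2 [b2 [w2L b2d [-> ->]]]] /= e.
  have /mem_LX[Q1 _] := w1L; have /mem_LX[Q2 _] := w2L.
  move: b1d b2d; rewrite !mem_iota => /andP[b11 _] /andP[b21 _].
  have := congr1 G e; rewrite !gauss_branch ?gauss_ge0 ?gauss_lt1 //.
  move/(gauss_inj_QG Q1 Q2) => ew; subst w2.
  move/invr_inj/addIr/eqP: e; rewrite eqr_nat => /eqP ->.
  by [].
have -> : QFT T = [set` s].
  apply/seteqP; split => [x /QFT_iter[w [b [wL bd ->]]]|x /= /allpairsPdep[w [b [wL]]]] /=.
    have /mem_LX[Qw _] := wL.
    apply/allpairsPdep; exists w, (dig w - b)%N; split => //.
      by rewrite mem_iota; lia.
    by rewrite farey_iter_lt_dig // QG_itv.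
  have /mem_LX[Qw _] := wL; rewrite mem_iota => bd ->.
  apply/QFT_iter; exists w, (dig w - b)%N; split => //; first lia.
  rewrite farey_iter_lt_dig ?QG_itv //; last lia.
  by congr (_%:R + _)^-1; lia.
rewrite -fsbig_seq // big_allpairs_dep; apply: eq_bigr => w _.
by rewrite /index_iota subn1.
Qed.

End FareyMap.

(** * Lower bound for the number of periodic points *)

Section LowerBound.
Variable R : realType.
Implicit Types (w x : R) (X : R).
Local Notation G := (@gauss R).

Lemma prod_iter_mul (f : R -> R) (F : R -> R) n k x : iter n f x = x ->
  \prod_(0 <= j < k * n) F (iter j f x) =
  (\prod_(0 <= j < n) F (iter j f x)) ^+ k.
Proof.
move=> e; elim: k => [|k IH]; first by rewrite mul0n big_geq // expr0.
rewrite mulSn (@big_cat_nat _ _ _ n) //= ?leq_addr // exprS; congr (_ * _).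
rewrite -IH -{1}[n]add0n big_addn addKn; apply: eq_bigr => j _.
by rewrite iterD e.
Qed.

Lemma periodic_point_of_word (s : seq nat) :
  positive_word s -> (1 < size s)%N -> exists2 w : R, QG w & branch s w = w.
Proof.
move=> ps s1.
have q0 := cden_gt0 ps.
(* P clears the denominator in [branch s w = w]; its values at 0 and 1 are -p and (q - p) + (q' -
   p'). *)
pose P : {poly R} := (cden' s)%:R *: 'X^2
  + ((cden s)%:R - (cnum' s)%:R) *: 'X - (cnum s)%:R%:P.
have PE y : P.[y] = (cden' s)%:R * y ^+ 2
   + ((cden s)%:R - (cnum' s)%:R) * y - (cnum s)%:R.
  by rewrite /P !hornerE.
have p'q' : (cnum' s <= cden' s)%N.
  case: s ps s1 {q0 P PE} => // a s /andP[a0 ps] _; rewrite !cont_consE.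
  by rewrite (leq_trans (leq_pmull _ a0)) // leq_addr.
have [||w /andP[w0 w1]] := @poly_ivt R P 0 1 => //.
  rewrite !PE expr0n mulr0 mulr0 !add0r expr1n !mulr1 oppr_le0 ler0n /=.
  have : (cnum' s)%:R <= (cden' s)%:R :> R by rewrite ler_nat.
  have : (cnum s)%:R <= (cden s)%:R :> R by rewrite ler_nat cnum_le_cden.
  by lra.
rewrite /root PE => /eqP ew.
have bw : branch s w = w.
  have h := bden_gt0 ps w0; rewrite branchE //.
  apply: (canLR (mulfK (lt0r_neq0 h))).
  apply/eqP; rewrite eq_sym -subr_eq0 -ew; apply/eqP.
  by rewrite /bden /bnum; ring.
exists w => //.
have w01 : 0 < w < 1.
  case: s ps s1 bw {q0 P PE p'q' ew} => [//|a [//|b s]] /and3P[a0 b0 ps] _ <-.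
  rewrite !branch_cons.
  have h := branch_ge0 s w0.
  have a1 : 1 <= a%:R :> R by rewrite ler1n.
  have b1 : 1 <= b%:R :> R by rewrite ler1n.
  have h1 : 0 < (b%:R + branch s w)^-1 by rewrite invr_gt0; lra.
  by apply/andP; split; [rewrite invr_gt0|rewrite invf_lt1]; lra.
apply/QG_iff; split => //; exists (size s); first exact: ltnW.
by have [_] := digits_branch ps w01; rewrite bw.
Qed.

Lemma dvdn_half_min_period w m : QG w -> iter (2 * m) G w = w ->
  (half_min_period w %| m)%N.
Proof.
move=> Qw e; have [h0 eh hmin] := half_min_periodP Qw.
rewrite /dvdn; case: (posnP (m %% half_min_period w)) => // r0.
have : iter (2 * (m %% half_min_period w)) G w = w.
  move: e; rewrite {1}(divn_eq m (half_min_period w)) mulnDr addnC iterD.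
  by rewrite mulnCA (iter_fix_mul _ eh).
by move=> /(hmin _ r0); rewrite leqNgt ltn_mod h0.
Qed.

(** The even word of p/q is the minimal word of its fixed point w repeated k times, so [lam w ^+ k]
    equals q + q' w, where q' <= q and w < 1. *)
Lemma fraction_QG p q : (0 < p < q)%N -> coprime p q ->
  exists (w : R) k, let s := digits (k * (2 * half_min_period w)) w in
   [/\ QG w, (0 < k)%N, cnum s = p, cden s = q & lam w ^+ k <= 2 * q%:R].
Proof.
move=> pq cpq; have [s [ps os ns ds]] := @word_of_fraction p q false pq cpq.
have s1 : (1 < size s)%N.
  case: s os ns ds {ps} => [_|a [//|//]]; rewrite /cnum /= => e.
  by rewrite -e in pq.
have [w Qw bw] := periodic_point_of_word ps s1.
have /andP[w0 w1] := QG_oo Qw.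
have [e1 e2] := digits_branch ps (QG_oo Qw); rewrite bw in e1 e2.
have es : size s = (2 * (size s)./2)%N.
  by rewrite mul2n -[LHS]odd_double_half os.
rewrite es in e2; have /dvdnP[k ek] := dvdn_half_min_period Qw e2.
have sz : size s = (k * (2 * half_min_period w))%N by rewrite es ek mulnCA.
exists w, k; rewrite -sz e1; split => //.
  by case: k sz {ek} => // sz; rewrite sz in s1.
have [_ e _] := half_min_periodP Qw.
rewrite /lam -(@prod_iter_mul G (fun x => x^-1)) // -sz.
rewrite -bden_digits; last exact: QG_nonterminating.
rewrite e1 es e2 /bden -ds [leRHS]mulr_natl mulr2n lerD2l.
apply: (@le_trans _ _ (cden' s)%:R); last by rewrite ler_nat cden'_le_cden.
by rewrite ler_piMr // ltW.
Qed.

(** A pair (a, b) will stand for the reduced fraction a / (a + b), which lies in (0, 1) and has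
    denominator at most 2N. *)
Definition coprime_pairs (N : nat) : seq (nat * nat) :=
  [seq u <- allpairs pair (iota 1 N) (iota 1 N) | coprime u.1 u.2].

Lemma sum_inv_sqr_le (N : nat) :
  \sum_(2 <= g < N.+1) (g%:R ^- 2 : R) <= 3 / 4.
Proof.
(* The term 1/4 at g = 2, then g^-2 <= 1/(g - 1) - 1/g. *)
suff h n : \sum_(2 <= g < n.+3) (g%:R ^- 2 : R) <= 3 / 4 - (n.+2)%:R^-1.
  case: N => [|[|n]]; [by rewrite big_geq //; lra|by rewrite big_geq //; lra|].
  by apply: le_trans (h n) _; rewrite gerBl invr_ge0.
elim: n => [|n IH]; first by rewrite big_nat1; lra.
rewrite big_nat_recr //=; apply: le_trans (lerD IH (lexx _)) _.
have -> : n.+3%:R = n%:R + 3 :> R by rewrite -natrD addn3.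
have -> : n.+2%:R = n%:R + 2 :> R by rewrite -natrD addn2.
have : 0 <= n%:R :> R by [].
move: (n%:R : R) => t t0.
rewrite -subr_ge0.
have -> : 3 / 4 - (t + 3)^-1 - (3 / 4 - (t + 2)^-1 + (t + 3) ^- 2)
  = (t + 2)^-1 * (t + 3) ^- 2 :> R.
  by field; rewrite !gt_eqF //; lra.
by rewrite mulr_ge0 ?invr_ge0 ?exprn_ge0; lra.
Qed.

(** Union bound over the common divisors g >= 2: at most (N / g)^2 pairs are divisible by g, and the
    sum of g^-2 is at most 3/4. *)
Lemma size_coprime_pairs N : (N%:R ^+ 2) / 4 <= (size (coprime_pairs N))%:R :> R.
Proof.
have dvdc g : \sum_(1 <= p < N.+1) ((g %| p)%N%:R : R) <= N%:R / g%:R.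
  have [->|g0] := posnP g.
    rewrite invr0 mulr0 big_nat big1 // => p /andP[p0 _].
    by rewrite dvd0n gtn_eqF.
  rewrite -natr_sum -divn_count_dvd ler_pdivlMr ?ltr0n // -natrM ler_nat.
  exact: leq_trunc_div.
have -> : (size (coprime_pairs N))%:R =
   \sum_(1 <= p < N.+1) \sum_(1 <= q < N.+1) ((coprime p q)%:R : R).
  rewrite size_filter -sum1_count natr_sum big_mkcond big_allpairs /=.
  rewrite /index_iota subn1; apply: eq_bigr => p _; apply: eq_bigr => q _.
  by case: coprime.
have : \sum_(1 <= p < N.+1) \sum_(1 <= q < N.+1) (1 : R) <=
   \sum_(1 <= p < N.+1) \sum_(1 <= q < N.+1) ((coprime p q)%:R : R) +
   \sum_(2 <= g < N.+1) \sum_(1 <= p < N.+1) \sum_(1 <= q < N.+1)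
     (((g %| p)%N%:R : R) * (g %| q)%N%:R).
  rewrite exchange_big /= [X in _ + X]exchange_big /=.
  under [X in _ + X]eq_bigr do rewrite exchange_big /=.
  rewrite exchange_big -big_split /=; rewrite big_nat [leRHS]big_nat.
  apply: ler_sum => p /andP[p1 pN]; rewrite -big_split /=.
  rewrite big_nat [leRHS]big_nat; apply: ler_sum => q /andP[q1 qN].
  have [cpq|ncpq] := boolP (coprime p q).
    by rewrite lerDl sumr_ge0 // => g _; rewrite mulr_ge0.
  rewrite add0r (bigD1_seq (gcdn p q)) /= ?iota_uniq //.
    by rewrite dvdn_gcdl dvdn_gcdr mulr1 lerDl sumr_ge0 // => g _; rewrite mulr_ge0.
  rewrite mem_index_iota; apply/andP; split.
    by rewrite ltn_neqAle eq_sym ncpq gcdn_gt0 p1.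
  by apply: leq_ltn_trans pN; rewrite dvdn_leq // dvdn_gcdl.
set C := (X in _ <= X + _).
rewrite !big_const_nat !iter_addr_0 !subn1 /= -mulrnA.
set S := (X in _ <= _ + X) => h.
have : S <= N%:R ^+ 2 * (3 / 4).
  apply: (@le_trans _ _ (\sum_(2 <= g < N.+1) N%:R ^+ 2 * g%:R ^- 2)).
    apply: ler_sum => g _; under eq_bigr do rewrite -mulr_sumr.
    rewrite -mulr_suml -exprVn -exprMn -expr2 lerXn2r ?nnegrE ?sumr_ge0 ?divr_ge0 //.
  by rewrite -mulr_sumr ler_wpM2l ?exprn_ge0 ?sum_inv_sqr_le.
by rewrite natrM -expr2 in h; rewrite -/C; move: h; lra.
Qed.

(** With N about X / 4, the denominators q = a + b are at most X / 2, so [fraction_QG] gives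
    [lam w ^+ k] <= 2q <= X. If k = 1, then w is in [LX X]. If k >= 2, then w is in [LX r], r the
    square root of X, and k <= 2r, which accounts for at most X (2r + 1) of the N^2 / 4, about X^2 /
    64, fractions. *)
Lemma size_LX_ge X : 300 ^+ 2 <= X -> X ^+ 2 / 128 <= (size (LX X))%:R.
Proof.
move=> X0; set r := Num.sqrt X.
have {}X0 : 300 ^+ 2 <= X /\ 300 <= X.
  by split => //; apply: le_trans X0; rewrite ler_eXnr // ler1n.
have [X1 X2] := X0.
have rr : r ^+ 2 = X by rewrite sqr_sqrtr //; lra.
have r0 : 300 <= r.
  by rewrite -(@ler_pXn2r _ 2) ?nnegrE ?ler0n ?sqrtr_ge0 ?rr.
clear X0 X1.
pose N := Num.truncn (X / 4).
have /andP[N1 N2] : N%:R <= X / 4 < N.+1%:R by apply: truncn_itv; lra.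
have [K eK] : exists K, K = (Num.truncn (2 * r)).+1 by eexists.
have : (size (coprime_pairs N) <= size (LX X) + size (LX r) * K)%N.
  have /choice[f hf] : forall u : nat * nat, exists v : R * nat,
      u \in coprime_pairs N ->
      let s := digits (v.2 * (2 * half_min_period v.1)) v.1 in
   [/\ QG v.1, (0 < v.2)%N, cnum s = u.1, cden s = (u.1 + u.2)%N & lam v.1 ^+ v.2 <= X].
    move=> u; have [|/negP uP] := boolP (u \in coprime_pairs N); last by exists (0, 0%N).
    rewrite mem_filter => /andP[cu /allpairsP[[a b] /=]].
    rewrite !mem_iota => -[/andP[a1 aN] /andP[b1 bN] eu].
    have [||w [k [Qw k0 nw dw lw]]] := @fraction_QG u.1 (u.1 + u.2).
    - by rewrite eu /=; lia.
    - by rewrite /coprime gcdnDl.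
    exists (w, k) => _; split => //; apply: le_trans lw _.
    rewrite eu natrD.
    have : a%:R <= N%:R :> R by rewrite ler_nat; lia.
    have : b%:R <= N%:R :> R by rewrite ler_nat; lia.
    by move=> /=; lra.
  rewrite -(size_map f).
  rewrite -(size_map (fun w : R => (w, 1%N)) (LX X)).
  rewrite -[K](size_iota 0) -(size_allpairs pair) -size_cat.
  apply: uniq_leq_size.
    rewrite map_inj_in_uniq.
      by rewrite filter_uniq // allpairs_uniq ?iota_uniq // => -[a b] [a' b'].
    move=> [a b] [a' b'] /hf/= [_ _ n1 d1 _] /hf/= [_ _ n2 d2 _] e.
    by rewrite e n2 in n1; rewrite e d2 in d1; congr (_, _); lia.
  move=> _ /mapP[u /hf/= [Qw k0 _ _ lw] ->].
  rewrite mem_cat; have l2 := lam_ge2 Qw.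
  have [k1|k1] := eqVneq (f u).2 1%N.
    apply/orP; left; apply/mapP; exists (f u).1.
      by apply/mem_LX; split => //; move: lw; rewrite k1.
    by rewrite -k1; case: (f u).
  apply/orP; right; rewrite [f u]surjective_pairing; apply: allpairs_f.
  - apply/mem_LX; split => //.
    rewrite -(@ler_pXn2r _ 2) ?nnegrE ?sqrtr_ge0 ?(ltW (lam_gt0 Qw)) //.
    rewrite rr; apply: le_trans lw; apply: ler_weXn2l; first lra.
    by rewrite ltn_neqAle eq_sym k1.
  - rewrite mem_iota /= add0n eK ltnS truncn_ge_nat; last lra.
    move: (f u).2 lw => k lw.
    (* As [lam] is at least 2, 2^k <= X; with this crude bound, k^2 <= 4X and k <= 2r. *)
    have : ((k ^ 2 <= 4 * 2 ^ k)%N).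
      elim: k {lw} => // -[|[|[|k]]] // IH.
      by rewrite (expnS 2 k.+3); rewrite -!mulnn in IH *; nia.
    rewrite -(ler_nat R) natrX natrM natrX => h.
    rewrite -(@ler_pXn2r _ 2) ?nnegrE //; last lra.
    apply: le_trans h _; rewrite exprMn rr -[2 ^+ 2]/(2 * 2) -natrM ler_pM2l //.
    by apply: le_trans lw; rewrite lerXn2r ?nnegrE ?(ltW (lam_gt0 Qw)).
rewrite -(ler_nat R) natrD natrM; have := size_coprime_pairs N.
have : (size (LX r))%:R <= r ^+ 2 by apply: size_LX_le; lra.
have : K%:R <= 2 * r + 1 by rewrite eK -natr1 lerD2r truncn_le; lra.
rewrite rr; set k : R := K%:R; set a : R := (size (LX r))%:R.
set c : R := (size (LX X))%:R; set d : R := (size _)%:R => hk ha hd h.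
have hN : X / 4 - 1 <= N%:R by rewrite -(@natr1 R N) in N2; lra.
have h1 : (X / 4 - 1) ^+ 2 <= N%:R ^+ 2 by rewrite lerXn2r ?nnegrE //; lra.
have h2 : a * k <= X * (2 * r + 1) by rewrite ler_pM.
(* Origin of the threshold 300: 2 r X = 2 X^2 / r <= X^2 / 150, which is below X^2 / 64 - X^2 /
   128. *)
have h3 : X * (300 * r) <= X * r ^+ 2.
  by rewrite ler_wpM2l ?expr2 ?ler_wpM2r //; lra.
have h4 : X * 300 <= X * r by rewrite ler_wpM2l //; lra.
rewrite rr in h3; move: h1 h2 h3 h4; rewrite !expr2; nra.
Qed.

End LowerBound.

(** * The transfer operator *)

Section TransferOperator.
Variable R : realType.
Implicit Types (x y : R) (u v f : R -> R) (K n i : nat).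
Local Notation G := (@gauss R).

(* Weight of the digit i.+1 in the transfer operator of the Gauss map,
   normalized by the Gauss density 1 / (1 + x). *)
Definition gweight i x : R := (1 + x) / ((i.+1%:R + x) * (i.+2%:R + x)).

(** Truncated to the digits up to K to keep the sum finite; by [sum_gweight] the weight lost is (1 +
    x) / (K + 1 + x). *)
Definition transfer K u x : R :=
  \sum_(0 <= i < K) gweight i x * u (i.+1%:R + x)^-1.

Definition lipschitz01 (L : R) u :=
  forall x y, 0 <= x <= 1 -> 0 <= y <= 1 -> `|u x - u y| <= L * `|x - y|.

Definition bounded01 (B : R) u := forall x, 0 <= x <= 1 -> `|u x| <= B.

Lemma digit_add_gt0 i x : 0 <= x -> 0 < i.+1%:R + x.
Proof. by move=> x0; rewrite ltr_pwDl ?ltr0n. Qed.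

Lemma gweight_gt0 i x : 0 <= x -> 0 < gweight i x.
Proof.
by move=> x0; rewrite divr_gt0 ?mulr_gt0 ?digit_add_gt0 //; lra.
Qed.

Lemma inv_digit_itv i x : 0 <= x <= 1 -> 0 <= (i.+1%:R + x)^-1 <= 1.
Proof.
move=> /andP[x0 x1]; have i0 : 0 <= i%:R :> R by [].
rewrite -(@natr1 R i); apply/andP; split; first by rewrite invr_ge0; lra.
by rewrite invf_le1; lra.
Qed.

Lemma inv_digit_oo i x : 0 < x < 1 -> 0 < (i.+1%:R + x)^-1 < 1.
Proof.
move=> /andP[x0 x1]; have i0 : 0 <= i%:R :> R by [].
rewrite -(@natr1 R i); apply/andP; split; first by rewrite invr_gt0; lra.
by rewrite invf_lt1; lra.
Qed.

Lemma sum_gweight K x : 0 <= x ->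
  \sum_(0 <= i < K) gweight i x = 1 - (1 + x) / (K.+1%:R + x).
Proof.
move=> x0; elim: K => [|K IH].
  by rewrite big_geq // divff ?subrr // gt_eqF //; lra.
rewrite big_nat_recr //= IH /gweight; have K0 : 0 <= K%:R :> R by [].
have -> : K.+2%:R = K%:R + 2 :> R by rewrite -natrD addn2.
rewrite -(@natr1 R K); field.
by rewrite !gt_eqF //; lra.
Qed.

Lemma sum_gweight_le1 K x : 0 <= x -> \sum_(0 <= i < K) gweight i x <= 1.
Proof.
by move=> x0; rewrite sum_gweight // gerBl divr_ge0 ?addr_ge0.
Qed.

Lemma sum_gweight_bound K x (c : nat -> R) (B : R) : 0 <= x -> 0 <= B ->
  (forall i, `|c i| <= B) -> `|\sum_(0 <= i < K) gweight i x * c i| <= B.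
Proof.
move=> x0 B0 h; apply: le_trans (ler_norm_sum _ _ _) _.
apply: (@le_trans _ _ (\sum_(0 <= i < K) gweight i x * B)).
  apply: ler_sum => i _; have g0 := gweight_gt0 i x0.
  by rewrite normrM [`|gweight _ _|]gtr0_norm // ler_pM2l.
by rewrite -mulr_suml ler_piMl // sum_gweight_le1.
Qed.

Lemma bounded01_ge0 B u : bounded01 B u -> 0 <= B.
Proof. by move=> /(_ 0); rewrite lexx ler01 => /(_ isT); apply: le_trans. Qed.

Lemma transfer_bounded K B u : bounded01 B u -> bounded01 B (transfer K u).
Proof.
move=> hu x x01; have /andP[x0 x1] := x01.
apply: sum_gweight_bound => //; first exact: bounded01_ge0 hu.
by move=> i; apply: hu; apply: inv_digit_itv.
Qed.

Lemma iter_transfer_bounded K n B u : bounded01 B u ->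
  bounded01 B (iter n (transfer K) u).
Proof. by move=> hu; elim: n => //= n; apply: transfer_bounded. Qed.

Lemma inv_dist (a b : R) : 0 < a -> 0 < b ->
  `|a^-1 - b^-1| = `|a - b| / (a * b).
Proof.
move=> a0 b0; have -> : a^-1 - b^-1 = (b - a) / (a * b).
  by field; rewrite !gt_eqF.
by rewrite normrM normfV (distrC b) (gtr0_norm (mulr_gt0 a0 b0)).
Qed.

Let tail i x y : R := i%:R * (x - y) / ((i.+1%:R + x) * (i.+1%:R + y)).

Let gweightB i x y : 0 <= x -> 0 <= y ->
  gweight i x - gweight i y = tail i x y - tail i.+1 x y.
Proof.
move=> x0 y0; rewrite /gweight /tail; have i0 : 0 <= i%:R :> R by [].
have -> : i.+2%:R = i%:R + 2 :> R by rewrite -natrD addn2.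
rewrite -(@natr1 R i); field.
by rewrite !gt_eqF //; lra.
Qed.

(* Abel summation: the tails of the weights are (1 + x) / (i + x), hence their
   differences at two points are the explicit [tail]. *)
Let abel_sum K L u x y : 0 <= x <= 1 -> 0 <= y <= 1 -> lipschitz01 L u ->
  0 <= L ->
  `|\sum_(0 <= i < K) (gweight i x - gweight i y) * u (i.+1%:R + y)^-1
     + tail K x y * u (K.+1%:R + y)^-1|
  <= L * `|x - y| * (4^-1 - (2 * (K.+1%:R * K.+2%:R))^-1).
Proof.
move=> x01 y01 hu L0; have /andP[x0 x1] := x01; have /andP[y0 y1] := y01.
elim: K => [|K IH].
  rewrite big_geq // /tail mul0r !mul0r addr0 normr0.
  by rewrite mulr_ge0 ?mulr_ge0 //; lra.
rewrite big_nat_recr //= gweightB //.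
set S := \sum_(0 <= i < K) _ in IH *; set a := u _ in IH *; set b := u _.
have -> : S + (tail K x y - tail K.+1 x y) * a + tail K.+1 x y * b =
   (S + tail K x y * a) + tail K.+1 x y * (b - a) by ring.
apply: le_trans (ler_normD _ _) _; apply: le_trans (lerD IH (lexx _)) _.
have K0 : 0 <= K%:R :> R by [].
have hba : `|b - a| <= L * ((K%:R + 2 + y) * (K%:R + 1 + y))^-1.
  apply: le_trans (hu _ _ _ _) _; rewrite ?inv_digit_itv //.
  rewrite ler_wpM2l // inv_dist; [|exact: digit_add_gt0..].
  have -> : K.+2%:R = K%:R + 2 :> R by rewrite -natrD addn2.
  rewrite -(@natr1 R K); set d := _ - _.
  have -> : d = 1 by rewrite /d; ring.
  by rewrite normr1 mul1r.
have -> : K.+3%:R = K%:R + 3 :> R by rewrite -natrD addn3.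
have -> : K.+2%:R = K%:R + 2 :> R by rewrite -natrD addn2.
have ht : `|tail K.+1 x y| <= `|x - y| * (K%:R + 1) / (K%:R + 2) ^+ 2.
  rewrite /tail normrM normrM [X in X * _]mulrC [`|K.+1%:R|]ger0_norm //.
  have -> : K.+2%:R = K%:R + 2 :> R by rewrite -natrD addn2.
  rewrite -(@natr1 R K) normfV [X in _ / X <= _]ger0_norm; last by rewrite mulr_ge0; lra.
  rewrite ler_wpM2l ?mulr_ge0 //.
  rewrite lef_pV2 ?posrE ?mulr_gt0 ?exprn_gt0 //; try lra.
  by rewrite expr2 ler_pM //; lra.
rewrite normrM.
have := ler_pM (normr_ge0 _) (normr_ge0 _) ht hba.
rewrite -(@natr1 R K); move: (K%:R : R) K0 (`|x - y|) (normr_ge0 (x - y)) => k k0 d d0.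
move=> h; apply: le_trans (lerD (lexx _) h) _.
rewrite -[leRHS]subr0 -subr_ge0 subr0.
have hy : ((k + 2 + y) * (k + 1 + y))^-1 <= ((k + 2) * (k + 1))^-1.
  rewrite lef_pV2 ?posrE ?mulr_gt0 //; try lra.
  by rewrite ler_pM //; lra.
have : d * (k + 1) / (k + 2) ^+ 2 * (L * ((k + 2 + y) * (k + 1 + y))^-1) <=
  d * (k + 1) / (k + 2) ^+ 2 * (L * ((k + 2) * (k + 1))^-1).
  rewrite ler_wpM2l ?ler_wpM2l // divr_ge0 ?exprn_ge0 //; try lra.
  by rewrite mulr_ge0 //; lra.
have -> : d * (k + 1) / (k + 2) ^+ 2 * (L * ((k + 2) * (k + 1))^-1) =
  L * d / (k + 2) ^+ 3.
  by field; rewrite !gt_eqF //; lra.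
(* (k + 2)^-3 is at most 1/((k+1)(k+2)(k+3)), half the difference of 1/((k+1)(k+2)) and
   1/((k+2)(k+3)); the telescoping sum over k >= 0 is 1/4. *)
have : 0 <= L * d * ((k + 2) ^- 3 * (((k + 1) * (k + 3))^-1)).
  by rewrite !mulr_ge0 ?invr_ge0 ?mulr_ge0 ?exprn_ge0 //; lra.
have -> : L * d * ((k + 2) ^- 3 * ((k + 1) * (k + 3))^-1) =
  L * d * ((2 * ((k + 1) * (k + 2)))^-1 - (2 * ((k + 2) * (k + 3)))^-1)
  - L * d / (k + 2) ^+ 3.
  by field; rewrite !gt_eqF //; lra.
move: (_ * (L * _)) (L * d / _) => p q.
rewrite !mulrBr; lra.
Qed.

(** 7/8 = 5/8 + 1/4: moving the arguments of u costs 5/8, changing the weights 1/4 by [abel_sum].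
    The boundary term of the Abel summation at K gives B / (K + 1). *)
Lemma transfer_lipschitz K L B u : 0 <= L ->
  lipschitz01 L u -> bounded01 B u ->
  lipschitz01 (7 / 8 * L + B / K.+1%:R) (transfer K u).
Proof.
move=> L0 hu bu x y x01 y01; have /andP[x0 x1] := x01; have /andP[y0 y1] := y01.
have B0 := bounded01_ge0 bu.
have -> : transfer K u x - transfer K u y =
  \sum_(0 <= i < K) gweight i x * (u (i.+1%:R + x)^-1 - u (i.+1%:R + y)^-1) +
  (\sum_(0 <= i < K) (gweight i x - gweight i y) * u (i.+1%:R + y)^-1
   + tail K x y * u (K.+1%:R + y)^-1) - tail K x y * u (K.+1%:R + y)^-1.
  rewrite addrA addrK /transfer -big_split /= -sumrB; apply: eq_bigr => i _.
  by ring.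
apply: le_trans (ler_normB _ _) _.
apply: le_trans (lerD (ler_normD _ _) (lexx _)) _.
have h2 := abel_sum K x01 y01 hu L0.
have h3 : `|tail K x y * u (K.+1%:R + y)^-1| <= B / K.+1%:R * `|x - y|.
  rewrite normrM mulrC -mulrA ler_pM //; first by apply: bu; apply: inv_digit_itv.
  have K0 : 0 <= K%:R :> R by [].
  rewrite /tail normrM normrM [X in X * _]mulrC [`|K%:R|]ger0_norm //.
  rewrite -(@natr1 R K) normfV [X in _ / X <= _]ger0_norm; last by rewrite mulr_ge0; lra.
  rewrite [leRHS]mulrC -mulrA ler_wpM2l //.
  rewrite ler_pdivrMr; last by rewrite mulr_gt0; lra.
  apply: (@le_trans _ _ ((K%:R + 1)^-1 * ((K%:R + 1) * (K%:R + 1)))).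
    by rewrite mulrA mulVf ?mul1r ?gt_eqF //; lra.
  by rewrite ler_wpM2l ?invr_ge0 ?ler_pM //; lra.
have h1 : `|\sum_(0 <= i < K) gweight i x *
     (u (i.+1%:R + x)^-1 - u (i.+1%:R + y)^-1)| <= L * `|x - y| * (5 / 8).
  apply: le_trans (ler_norm_sum _ _ _) _.
  apply: (@le_trans _ _ (\sum_(0 <= i < K) L * `|x - y| *
      (gweight i x / ((i.+1%:R + x) * (i.+1%:R + y))))).
    apply: ler_sum => i _; have g0 := gweight_gt0 i x0.
    rewrite normrM gtr0_norm // mulrCA ler_pM2l // -mulrA.
    apply: le_trans (hu _ _ _ _) _; rewrite ?inv_digit_itv //.
    rewrite ler_wpM2l // inv_dist; [|exact: digit_add_gt0..].
    by rewrite (_ : i.+1%:R + x - _ = x - y) //; ring.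
  rewrite -mulr_sumr ler_wpM2l ?mulr_ge0 //.
  case: K {h2 h3} => [|K]; first by rewrite big_geq //; lra.
  (* The term i = 0 is at most 1/2, the term i = k + 1 at most half of 1/((k+1)(k+2)(k+3)); together
     1/2 + 1/8. *)
  suff : \sum_(0 <= i < K.+1) gweight i x / ((i.+1%:R + x) * (i.+1%:R + y))
     <= 5 / 8 - (4 * ((K%:R + 1) * (K%:R + 2)))^-1.
    move=> /le_trans; apply; rewrite gerBl invr_ge0 !mulr_ge0 //; lra.
  elim: K => [|K IH].
    rewrite big_nat1 /gweight mulr0n !add0r mul1r.
    have -> : (1 + x) / ((1 + x) * (2 + x)) / ((1 + x) * (1 + y)) =
       ((2 + x) * ((1 + x) * (1 + y)))^-1.
      by field; rewrite !gt_eqF //; lra.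
    rewrite (_ : 5 / 8 - (4 * 2)^-1 = 2^-1 :> R); last by field.
    rewrite lef_pV2 ?posrE ?mulr_gt0 //; try lra.
    by nra.
  rewrite big_nat_recr //=; apply: le_trans (lerD IH (lexx _)) _.
  have K0 : 0 <= K%:R :> R by [].
  rewrite /gweight; have -> : K.+3%:R = K%:R + 3 :> R by rewrite -natrD addn3.
  have -> : K.+2%:R = K%:R + 2 :> R by rewrite -natrD addn2.
  rewrite -(@natr1 R K); move: (K%:R : R) K0 => k k0.
  have a1 : (1 + x) / (k + 3 + x) <= 2^-1.
    by rewrite ler_pdivrMr; lra.
  have a2 : ((k + 2 + x) * ((k + 2 + x) * (k + 2 + y)))^-1
     <= ((k + 1) * ((k + 2) * (k + 3)))^-1.
    rewrite lef_pV2 ?posrE ?mulr_gt0 //; try lra.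
    apply: (@le_trans _ _ ((k + 2) * ((k + 2) * (k + 2)))); first nra.
    by rewrite !ler_pM ?mulr_ge0 //; lra.
  have -> : (1 + x) / ((k + 2 + x) * (k + 3 + x)) / ((k + 2 + x) * (k + 2 + y))
    = (1 + x) / (k + 3 + x) * ((k + 2 + x) * ((k + 2 + x) * (k + 2 + y)))^-1.
    by field; rewrite !gt_eqF //; lra.
  have := ler_pM _ _ a1 a2.
  rewrite divr_ge0 ?invr_ge0 ?mulr_ge0 //; try lra.
  move=> /(_ isT isT) h; apply: le_trans (lerD (lexx _) h) _.
  have -> : (4 * ((k + 1 + 1) * (k + 1 + 2)))^-1 = (4 * ((k + 1) * (k + 2)))^-1 -
     2^-1 * ((k + 1) * ((k + 2) * (k + 3)))^-1 :> R.
    by field; rewrite !gt_eqF //; lra.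
  lra.
have : L * `|x - y| * (4^-1 - (2 * (K.+1%:R * K.+2%:R))^-1) <= L * `|x - y| / 4.
  by rewrite ler_wpM2l ?mulr_ge0 // gerBl invr_ge0 !mulr_ge0.
move=> h4; rewrite [leRHS]mulrDl; move: h1 h2 h3 h4.
move: (L * _ * (_ - _)) (B / _ * _) `|\sum_(0 <= i < K) _ * _|.
by move: `|_ + _| `|tail _ _ _ * _| => a b c d e; lra.
Qed.

(** The map L -> 7/8 L + e has the fixed point 8e; here e = B / (K + 1). *)
Lemma iter_transfer_lipschitz K n L B u : 0 <= L ->
  lipschitz01 L u -> bounded01 B u ->
  lipschitz01 ((7 / 8) ^+ n * L + 8 * (B / K.+1%:R)) (iter n (transfer K) u).
Proof.
move=> L0 hu bu; have B0 := bounded01_ge0 bu.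
have e0 : 0 <= B / K.+1%:R by rewrite divr_ge0.
elim: n => [|n IH] /=.
  move=> x y hx hy; apply: le_trans (hu x y hx hy) _.
  by rewrite expr0 mul1r ler_wpM2r // lerDl mulr_ge0.
move=> x y hx hy.
have L1 : 0 <= (7 / 8) ^+ n * L by rewrite mulr_ge0 // exprn_ge0 //; lra.
set c := (X in _ <= X * _); pose M := (7 / 8) ^+ n * L + 8 * (B / K.+1%:R).
have -> : c = 7 / 8 * M + B / K.+1%:R by rewrite /c /M exprS; field.
apply: transfer_lipschitz IH (iter_transfer_bounded _ n bu) _ _ hx hy.
by rewrite addr_ge0 // mulr_ge0.
Qed.

End TransferOperator.

(** * Birkhoff sums *)

Section Birkhoff.
Variable R : realType.
Implicit Types (x y : R) (u v f : R -> R) (K n i : nat) (g : nat -> R -> R).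
Local Notation G := (@gauss R).

(** The branches preserve the open interval. The endpoint 1 is avoided because there 1 / (i + 1 + x)
    has first digit i + 2. *)
Lemma transfer_eq K u v : (forall x, 0 < x < 1 -> u x = v x) ->
  forall x, 0 < x < 1 -> transfer K u x = transfer K v x.
Proof.
by move=> uv x x01; apply: eq_bigr => i _; rewrite uv // inv_digit_oo.
Qed.

Lemma iter_transfer_eq K n u v : (forall x, 0 < x < 1 -> u x = v x) ->
  forall x, 0 < x < 1 -> iter n (transfer K) u x = iter n (transfer K) v x.
Proof. by move=> uv; elim: n => //= n; apply: transfer_eq. Qed.

Lemma iter_transfer_le K n u v : (forall x, 0 < x < 1 -> u x <= v x) ->
  forall x, 0 < x < 1 -> iter n (transfer K) u x <= iter n (transfer K) v x.
Proof.
move=> uv; elim: n => //= n IH x x01; apply: ler_sum => i _.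
have /andP[/ltW x0 _] := x01.
by rewrite ler_pM2l ?gweight_gt0 // IH // inv_digit_oo.
Qed.

Lemma iter_transfer_bounded_oo K n u (B : R) :
  (forall x, 0 < x < 1 -> `|u x| <= B) ->
  forall x, 0 < x < 1 -> `|iter n (transfer K) u x| <= B.
Proof.
move=> uB; elim: n => //= n IH x x01; have /andP[/ltW x0 _] := x01.
have B0 : 0 <= B by apply: le_trans (IH x x01).
apply: le_trans (ler_norm_sum _ _ _) _.
apply: (@le_trans _ _ (\sum_(0 <= i < K) gweight i x * B)).
  apply: ler_sum => i _; have g0 := gweight_gt0 i x0.
  rewrite normrM [`|gweight _ _|]gtr0_norm // ler_pM2l //.
  by rewrite IH // inv_digit_oo.
by rewrite -mulr_suml ler_piMl // sum_gweight_le1.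
Qed.

Lemma iter_transferD K n u v :
  iter n (transfer K) (fun x => u x + v x) =
  (fun x => iter n (transfer K) u x + iter n (transfer K) v x).
Proof.
elim: n => //= n ->; apply/funext => x; rewrite /transfer -big_split /=.
by apply: eq_bigr => i _; rewrite mulrDr.
Qed.

Lemma iter_transferZ K n (c : R) u :
  iter n (transfer K) (fun x => c * u x) =
  (fun x => c * iter n (transfer K) u x).
Proof.
elim: n => //= n ->; apply/funext => x; rewrite /transfer mulr_sumr.
by apply: eq_bigr => i _; rewrite mulrCA.
Qed.

(* Transfer operator on functions of the first digit and of the tail. *)
Definition transfer_dig K g x : R :=
  \sum_(0 <= i < K) gweight i x * g i.+1 x.

(** The observable y -> g (dig y) (G y) is kept as a family indexed by the digit: it may jump where
    the digit changes, while each member will be Lipschitz. *)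
Fixpoint birkhoff g n x : R :=
  if n is m.+1 then g (dig x) (G x) + birkhoff g m (G x) else 0.

Lemma birkhoff_inv_digit g n i x : 0 <= x < 1 ->
  birkhoff g n.+1 (i.+1%:R + x)^-1 = g i.+1 x + birkhoff g n x.
Proof. by move=> x01 /=; rewrite dig_branch // gauss_branch. Qed.

(** After the first term is split off, the remaining Birkhoff sum depends on the tail only and comes
    out of the operator. *)
Lemma transfer_birkhoffM g K n v x : 0 < x < 1 ->
  transfer K (fun y => birkhoff g n.+1 y * v y) x =
  \sum_(0 <= i < K) gweight i x * (g i.+1 x * v (i.+1%:R + x)^-1) +
  birkhoff g n x * transfer K v x.
Proof.
move=> /andP[x0 x1]; rewrite /transfer mulr_sumr -big_split /=.
apply: eq_bigr => i _; have := @birkhoff_inv_digit g n i x.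
by rewrite x1 (ltW x0) => /(_ isT) /= ->; ring.
Qed.

(** For the cross terms of the square below. Step i releases a term g v in which v has been
    transferred i times, of size B times [beta i]; further transfers do not increase its sup
    bound. *)
Lemma iter_transfer_birkhoffM g (B : R) K n v (beta : nat -> R) :
  (forall i x, 0 < x < 1 -> `|g i.+1 x| <= B) ->
  (forall i x, 0 < x < 1 -> `|iter i (transfer K) v x| <= beta i) ->
  forall x, 0 < x < 1 ->
  `|iter n (transfer K) (fun y => birkhoff g n y * v y) x| <=
    B * \sum_(0 <= i < n) beta i.
Proof.
move=> gB; elim: n v beta => [|n IH] v beta vb x x01.
  by rewrite /= mul0r normr0 big_geq // mulr0.
pose h y := \sum_(0 <= i < K) gweight i y * (g i.+1 y * v (i.+1%:R + y)^-1).
rewrite iterSr (@iter_transfer_eq _ _ _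
  (fun y => h y + birkhoff g n y * transfer K v y)) //; last first.
  by move=> y y01; rewrite transfer_birkhoffM.
rewrite iter_transferD big_nat_recl // mulrDr.
apply: le_trans (ler_normD _ _) _; apply: lerD.
  apply: iter_transfer_bounded_oo => // y y01.
  have /andP[/ltW y0 _] := y01.
  have hi i : `|g i.+1 y * v (i.+1%:R + y)^-1| <= B * beta 0%N.
    by rewrite normrM ler_pM ?gB // (vb 0%N) // inv_digit_oo.
  by apply: sum_gweight_bound => //; apply: le_trans (hi 0%N).
by apply: IH => // i y y01; rewrite -iterSr; apply: vb.
Qed.

(** The operator sends the square of g + S_n o G to at most B^2, plus twice S_n times
    [transfer_dig K g], plus S_n^2. If the sums of [beta] stay bounded, the growth is linear in
    n. *)
Lemma iter_transfer_birkhoff_sqr g (B : R) K n (beta : nat -> R) :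
  (forall i x, 0 < x < 1 -> `|g i.+1 x| <= B) ->
  (forall i x, 0 < x < 1 ->
     `|iter i (transfer K) (transfer_dig K g) x| <= beta i) ->
  forall x, 0 < x < 1 ->
  iter n (transfer K) (fun y => birkhoff g n y ^+ 2) x <=
    n%:R * (B ^+ 2 + 2 * B * \sum_(0 <= i < n) beta i).
Proof.
move=> gB vb.
have h01 : 0 < (2^-1 : R) < 1 by apply/andP; split; lra.
have B0 : 0 <= B by apply: le_trans (gB 0%N _ h01).
have b0 i : 0 <= beta i by apply: le_trans (vb i _ h01).
elim: n => [|n IH] x x01; first by rewrite /= expr0n mul0r.
pose v := transfer_dig K g.
have stepI y : 0 < y < 1 -> transfer K (fun z => birkhoff g n.+1 z ^+ 2) y <=
    B ^+ 2 + 2 * (birkhoff g n y * v y) + birkhoff g n y ^+ 2.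
  move=> y01; have /andP[y0 y1] := y01; have y0' := ltW y0.
  have -> : transfer K (fun z => birkhoff g n.+1 z ^+ 2) y =
    \sum_(0 <= i < K) gweight i y * g i.+1 y ^+ 2 +
    2 * (birkhoff g n y * v y) +
    (\sum_(0 <= i < K) gweight i y) * birkhoff g n y ^+ 2.
    rewrite mulr_suml !mulr_sumr -!big_split /=; apply: eq_bigr => i _.
    have := @birkhoff_inv_digit g n i y.
    by rewrite y1 y0' => /(_ isT) /= ->; ring.
  apply: lerD; last by rewrite ler_piMl ?sqr_ge0 // sum_gweight_le1.
  rewrite lerD2r; apply: le_trans (ler_norm _) _.
  apply: sum_gweight_bound => //; first exact: sqr_ge0.
  by move=> i; rewrite normrX lerXn2r ?nnegrE // gB.
rewrite iterSr; apply: le_trans (iter_transfer_le _ _ stepI x01) _.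
rewrite iter_transferD iter_transferD iter_transferZ.
have c1 : iter n (transfer K) (fun=> B ^+ 2) x <= B ^+ 2.
  apply: le_trans (ler_norm _) _; apply: iter_transfer_bounded_oo => // y _.
  by rewrite ger0_norm // sqr_ge0.
have c2 : iter n (transfer K) (fun y => birkhoff g n y * v y) x <=
    B * \sum_(0 <= i < n) beta i.
  by apply: le_trans (ler_norm _) _; apply: iter_transfer_birkhoffM.
have c3 := IH x x01.
have c4 : B * \sum_(0 <= i < n) beta i <= B * \sum_(0 <= i < n.+1) beta i.
  by rewrite ler_wpM2l // big_nat_recr //= lerDl.
have c5 : n%:R * (B ^+ 2 + 2 * B * \sum_(0 <= i < n) beta i) <=
    n%:R * (B ^+ 2 + 2 * B * \sum_(0 <= i < n.+1) beta i).
  by rewrite ler_wpM2l // lerD2l -!mulrA; lra.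
rewrite -(@natr1 R n) mulrDl mul1r.
move: c1 c2 c3 c4 c5; rewrite -!mulrA.
move: (iter n _ _ x) (iter n _ _ x) (iter n _ _ x) => p q r; lra.
Qed.

(** The absolute derivative of the branch at x, times the ratio of the Gauss densities at its image
    and at x. *)
Definition wordweight (w : seq nat) x : R :=
  (1 + x) / (bden w x ^+ 2 * (1 + branch w x)).

Lemma wordweight_cons i w x : positive_word w -> 0 <= x ->
  wordweight (i.+1 :: w) x = gweight i (branch w x) * wordweight w x.
Proof.
move=> pw x0; have D0 := bden_gt0 pw x0; have z0 := branch_ge0 w x0.
have eN : bnum w x = branch w x * bden w x.
  by rewrite branchE // divfK // gt_eqF.
have i0 : 0 <= i%:R :> R by [].
rewrite /wordweight bden_cons eN branch_cons /gweight.
have -> : i.+2%:R = i%:R + 2 :> R by rewrite -natrD addn2.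
rewrite -(@natr1 R i); move: (branch w x) z0 (bden w x) D0 => z z0 D D0.
have p1 : 0 < i%:R + 1 + z by lra.
have p2 : 0 < (i%:R + 1) * D + z * D by rewrite -mulrDl mulr_gt0.
field; rewrite !gt_eqF //; lra.
Qed.

Definition words K n : seq (seq nat) :=
  iter n (fun ws => [seq i.+1 :: w | w <- ws, i <- iota 0 K]) [:: [::]].

Lemma mem_words K n w : w \in words K n <->
  size w = n /\ all (fun a => 0 < a <= K)%N w.
Proof.
elim: n w => [|n IH] w.
  by rewrite inE; split => [/eqP ->|[/size0nil ->]].
split=> [/allpairsP[[w' i] /= [/IH[sw aw]]]|[]].
  by rewrite mem_iota /= add0n => iK ->; rewrite /= sw aw iK.
case: w => [//|[//|i] w] /= [sw] /andP[iK aw].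
apply/allpairsP; exists (w, i); split => //=; first exact/IH.
by rewrite mem_iota.
Qed.

Lemma words_positive K n w : w \in words K n -> positive_word w.
Proof. by move=> /mem_words[_]; apply: sub_all => a /andP[]. Qed.

Lemma iter_transfer_words K n f x : 0 <= x ->
  iter n (transfer K) f x =
  \sum_(w <- words K n) wordweight w x * f (branch w x).
Proof.
move=> x0; elim: n f => [|n IH] f.
  rewrite big_seq1 /wordweight /bden /cden /cden' /=.
  by rewrite mul0r addr0 expr1n mul1r divff ?mul1r // gt_eqF //; lra.
rewrite iterSr IH /= big_allpairs_dep; apply: eq_big_seq => w /words_positive pw.
rewrite /transfer mulr_sumr /index_iota subn0; apply: eq_bigr => i _.
by rewrite wordweight_cons //; ring.
Qed.

(** 8 is 4 from [bden] <= 2 [cden], squared, times 2 from [branch] <= 1. *)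
Lemma wordweight_ge w x : positive_word w -> 0 <= x <= 1 ->
  (8 * (cden w)%:R ^+ 2)^-1 <= wordweight w x.
Proof.
move=> pw /andP[x0 x1]; have z0 := branch_ge0 w x0.
have z1 : branch w x <= 1 by rewrite branch_le1 // x0.
have D0 := bden_gt0 pw x0.
have q0 : 0 < (cden w)%:R :> R by rewrite ltr0n cden_gt0.
have D2 : bden w x <= 2 * (cden w)%:R.
  rewrite [leRHS]mulr_natl mulr2n lerD2l.
  apply: (@le_trans _ _ (cden' w)%:R); last by rewrite ler_nat cden'_le_cden.
  by rewrite ler_piMr.
apply: (@le_trans _ _ (bden w x ^+ 2 * (1 + branch w x))^-1); last first.
  by rewrite /wordweight ler_peMl ?invr_ge0 ?mulr_ge0 ?sqr_ge0 //; lra.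
rewrite lef_pV2 ?posrE ?mulr_gt0 ?exprn_gt0 //; last lra.
have -> : 8 * (cden w)%:R ^+ 2 = (2 * (cden w)%:R) ^+ 2 * 2 :> R by ring.
by rewrite ler_pM ?sqr_ge0 ?lerXn2r ?nnegrE ?(ltW D0) ?mulr_ge0 //; lra.
Qed.

End Birkhoff.

(** * Equidistribution of the periodic points of the Gauss map *)

Section Equidistribution.
Variable R : realType.
Implicit Types (w x y X : R) (K n i : nat) (g : nat -> R -> R).
Local Notation G := (@gauss R).

Lemma sum_geometric_le (r : R) n : 0 <= r < 1 ->
  \sum_(0 <= i < n) r ^+ i <= (1 - r)^-1.
Proof.
move=> /andP[r0 r1]; suff -> : \sum_(0 <= i < n) r ^+ i = (1 - r ^+ n) / (1 - r).
  by rewrite ler_pdivrMr ?mulVf ?gerBl ?exprn_ge0 ?gt_eqF //; lra.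
elim: n => [|n IH]; first by rewrite big_geq // expr0 subrr mul0r.
by rewrite big_nat_recr //= IH exprS; field; rewrite gt_eqF //; lra.
Qed.

Lemma sum_LX_iter X j (F : R -> R) :
  \sum_(w <- LX X) F (iter j G w) = \sum_(w <- LX X) F w.
Proof.
elim: j => // j IH; rewrite -IH -(sum_LX_gauss X (fun w => F (iter j G w))).
by under eq_bigr do rewrite iterSr.
Qed.

Lemma sum_LX_birkhoff g X n :
  \sum_(w <- LX X) birkhoff g n w = n%:R * \sum_(w <- LX X) g (dig w) (G w).
Proof.
elim: n => [|n IH]; first by rewrite /= big1 ?mul0r.
rewrite /= big_split /= (sum_LX_gauss X (birkhoff g n)) IH.
by rewrite -(@natr1 R n); ring.
Qed.

Lemma birkhoff_bound g (B : R) n w : nonterminating w ->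
  (forall i x, 0 < x < 1 -> `|g i.+1 x| <= B) -> `|birkhoff g n w| <= n%:R * B.
Proof.
move=> ntw gB; elim: n w ntw => [|n IH] w ntw /=; first by rewrite normr0 mul0r.
have ntG := nonterminating_gauss ntw.
apply: le_trans (ler_normD _ _) _; rewrite -(@natr1 R n) mulrDl mul1r addrC.
apply: lerD; first exact: IH.
have : (0 < dig w)%N by have /andP[? /ltW ?] := ntw 0%N; rewrite dig_gt0 //; apply/andP.
by case: (dig w) => // a _; apply: gB; apply: (ntG 0%N).
Qed.

(** Bounded distortion: tails sharing m digits are within 2 / 2^m of each other, and these bounds
    sum to at most 4. *)
Lemma birkhoff_word_close g (L : R) n w y : 0 <= L -> nonterminating w ->
  0 < y < 1 -> (forall i, lipschitz01 L (g i.+1)) ->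
  `|birkhoff g n w - birkhoff g n (branch (digits n w) y)| <= 4 * L.
Proof.
move=> L0 + y01 gL.
suff h : nonterminating w -> `|birkhoff g n w - birkhoff g n (branch (digits n w) y)|
    <= L * (4 - 4 * 2 ^- n).
  move=> /h/le_trans; apply; rewrite mulrC ler_wpM2r //.
  have : 0 <= (2 ^- n : R) by rewrite invr_ge0 exprn_ge0.
  lra.
elim: n w => [|n IH] w ntw.
  by rewrite /= subrr normr0 expr0 invr1 mulr1 subrr mulr0.
have ntG := nonterminating_gauss ntw.
have pG := positive_digits n ntG.
have : (0 < dig w)%N by have /andP[? /ltW ?] := ntw 0%N; rewrite dig_gt0 //; apply/andP.
have -> : digits n.+1 w = dig w :: digits n (G w) by [].
rewrite branch_cons [birkhoff g n.+1 w]/=; case: (dig w) => // a _.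
set z := branch _ y; have z01 : 0 < z < 1 by apply: branch_oo.
have /andP[z0 z1] := z01; have /andP[u0 u1] := ntG 0%N; rewrite /= in u0 u1.
rewrite birkhoff_inv_digit ?(ltW z0) //.
set s := g _ (G w); set t := birkhoff g n (G w); set s' := g _ z; set t' := birkhoff g n z.
have -> : s + t - (s' + t') = (s - s') + (t - t') by ring.
apply: le_trans (ler_normD _ _) _; apply: le_trans (lerD (lexx _) (IH _ ntG)) _.
have hs : `|s - s'| <= L * (2 * 2 ^- n).
  apply: le_trans (gL _ _ _ _ _) _; rewrite ?(ltW z0) ?(ltW u0) ?(ltW z1) ?(ltW u1) //.
  rewrite ler_wpM2l // -{1}(branch_digits n ntG).
  have /andP[v0 v1] := ntG n; have /andP[y0 y1] := y01.
  rewrite -[X in 2 * 2 ^- X](size_digits n (G w)).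
  by rewrite branch_contract // ?(ltW v0) ?(ltW v1) ?(ltW y0) ?(ltW y1).
apply: le_trans (lerD hs (lexx _)) _.
rewrite -mulrDr ler_wpM2l // exprS invfM; lra.
Qed.

(** Union bound over the n positions, each reduced to the first by G-invariance. *)
Lemma size_LX_large_digit X K n : 0 <= X ->
  (count (fun w => ~~ all (fun a => a <= K)%N (digits n w)) (LX X))%:R
   <= n%:R * (X ^+ 2 / K.+1%:R).
Proof.
move=> X0.
have h1 : (count (fun w => K < dig w)%N (LX X))%:R <= X ^+ 2 / K.+1%:R.
  rewrite -size_filter; apply: size_QG_dig => //; first by rewrite filter_uniq ?LX_uniq.
  by move=> w; rewrite mem_filter => /andP[Kw /mem_LX[Qw wX]].
have e w : (~~ all (fun a => a <= K)%N (digits n w))%:R <=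
    \sum_(0 <= j < n) ((K < dig (iter j G w))%N%:R : R).
  elim: n w => [|n IH] w; first by rewrite big_geq.
  rewrite big_nat_recl // negb_and -ltnNge.
  under eq_bigr do rewrite iterSr.
  have S0 : 0 <= \sum_(0 <= j < n) ((K < dig (iter j G (G w)))%N%:R : R).
    by rewrite sumr_ge0.
  rewrite /=; case: (ltnP K (dig w)) => _ /=; first by rewrite lerDl.
  by rewrite add0r; apply: IH.
have cE (P : pred R) : (count P (LX X))%:R = \sum_(w <- LX X) ((P w)%:R : R).
  by rewrite -sum1_count natr_sum big_mkcond /=; apply: eq_bigr => w _; case: (P w).
rewrite cE; apply: le_trans (ler_sum _ (fun w _ => e w)) _.
rewrite exchange_big /=.
under eq_bigr do rewrite (sum_LX_iter X _ (fun w => (K < dig w)%N%:R)) -cE.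
by rewrite big_const_nat iter_addr_0 subn0 -[leLHS]mulr_natl ler_wpM2l.
Qed.

(** The cylinder of s lies within q^-2 of p/q, so [size_QG_near] applies with r = q^-2; by
    [wordweight_ge], 2 q^-2 is at most 16 times the weight. *)
Lemma count_LX_word X n (s : seq nat) : 0 <= X -> positive_word s -> size s = n ->
  (count (fun w => digits n w == s) (LX X))%:R <=
  16 * X ^+ 2 * wordweight s (2^-1 : R) + 3 * X.
Proof.
move=> X0 ps sn; have h2 : 0 <= (2^-1 : R) <= 1 by apply/andP; split; lra.
have q0 : 0 < (cden s)%:R :> R by rewrite ltr0n cden_gt0.
rewrite -size_filter.
apply: le_trans (@size_QG_near R _ X ((cnum s)%:R / (cden s)%:R)
  ((cden s)%:R ^- 2) _ X0 _ _) _.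
- by rewrite invr_ge0 exprn_ge0.
- by rewrite filter_uniq ?LX_uniq.
- move=> w; rewrite mem_filter => /andP[/eqP ew /mem_LX[Qw wX]]; split => //.
  have ntw := QG_nonterminating Qw.
  rewrite -{1}(branch_digits n ntw) ew branch_dist0 //.
  by have /andP[/ltW -> /ltW ->] := ntw n.
rewrite lerD2r (mulrAC 16) ler_wpM2r ?sqr_ge0 //.
have := wordweight_ge ps h2; rewrite invfM; lra.
Qed.

(** A point whose first n digits are at most K is compared with the point [branch s 2^-1] of its
    cylinder; cylinder counts bounded by weights then reproduce the iterated operator at 1/2. The
    other points are few and take the trivial bound n B. *)
Lemma sum_LX_birkhoff_sqr g (B L V : R) X K n : 0 <= X -> 0 <= L ->
  (forall i x, 0 < x < 1 -> `|g i.+1 x| <= B) ->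
  (forall i, lipschitz01 L (g i.+1)) ->
  iter n (transfer K) (fun y => birkhoff g n y ^+ 2) 2^-1 <= V ->
  \sum_(w <- LX X) birkhoff g n w ^+ 2 <=
    (32 * V + 512 * L ^+ 2 + n%:R ^+ 3 * B ^+ 2 / K.+1%:R) * X ^+ 2
    + 3 * X * (size (words K n))%:R * (2 * (n%:R * B) ^+ 2 + 32 * L ^+ 2).
Proof.
move=> X0 L0 gB gL hV.
have h01 : 0 < (2^-1 : R) < 1 by apply/andP; split; lra.
have B0 : 0 <= B by apply: le_trans (gB 0%N _ h01).
pose good w := all (fun a => a <= K)%N (digits n w).
(* From a^2 <= 2 b^2 + 2 (a - b)^2 with |a - b| <= 4L. *)
pose c (s : seq nat) : R := 2 * birkhoff g n (branch s 2^-1) ^+ 2 + 32 * L ^+ 2.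
have c0 s : 0 <= c s by apply: addr_ge0; apply: mulr_ge0 => //; apply: sqr_ge0.
have bad : \sum_(w <- LX X | ~~ good w) birkhoff g n w ^+ 2 <=
   n%:R ^+ 3 * B ^+ 2 / K.+1%:R * X ^+ 2.
  apply: (@le_trans _ _ (\sum_(w <- LX X | ~~ good w) (n%:R * B) ^+ 2)).
    rewrite big_seq_cond [leRHS]big_seq_cond; apply: ler_sum => w /andP[/mem_LX[Qw _] _].
    rewrite -(ger0_norm (sqr_ge0 _)) normrX lerXn2r ?nnegrE ?mulr_ge0 //.
    by rewrite birkhoff_bound //; apply: QG_nonterminating.
  rewrite big_const_seq iter_addr_0 -[leLHS]mulr_natl.
  apply: (@le_trans _ _ (n%:R * (X ^+ 2 / K.+1%:R) * (n%:R * B) ^+ 2)).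
    by rewrite ler_wpM2r ?sqr_ge0 ?size_LX_large_digit.
  by rewrite le_eqVlt; apply/orP; left; apply/eqP; rewrite exprMn; ring.
have hgood : \sum_(w <- LX X | good w) birkhoff g n w ^+ 2 <=
   \sum_(s <- words K n) (count (fun w => digits n w == s) (LX X))%:R * c s.
  apply: (@le_trans _ _ (\sum_(w <- LX X | good w) c (digits n w))).
    rewrite big_seq_cond [leRHS]big_seq_cond; apply: ler_sum => w /andP[/mem_LX[Qw _] _].
    have := birkhoff_word_close n L0 (QG_nonterminating Qw) h01 gL.
    rewrite /c; move: (birkhoff _ _ (branch _ _)) (birkhoff _ _ w) => b a.
    rewrite ler_norml => /andP[h1 h2].
    have : (a - b) ^+ 2 <= 16 * L ^+ 2.
      rewrite -subr_ge0 (_ : _ - _ = (4 * L - (a - b)) * (4 * L + (a - b))); last by ring.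
      by rewrite mulr_ge0 //; lra.
    have : 0 <= (a - 2 * b) ^+ 2 by apply: sqr_ge0.
    by rewrite !expr2; nra.
  rewrite big_seq_cond.
  apply: (@le_trans _ _ (\sum_(w <- LX X) \sum_(s <- words K n)
     (digits n w == s)%:R * c s)).
    rewrite big_mkcond /= big_seq [leRHS]big_seq; apply: ler_sum => w wX.
    have S0 : 0 <= \sum_(s <- words K n) (digits n w == s)%:R * c s.
      by rewrite sumr_ge0 // => s _; rewrite mulr_ge0.
    rewrite wX /=; case: ifP => // gw.
    have /mem_LX[Qw _] := wX.
    have ms : digits n w \in words K n.
      apply/mem_words; rewrite size_digits; split => //.
      have := positive_digits n (QG_nonterminating Qw).
      by rewrite all_predI => ->; exact: gw.
    rewrite (big_rem _ ms) /= eqxx mul1r lerDl sumr_ge0 // => s _.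
    by rewrite mulr_ge0.
  rewrite exchange_big /=; apply: ler_sum => s _.
  rewrite -mulr_suml ler_wpM2r // -sum1_count natr_sum [leRHS]big_mkcond /=.
  by apply: ler_sum => w _; case: (_ == _).
have hwords : \sum_(s <- words K n) (count (fun w => digits n w == s) (LX X))%:R * c s
   <= (32 * V + 512 * L ^+ 2) * X ^+ 2
    + 3 * X * (size (words K n))%:R * (2 * (n%:R * B) ^+ 2 + 32 * L ^+ 2).
  apply: (@le_trans _ _ (\sum_(s <- words K n)
    (16 * X ^+ 2 * (wordweight s 2^-1 * c s) +
     3 * X * (2 * (n%:R * B) ^+ 2 + 32 * L ^+ 2)))).
    rewrite big_seq [leRHS]big_seq; apply: ler_sum => s ms.
    have ps := words_positive ms; have /mem_words[sn _] := ms.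
    apply: le_trans (ler_wpM2r (c0 s) (count_LX_word X0 ps sn)) _.
    rewrite mulrDl (mulrA _ (wordweight _ _)) lerD2l ler_wpM2l ?mulr_ge0 //.
    rewrite lerD2r ler_pM2l // -(ger0_norm (sqr_ge0 _)) normrX.
    rewrite lerXn2r ?nnegrE ?mulr_ge0 //.
    have bo : 0 < branch s (2^-1 : R) < 1 by apply: branch_oo.
    have [e1 _] := digits_branch ps h01.
    have {sn}: size s = n by [].
    elim: n s ps {ms hV bad hgood good c c0 e1} bo => [|m IH] [|a s] //=.
      by rewrite normr0 mul0r.
    move=> /andP[a0 ps] bo [sm].
    have bo' : 0 < branch s (2^-1 : R) < 1 by apply: branch_oo.
    have /andP[b0 b1] := bo'; case: a a0 bo => // a _ bo.
    have := @birkhoff_inv_digit R g m a (branch s 2^-1).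
    rewrite b1 (ltW b0) => /(_ isT) /= ->.
    apply: le_trans (ler_normD _ _) _; rewrite -(@natr1 R m) mulrDl mul1r addrC.
    by apply: lerD; [apply: IH|apply: gB].
  rewrite big_split /= -mulr_sumr big_const_seq count_predT iter_addr_0.
  rewrite -[X in _ + X]mulr_natr [X in _ + X]mulrAC lerD2r.
  have -> : \sum_(s <- words K n) wordweight s 2^-1 * c s =
     2 * iter n (transfer K) (fun y => birkhoff g n y ^+ 2) 2^-1 +
     32 * L ^+ 2 * iter n (transfer K) (fun=> 1) 2^-1.
    rewrite !iter_transfer_words; [|lra|lra].
    rewrite !mulr_sumr -big_split /=; apply: eq_bigr => s _.
    by rewrite /c; ring.
  have h1 : iter n (transfer K) (fun=> 1) (2^-1 : R) <= 1.
    apply: le_trans (ler_norm _) _; apply: iter_transfer_bounded_oo => // y _.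
    by rewrite normr1.
  have h2 : 32 * L ^+ 2 * iter n (transfer K) (fun=> 1) (2^-1 : R) <= 32 * L ^+ 2.
    by rewrite ler_piMr // mulr_ge0 // sqr_ge0.
  have -> : (32 * V + 512 * L ^+ 2) * X ^+ 2 =
    16 * X ^+ 2 * (2 * V + 32 * L ^+ 2) by ring.
  by rewrite ler_wpM2l ?mulr_ge0 ?sqr_ge0 //; lra.
rewrite (bigID good) /=.
apply: le_trans (lerD (le_trans hgood hwords) bad) _.
by rewrite le_eqVlt; apply/orP; left; apply/eqP; ring.
Qed.

(** Decay makes the second moment smaller than n^2 X^2 by any factor. The parameters are fixed in
    the order n, [eta], K, X: the error [Q] X contains the number of words and is harmless only once
    X is large. *)
Lemma sum_LX_mean_zero g (B L M : R) : 0 <= L -> 0 <= M ->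
  (forall i x, 0 < x < 1 -> `|g i.+1 x| <= B) ->
  (forall i, lipschitz01 L (g i.+1)) ->
  (forall n (eta : R), 0 < eta -> exists K0, forall K, (K0 <= K)%N ->
     forall i x, (i < n)%N -> 0 < x < 1 ->
     `|iter i (transfer K) (transfer_dig K g) x| <= (7 / 8) ^+ i * M + eta) ->
  forall eps : R, 0 < eps -> exists X0, forall X, X0 <= X ->
    `|\sum_(w <- LX X) g (dig w) (G w)| <= eps * X ^+ 2.
Proof.
move=> L0 M0 gB gL decay eps e0.
have h01 : 0 < (2^-1 : R) < 1 by apply/andP; split; lra.
have B0 : 0 <= B by apply: le_trans (gB 0%N _ h01).
pose delta := eps / 4; have d0 : 0 < delta by rewrite /delta; lra.
pose C := 32 * B ^+ 2 + 512 * B * M + 512 * L ^+ 2.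
have L2 : 0 <= 512 * L ^+ 2 by have := sqr_ge0 L; lra.
have C0 : 0 <= C.
  by rewrite /C; have := sqr_ge0 B; have := mulr_ge0 B0 M0; lra.
pose n := (Num.truncn (C / delta ^+ 2)).+1.
have n0 : 0 < n%:R :> R by rewrite ltr0n.
have n1 : 1 <= n%:R :> R by rewrite ler1n.
have hn : C / n%:R <= delta ^+ 2.
  rewrite ler_pdivrMr // mulrC -ler_pdivrMr ?exprn_gt0 // ltW //.
  by apply: truncnS_gt.
pose eta := delta ^+ 2 / (64 * B + 1).
have B1 : 0 < 64 * B + 1 by lra.
have eta0 : 0 < eta by rewrite divr_gt0 ?exprn_gt0.
have [K0 hK0] := decay n eta eta0.
pose K := (K0 + Num.truncn (n%:R * B ^+ 2 / delta ^+ 2))%N.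
have hK : n%:R * B ^+ 2 / K.+1%:R <= delta ^+ 2.
  rewrite ler_pdivrMr ?ltr0n // [leRHS]mulrC -ler_pdivrMr ?exprn_gt0 // ltW //.
  apply: lt_le_trans (truncnS_gt (n%:R * B ^+ 2 / delta ^+ 2)) _.
  by rewrite ler_nat ltnS leq_addl.
(* Decay is available below n only; the trivial bound B completes the sequence. *)
pose beta i := if (i < n)%N then (7 / 8) ^+ i * M + eta else B.
have pB x : 0 < x < 1 -> `|transfer_dig K g x| <= B.
  move=> x01; have /andP[/ltW x0 _] := x01.
  by apply: sum_gweight_bound => // i; apply: gB.
have betaP i x : 0 < x < 1 ->
    `|iter i (transfer K) (transfer_dig K g) x| <= beta i.
  rewrite /beta; case: ifP => [ni|_] x01.
    by apply: hK0 => //; apply: leq_addr.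
  by apply: iter_transfer_bounded_oo.
have sb : \sum_(0 <= i < n) beta i <= 8 * M + n%:R * eta.
  rewrite (@eq_big_nat _ _ _ _ _ _ (fun i => (7 / 8) ^+ i * M + eta)); last first.
    by move=> i /andP[_ ni]; rewrite /beta ni.
  rewrite big_split /= -mulr_suml big_const_nat iter_addr_0 subn0.
  rewrite -[X in _ + X <= _]mulr_natl.
  rewrite lerD2r ler_wpM2r //; apply: le_trans (sum_geometric_le _ _) _.
    by apply/andP; split; lra.
  by rewrite (_ : 1 - 7 / 8 = 8^-1) ?invrK //; field.
pose V := n%:R * (B ^+ 2 + 2 * B * (8 * M + n%:R * eta)).
have hV : iter n (transfer K) (fun y => birkhoff g n y ^+ 2) 2^-1 <= V.
  apply: le_trans (iter_transfer_birkhoff_sqr n gB betaP h01) _.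
  rewrite /V ler_pM2l // lerD2l ler_wpM2l //; lra.
pose Q := 3 * (size (words K n))%:R * (2 * (n%:R * B) ^+ 2 + 32 * L ^+ 2).
have Q0 : 0 <= Q.
  rewrite /Q; apply: mulr_ge0; first by rewrite mulr_ge0.
  by apply: addr_ge0; apply: mulr_ge0 => //; apply: sqr_ge0.
exists (1 + Q / (delta ^+ 2 * n%:R ^+ 2)) => X X0.
have X1 : 1 <= X.
  apply: le_trans X0; rewrite lerDl divr_ge0 // ltW //.
  by rewrite mulr_gt0 ?exprn_gt0.
have QX : Q * X <= delta ^+ 2 * n%:R ^+ 2 * X ^+ 2.
  have : Q / (delta ^+ 2 * n%:R ^+ 2) <= X by lra.
  rewrite ler_pdivrMr ?mulr_gt0 ?exprn_gt0 // => h.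
  by rewrite expr2 mulrA ler_wpM2r //; [lra|rewrite mulrC].
have X00 : 0 <= X by lra.
have := sum_LX_birkhoff_sqr X00 L0 gB gL hV.
set S := \sum_(w <- _) _ => hS.
have hS2 : S <= 4 * delta ^+ 2 * n%:R ^+ 2 * X ^+ 2.
  apply: le_trans hS _.
  have -> : 3 * X * (size (words K n))%:R * (2 * (n%:R * B) ^+ 2 + 32 * L ^+ 2) =
    Q * X by rewrite /Q; ring.
  apply: le_trans (lerD (lexx _) QX) _.
  rewrite -mulrDl ler_wpM2r ?sqr_ge0 //.
  have -> : n%:R ^+ 3 * B ^+ 2 / K.+1%:R = n%:R ^+ 2 * (n%:R * B ^+ 2 / K.+1%:R) by ring.
  have k1 : n%:R ^+ 2 * (n%:R * B ^+ 2 / K.+1%:R) <= n%:R ^+ 2 * delta ^+ 2.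
    by rewrite ler_wpM2l ?sqr_ge0.
  have k2 : 64 * B * eta <= delta ^+ 2.
    rewrite /eta mulrA ler_pdivrMr // mulrC ler_wpM2l ?sqr_ge0 //; lra.
  have k3 : n%:R ^+ 2 * (64 * B * eta) <= n%:R ^+ 2 * delta ^+ 2.
    by rewrite ler_wpM2l ?sqr_ge0.
  have k4 : n%:R * C <= n%:R ^+ 2 * delta ^+ 2.
    rewrite expr2 -mulrA ler_pM2l //.
    by move: hn; rewrite ler_pdivrMr // mulrC.
  have k5 : 512 * L ^+ 2 <= n%:R * (512 * L ^+ 2).
    by rewrite ler_peMl.
  have -> : 32 * V = n%:R * (32 * B ^+ 2 + 512 * B * M) + n%:R ^+ 2 * (64 * B * eta).
    by rewrite /V; ring.
  move: k1 k3 k4 k5; rewrite /C.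
  move: (n%:R ^+ 2 * (64 * _ * _)) (n%:R ^+ 2 * (n%:R * _ / _)) => a b; nra.
have hL := size_LX_le X1.
have key : n%:R * `|\sum_(w <- LX X) g (dig w) (G w)| <= n%:R * (eps * X ^+ 2).
  rewrite -{1}(ger0_norm (ltW n0)) -normrM -sum_LX_birkhoff.
  apply: le_trans (ler_norm_sum _ _ _) _.
  (* t <= c / 2 + t^2 / (2c) with c = 4 delta n passes from the second moment to the first. *)
  apply: (@le_trans _ _ (\sum_(w <- LX X)
     (2^-1 * (4 * delta * n%:R) + 2^-1 * (birkhoff g n w ^+ 2 / (4 * delta * n%:R))))).
    apply: ler_sum => w _.
    have c0 : 0 < 4 * delta * n%:R by rewrite !mulr_gt0.
    rewrite -[birkhoff g n w ^+ 2]ger0_norm ?sqr_ge0 // normrX.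
    move: `|birkhoff _ _ _| (4 * delta * n%:R) c0 => b c c0.
    have -> : 2^-1 * c + 2^-1 * (b ^+ 2 / c) = b + 2^-1 * ((b - c) ^+ 2 / c).
      by field; rewrite gt_eqF.
    by rewrite lerDl mulr_ge0 // divr_ge0 ?sqr_ge0 // ltW.
  rewrite big_split /= big_const_seq count_predT iter_addr_0.
  rewrite -mulr_sumr -mulr_suml -/S -[X in X + _]mulr_natr -(mulrA 2^-1).
  have h1 : 4 * delta * n%:R * (size (LX X))%:R <= 4 * delta * n%:R * X ^+ 2.
    by rewrite ler_wpM2l // !mulr_ge0 // ltW.
  have h2 : S / (4 * delta * n%:R) <= delta * n%:R * X ^+ 2.
    rewrite ler_pdivrMr ?mulr_gt0 //.
    apply: le_trans hS2 _; rewrite le_eqVlt; apply/orP; left; apply/eqP; ring.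
  have -> : n%:R * (eps * X ^+ 2) = 4 * delta * n%:R * X ^+ 2.
    by rewrite /delta; field.
  have h3 : 0 <= delta * n%:R * X ^+ 2 by rewrite !mulr_ge0 ?sqr_ge0 // ltW.
  have h4 : 4 * delta * n%:R * X ^+ 2 = 4 * (delta * n%:R * X ^+ 2) by ring.
  by rewrite h4 in h1 *; move: h1 h2 h3; lra.
by rewrite ler_pM2l in key.
Qed.

End Equidistribution.

(** * Integrals *)

Section Integrals.
Variable R : realType.
Implicit Types (x y a b : R) (u v f : R -> R) (K n i : nat).
Local Notation mu := (@lebesgue_measure R).

Lemma lipschitz01_ge0 (L : R) u : lipschitz01 L u -> 0 <= L.
Proof.
move=> hu; have := hu 0 1; rewrite !lexx ler01 => /(_ isT isT).
by rewrite sub0r normrN normr1 mulr1; apply: le_trans.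
Qed.

Lemma lipschitz01_continuous (L : R) u :
  lipschitz01 L u -> {within `[0, 1], continuous u}.
Proof.
move=> hu; apply/subspace_continuousP => x /= x01.
have L0 := lipschitz01_ge0 hu; have L1 : 0 < L + 1 by lra.
apply/cvgrPdist_le => e e0; rewrite near_withinE.
apply/nbhs_ballP; exists (e / (L + 1)); first by rewrite /= divr_gt0.
move=> y /= /ltW xy y01; rewrite /= !in_itv /= in x01 y01.
apply: le_trans (hu x y x01 y01) _.
apply: (@le_trans _ _ ((L + 1) * (e / (L + 1)))).
  by rewrite ler_pM //; lra.
by rewrite mulrCA mulfV ?mulr1 // gt_eqF.
Qed.

Lemma is_derive_inv_digit i x : 0 <= x ->
  is_derive x 1 (fun y : R => (i.+1%:R + y)^-1) (- (i.+1%:R + x) ^- 2).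
Proof.
move=> x0; have h : i.+1%:R + x != 0 by rewrite gt_eqF // digit_add_gt0.
have dF : is_derive x 1 (fun y : R => i.+1%:R + y) 1.
  rewrite -[X in is_derive _ _ _ X]add0r; apply: is_deriveD.
have := @is_deriveV R (fun y => i.+1%:R + y) x 1 1 h dF.
by rewrite [_ *: _]mulr1.
Qed.

Lemma derive1_inv_digit i x : 0 <= x ->
  derive1 (fun y : R => (i.+1%:R + y)^-1) x = - (i.+1%:R + x) ^- 2.
Proof. by move=> x0; rewrite derive1E; exact: (@derive_val _ _ _ _ _ _ _ (is_derive_inv_digit i x0)). Qed.

Lemma cvg_inv_digit_sqr i x : 0 <= x ->
  (- (i.+1%:R + y) ^- 2 : R) @[y --> x] --> - (i.+1%:R + x) ^- 2.
Proof.
move=> x0; apply: cvgN; apply: cvgV.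
  by rewrite expf_eq0 /= gt_eqF // digit_add_gt0.
by rewrite expr2; under eq_fun do rewrite expr2; apply: cvgM; apply: cvgD => //; apply: cvg_cst.
Qed.

Lemma cvg_inv_digit i x : 0 <= x ->
  ((i.+1%:R + y)^-1 : R) @[y --> x] --> (i.+1%:R + x)^-1.
Proof.
move=> x0; apply: cvgV; first by rewrite gt_eqF // digit_add_gt0.
by apply: cvgD => //; apply: cvg_cst.
Qed.

Lemma Rintegral_inv_digit i f : {within `[0, 1], continuous f} ->
  \int[mu]_(x in `[0, 1]) (f (i.+1%:R + x)^-1 * (i.+1%:R + x) ^- 2) =
  \int[mu]_(x in `[i.+2%:R^-1, i.+1%:R^-1]) f x.
Proof.
move=> cf; pose F y : R := (i.+1%:R + y)^-1.
have F0 : F 0 = i.+1%:R^-1 by rewrite /F addr0.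
have F1 : F 1 = i.+2%:R^-1 by rewrite /F natr1.
rewrite -F0 -F1 /Rintegral; congr fine.
rewrite (@integration_by_substitution_decreasing R F f 0 1) //.
- apply: eq_integral => x; rewrite inE /= in_itv /= => /andP[x0 _].
  by rewrite !fctE /F derive1_inv_digit // opprK.
- move=> x y; rewrite !in_itv /= => /andP[x0 _] /andP[y0 _] xy.
  by rewrite /F ltf_pV2 ?posrE ?digit_add_gt0 // ltrD2l.
- move=> x; rewrite in_itv /= => /andP[x0 _].
  rewrite /continuous_at /F derive1_inv_digit ?(ltW x0) //.
  apply: cvg_trans (cvg_inv_digit_sqr (ltW x0)).
  apply: near_eq_cvg; near=> y; rewrite derive1_inv_digit //.
  by near: y; apply: (@cvgr_ge R R (nbhs x) _ id x (@cvg_id _ _)) x0.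
- apply/cvg_ex; exists (- (i.+1%:R + 0) ^- 2).
  apply: cvg_trans (cvg_at_right_filter (cvg_inv_digit_sqr (lexx 0))).
  apply: near_eq_cvg; near=> y; rewrite derive1_inv_digit //.
- apply/cvg_ex; exists (- (i.+1%:R + 1) ^- 2).
  apply: cvg_trans (cvg_at_left_filter (cvg_inv_digit_sqr ler01)).
  apply: near_eq_cvg; near=> y; rewrite derive1_inv_digit //.
  by near: y; apply: nbhs_left_ge.
- split.
  + move=> x; rewrite in_itv /= => /andP[/ltW x0 _].
    by have [] := is_derive_inv_digit i x0.
  + exact: cvg_at_right_filter (cvg_inv_digit (lexx 0)).
  + exact: cvg_at_left_filter (cvg_inv_digit ler01).
- apply: continuous_subspaceW cf => x /=; rewrite !in_itv /= F0 F1.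
  move=> /andP[h1 h2]; apply/andP; split.
    by apply: le_trans h1; rewrite invr_ge0.
  by apply: le_trans h2 _; rewrite invf_le1 ?ler1n ?ltr0n.
Unshelve. all: by end_near.
Qed.


(** * Lipschitz functions on the unit interval *)

Definition lipschitz_on01 u := exists L, lipschitz01 L u.

Lemma lipschitz_bounded u : lipschitz_on01 u -> exists B, bounded01 B u.
Proof.
move=> [L hu]; exists (L + `|u 0|) => x x01.
rewrite -[u x](subrK (u 0)); apply: le_trans (ler_normD _ _) _.
rewrite lerD2r; apply: le_trans (hu _ _ x01 _) _; first by rewrite lexx ler01.
have /andP[x0 x1] := x01; rewrite subr0 ger0_norm // ler_piMr //.
exact: lipschitz01_ge0 hu.
Qed.

Lemma lipschitz_cst (c : R) : lipschitz_on01 (fun=> c).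
Proof. by exists 0 => x y _ _; rewrite subrr normr0 mul0r. Qed.

Lemma lipschitzD u v : lipschitz_on01 u -> lipschitz_on01 v ->
  lipschitz_on01 (fun x => u x + v x).
Proof.
move=> [L hu] [M hv]; exists (L + M) => x y hx hy.
rewrite (_ : _ - _ = (u x - u y) + (v x - v y)); last by ring.
by rewrite mulrDl; apply: le_trans (ler_normD _ _) (lerD (hu _ _ hx hy) (hv _ _ hx hy)).
Qed.

Lemma lipschitzM u v : lipschitz_on01 u -> lipschitz_on01 v ->
  lipschitz_on01 (fun x => u x * v x).
Proof.
move=> lu lv; have [B bu] := lipschitz_bounded lu; have [C bv] := lipschitz_bounded lv.
move: lu lv => [L hu] [M hv]; exists (L * C + B * M) => x y hx hy.
rewrite (_ : _ - _ = (u x - u y) * v x + u y * (v x - v y)); last by ring.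
apply: le_trans (ler_normD _ _) _; rewrite !normrM mulrDl; apply: lerD.
  rewrite mulrAC; apply: ler_pM => //; [exact: hu|exact: bv].
by rewrite -mulrA; apply: ler_pM => //; [exact: bu|exact: hv].
Qed.

Lemma lipschitzB u v : lipschitz_on01 u -> lipschitz_on01 v ->
  lipschitz_on01 (fun x => u x - v x).
Proof.
move=> hu hv; have := lipschitzD hu (lipschitzM (lipschitz_cst (-1)) hv).
by under eq_fun do rewrite mulN1r.
Qed.

Lemma lipschitz_sum K (u : nat -> R -> R) :
  (forall i, lipschitz_on01 (u i)) ->
  lipschitz_on01 (fun x => \sum_(0 <= i < K) u i x).
Proof.
move=> hu; elim: K => [|K IH].
  by under eq_fun do rewrite big_geq //; apply: lipschitz_cst.
by under eq_fun do rewrite big_nat_recr //=; apply: lipschitzD.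
Qed.

Lemma inv_digit_lipschitz i : lipschitz01 1 (fun x : R => (i.+1%:R + x)^-1).
Proof.
move=> x y /andP[x0 _] /andP[y0 _].
rewrite inv_dist ?digit_add_gt0 // (_ : _ - _ = x - y); last by ring.
rewrite ler_pdivrMr ?mulr_gt0 ?digit_add_gt0 // mulrAC -[leLHS]mul1r ler_wpM2r //.
have i0 : 0 <= i%:R :> R by [].
by rewrite mul1r -(@natr1 R i) -[leLHS]mul1r ler_pM //; lra.
Qed.

Lemma lipschitz_inv_digit i : lipschitz_on01 (fun x => (i.+1%:R + x)^-1).
Proof. by exists 1; apply: inv_digit_lipschitz. Qed.

Lemma lipschitz01_comp_inv_digit (L : R) i u : lipschitz01 L u ->
  lipschitz01 L (fun x => u (i.+1%:R + x)^-1).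
Proof.
move=> hu x y hx hy; apply: le_trans (hu _ _ _ _) _; rewrite ?inv_digit_itv //.
rewrite ler_wpM2l ?(lipschitz01_ge0 hu) //.
by have := inv_digit_lipschitz i hx hy; rewrite mul1r.
Qed.

Lemma lipschitz_comp_inv_digit i u : lipschitz_on01 u ->
  lipschitz_on01 (fun x => u (i.+1%:R + x)^-1).
Proof. by move=> [L hu]; exists L; apply: lipschitz01_comp_inv_digit. Qed.

Lemma lipschitz_inv1 : lipschitz_on01 (fun x => (1 + x)^-1).
Proof. exact: (lipschitz_inv_digit 0). Qed.

Lemma lipschitz_on01_id : lipschitz_on01 (fun x => x).
Proof. by exists 1 => x y _ _; rewrite mul1r. Qed.

Lemma lipschitz_eq u v : (forall x, 0 <= x <= 1 -> u x = v x) ->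
  lipschitz_on01 u -> lipschitz_on01 v.
Proof.
by move=> uv [L hu]; exists L => x y hx hy; rewrite -!uv //; apply: hu.
Qed.

Lemma gweightE i x : 0 <= x ->
  gweight i x = (1 + x) * ((i.+1%:R + x)^-1 * (i.+2%:R + x)^-1).
Proof. by move=> x0; rewrite /gweight invfM. Qed.

Lemma lipschitz_gweight i : lipschitz_on01 (gweight i).
Proof.
apply: (@lipschitz_eq (fun x => (1 + x) * ((i.+1%:R + x)^-1 * (i.+2%:R + x)^-1))).
  by move=> x /andP[x0 _]; rewrite gweightE.
apply: lipschitzM; first by apply: lipschitzD lipschitz_on01_id; apply: lipschitz_cst.
by apply: lipschitzM; apply: lipschitz_inv_digit.
Qed.

Lemma lipschitz_transfer K u : lipschitz_on01 u -> lipschitz_on01 (transfer K u).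
Proof.
move=> hu; apply: lipschitz_sum => i; apply: lipschitzM (lipschitz_gweight i) _.
exact: lipschitz_comp_inv_digit.
Qed.

Lemma lipschitz_iter_transfer K n u :
  lipschitz_on01 u -> lipschitz_on01 (iter n (transfer K) u).
Proof. by move=> hu; elim: n => //= n; apply: lipschitz_transfer. Qed.

(** Written as a telescoping difference, so that the constants sum over i to at most 4. *)
Lemma gweight_dist i x y : 0 <= x <= 1 -> 0 <= y <= 1 ->
  `|gweight i x - gweight i y| <= 4 * ((i.+1%:R)^-1 - (i.+2%:R)^-1) * `|x - y|.
Proof.
move=> /andP[x0 x1] /andP[y0 y1]; rewrite /gweight.
have -> : i.+2%:R = i%:R + 2 :> R by rewrite -natrD addn2.
have : 0 <= i%:R :> R by []; rewrite -(@natr1 R i); move: (i%:R : R) => t t0.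
have -> : (1 + x) / ((t + 1 + x) * (t + 2 + x)) - (1 + y) / ((t + 1 + y) * (t + 2 + y))
  = (t * (t + 1) - (1 + x) * (1 + y)) * (x - y) /
    ((t + 1 + x) * (t + 2 + x) * ((t + 1 + y) * (t + 2 + y))).
  by field; rewrite !gt_eqF //; lra.
have -> : (t + 1)^-1 - (t + 2)^-1 = ((t + 1) * (t + 2))^-1 :> R.
  by field; rewrite !gt_eqF //; lra.
have q x' : 0 <= x' -> (t + 1) * (t + 2) <= (t + 1 + x') * (t + 2 + x').
  by move=> ?; rewrite ler_pM //; lra.
have p0 : 0 < (t + 1) * (t + 2) by rewrite mulr_gt0 //; lra.
have px := q _ x0; have py := q _ y0.
move: (_ * (t + 2 + x)) (_ * (t + 2 + y)) px py => X Y px py.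
have hn : `|t * (t + 1) - (1 + x) * (1 + y)| <= 4 * ((t + 1) * (t + 2)).
  by rewrite ler_norml; apply/andP; split; nra.
move: ((t + 1) * (t + 2)) p0 px py hn => p p0 px py hn.
rewrite !normrM normfV [X in _ / X <= _]gtr0_norm; last first.
  by rewrite mulr_gt0 //; apply: lt_le_trans p0 _.
rewrite ler_pdivrMr; last by rewrite mulr_gt0 //; apply: lt_le_trans p0 _.
apply: (@le_trans _ _ (4 * p * `|x - y|)).
  by rewrite ler_wpM2r.
rewrite -[leRHS]mulrA [`|x - y| * _]mulrC [leRHS]mulrA ler_wpM2r //.
rewrite -mulrA ler_pM2l // ler_pdivlMl // ler_pM // ltW //.
Qed.

(** The functions of different digits are unrelated, so no Abel summation here; the variation of the
    weights, summed crudely, still gives a constant independent of K. *)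
Lemma transfer_dig_lipschitz K g (B L : R) :
  (forall i, bounded01 B (g i.+1)) -> (forall i, lipschitz01 L (g i.+1)) ->
  lipschitz01 (L + 4 * B) (transfer_dig K g).
Proof.
move=> gB gL x y hx hy; have /andP[x0 _] := hx.
have L0 := lipschitz01_ge0 (gL 0%N); have B0 := bounded01_ge0 (gB 0%N).
rewrite /transfer_dig -sumrB.
rewrite (eq_bigr (fun i => gweight i x * (g i.+1 x - g i.+1 y) +
   (gweight i x - gweight i y) * g i.+1 y)); last by move=> i _; ring.
rewrite big_split /= mulrDl; apply: le_trans (ler_normD _ _) _; apply: lerD.
  apply: sum_gweight_bound => // [|i]; first by rewrite mulr_ge0.
  exact: gL.
apply: le_trans (ler_norm_sum _ _ _) _.
apply: (@le_trans _ _ (\sum_(0 <= i < K) 4 * B * `|x - y| *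
    (i.+1%:R^-1 - i.+2%:R^-1))).
  apply: ler_sum => i _; rewrite normrM.
  apply: le_trans (ler_pM _ _ (gweight_dist i hx hy) (gB i y hy)) _ => //.
  by rewrite le_eqVlt; apply/orP; left; apply/eqP; ring.
rewrite -mulr_sumr ler_piMr ?mulr_ge0 //.
suff -> : \sum_(0 <= i < K) (i.+1%:R^-1 - i.+2%:R^-1) = 1 - K.+1%:R^-1 :> R.
  by rewrite gerBl invr_ge0.
elim: K => [|K IH]; first by rewrite big_geq // invr1 subrr.
by rewrite big_nat_recr //= IH; ring.
Qed.

(** * Integrals over the unit interval and Gauss means *)

Lemma integrable_lipschitz u : lipschitz_on01 u ->
  mu.-integrable `[0, 1] (EFin \o u).
Proof.
move=> [L /lipschitz01_continuous cu]; apply: continuous_compact_integrable => //.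
exact: segment_compact.
Qed.

Definition int01 u : R := \int[mu]_(x in `[0, 1]) u x.

Lemma int01_eq u v : (forall x, 0 <= x <= 1 -> u x = v x) -> int01 u = int01 v.
Proof.
by move=> uv; apply: eq_Rintegral => x; rewrite inE /= in_itv /=; apply: uv.
Qed.

Lemma int01D u v : lipschitz_on01 u -> lipschitz_on01 v ->
  int01 (fun x => u x + v x) = int01 u + int01 v.
Proof. by move=> hu hv; apply: RintegralD => //; apply: integrable_lipschitz. Qed.

Lemma int01B u v : lipschitz_on01 u -> lipschitz_on01 v ->
  int01 (fun x => u x - v x) = int01 u - int01 v.
Proof. by move=> hu hv; apply: RintegralB => //; apply: integrable_lipschitz. Qed.

Lemma int01Z (c : R) u : lipschitz_on01 u ->
  int01 (fun x => c * u x) = c * int01 u.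
Proof. by move=> hu; apply: RintegralZl => //; apply: integrable_lipschitz. Qed.

Lemma int01_cst (c : R) : int01 (fun=> c) = c.
Proof.
rewrite /int01 Rintegral_cst //= lebesgue_measure_itv /= lte_fin ltr01.
by rewrite oppr0 adde0 mulr1.
Qed.

Lemma int01_le u v : lipschitz_on01 u -> lipschitz_on01 v ->
  (forall x, 0 <= x <= 1 -> u x <= v x) -> int01 u <= int01 v.
Proof.
by move=> hu hv uv; apply: le_Rintegral => //; apply: integrable_lipschitz.
Qed.

Lemma int01_bounded (B : R) u : lipschitz_on01 u -> bounded01 B u ->
  `|int01 u| <= B.
Proof.
move=> hu bu; rewrite ler_norml; apply/andP; split.
  rewrite -(int01_cst (- B)); apply: int01_le => //; first exact: lipschitz_cst.
  by move=> x /bu; rewrite ler_norml => /andP[].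
rewrite -[leRHS](int01_cst B); apply: int01_le => //; first exact: lipschitz_cst.
by move=> x /bu; rewrite ler_norml => /andP[].
Qed.

Lemma int01_sum K (u : nat -> R -> R) : (forall i, lipschitz_on01 (u i)) ->
  int01 (fun x => \sum_(0 <= i < K) u i x) = \sum_(0 <= i < K) int01 (u i).
Proof.
move=> hu; elim: K => [|K IH].
  rewrite [RHS]big_geq // -[RHS](int01_cst 0); apply: int01_eq => x _.
  by rewrite big_geq.
rewrite big_nat_recr //= -IH -int01D //; last exact: lipschitz_sum.
by apply: int01_eq => x _; rewrite big_nat_recr.
Qed.

Lemma integrable_within a b u : 0 <= a -> b <= 1 ->
  {within `[0, 1], continuous u} -> mu.-integrable `[a, b] (EFin \o u).
Proof.
move=> a0 b1 cu; apply: continuous_compact_integrable; first exact: segment_compact.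
apply: continuous_subspaceW cu => x /=; rewrite !in_itv /= => /andP[h1 h2].
by apply/andP; split; lra.
Qed.

Lemma Rintegral_cat a b c u : 0 <= a -> a <= c -> c <= b -> b <= 1 ->
  {within `[0, 1], continuous u} ->
  \int[mu]_(x in `[a, b]) u x =
  \int[mu]_(x in `[a, c]) u x + \int[mu]_(x in `[c, b]) u x.
Proof.
move=> a0 ac cb b1 cu.
have iu := integrable_within a0 b1 cu.
have := @Rintegral_itvB R u (BLeft a) (BRight b) c iu.
rewrite !bnd_simp => /(_ ac cb) e.
rewrite -(@Rintegral_itv_obnd_cbnd R c (BRight b)); last first.
  apply: integrableS iu => // x /=; rewrite !in_itv /= => /andP[h1 ->].
  by rewrite andbT (le_trans ac) // ltW.
by rewrite -e addrC subrK.
Qed.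

Lemma sum_Rintegral_digit K u : {within `[0, 1], continuous u} ->
  \sum_(0 <= i < K) \int[mu]_(x in `[i.+2%:R^-1, i.+1%:R^-1]) u x =
  \int[mu]_(x in `[K.+1%:R^-1, 1]) u x.
Proof.
move=> cu; elim: K => [|K IH].
  by rewrite big_geq // invr1 set_itv1 Rintegral_set1.
rewrite big_nat_recr //= IH addrC -Rintegral_cat ?invr_ge0 //.
- by rewrite lef_pV2 ?posrE ?ltr0n // ler_nat.
- by rewrite invf_le1 ?ler1n ?ltr0n.
Qed.

Lemma Rintegral_bounded a b (B : R) u : 0 <= a -> a <= b -> b <= 1 ->
  {within `[0, 1], continuous u} -> bounded01 B u ->
  `|\int[mu]_(x in `[a, b]) u x| <= B * (b - a).
Proof.
move=> a0 ab b1 cu bu.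
have iu := integrable_within a0 b1 cu.
apply: le_trans (le_normr_Rintegral _ iu) _ => //.
have -> : B * (b - a) = \int[mu]_(x in `[a, b]) B.
  rewrite Rintegral_cst //= lebesgue_measure_itv /= lte_fin.
  case: ltP => // ba; rewrite (_ : b = a) ?subrr //.
  by apply/eqP; rewrite eq_le ba ab.
apply: le_Rintegral => //.
- exact: (integrable_norm iu).
- apply: integrable_within => //.
  by have [L /lipschitz01_continuous] := lipschitz_cst B.
move=> x /=; rewrite in_itv /= => /andP[h1 h2]; apply: bu.
by apply/andP; split; lra.
Qed.

(** Its value is log 2; the bounds 1/2 and 1 suffice below. *)
Definition gauss_mass : R := int01 (fun x => (1 + x)^-1).

Lemma gauss_mass_ge : 2^-1 <= gauss_mass.
Proof.
rewrite -[leLHS]int01_cst; apply: int01_le; [exact: lipschitz_cst|exact: lipschitz_inv1|].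
move=> x /andP[x0 x1]; rewrite lef_pV2 ?posrE; lra.
Qed.

(** Against 1 / (1 + x), the branch i contributes by substitution the integral over
    [1/(i+2), 1/(i+1)]; only [0, 1/(K+1)] is missed. *)
Lemma int01_transfer K (B : R) v : lipschitz_on01 v -> bounded01 B v ->
  `|int01 (fun x => transfer K v x * (1 + x)^-1) -
    int01 (fun x => v x * (1 + x)^-1)| <= B / K.+1%:R.
Proof.
move=> lv bv; pose h x : R := v x * (1 + x)^-1.
have lh : lipschitz_on01 h by apply: lipschitzM lipschitz_inv1.
have [L /lipschitz01_continuous ch] := lh.
have -> : int01 (fun x => transfer K v x * (1 + x)^-1) =
    \int[mu]_(x in `[K.+1%:R^-1, 1]) h x.
  rewrite -sum_Rintegral_digit //.
  rewrite (@int01_eq _ (fun x => \sum_(0 <= i < K)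
     (h (i.+1%:R + x)^-1 * (i.+1%:R + x) ^- 2))); last first.
    move=> x /andP[x0 x1]; rewrite /transfer mulr_suml; apply: eq_bigr => i _.
    rewrite /h /gweight; move: (v _) => w; have : 0 <= i%:R :> R by [].
    have -> : i.+2%:R = i%:R + 2 :> R by rewrite -natrD addn2.
    rewrite -(@natr1 R i); move: (i%:R : R) => t t0.
    by field; rewrite !gt_eqF //; lra.
  rewrite int01_sum; last first.
    move=> i; apply: lipschitzM; first exact: lipschitz_comp_inv_digit.
    apply: (@lipschitz_eq (fun x => (i.+1%:R + x)^-1 * (i.+1%:R + x)^-1)).
      by move=> x _; rewrite -invfM expr2.
    by apply: lipschitzM; apply: lipschitz_inv_digit.
  by apply: eq_bigr => i _; apply: Rintegral_inv_digit.
have -> : int01 (fun x => v x * (1 + x)^-1) =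
   \int[mu]_(x in `[0, K.+1%:R^-1]) h x + \int[mu]_(x in `[K.+1%:R^-1, 1]) h x.
  by apply: Rintegral_cat; rewrite ?invr_ge0 // invf_le1 ?ler1n ?ltr0n.
rewrite opprD addrCA subrr addr0 normrN.
apply: le_trans (Rintegral_bounded _ _ _ ch (B := B) _) _ => //.
- by rewrite invf_le1 ?ler1n ?ltr0n.
- move=> x x01; rewrite /h normrM -[leRHS]mulr1 ler_pM // ?bv //.
  have /andP[x0 x1] := x01; rewrite ger0_norm ?invr_ge0; last lra.
  by rewrite invf_le1; lra.
- by rewrite subr0.
Qed.

Lemma int01_iter_transfer K n (B : R) v : lipschitz_on01 v -> bounded01 B v ->
  `|int01 (fun x => iter n (transfer K) v x * (1 + x)^-1) -
    int01 (fun x => v x * (1 + x)^-1)| <= n%:R * (B / K.+1%:R).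
Proof.
move=> lv bv; elim: n => [|n IH]; first by rewrite subrr normr0 mul0r.
rewrite -(@natr1 R n) mulrDl mul1r [leRHS]addrC.
have := int01_transfer K (lipschitz_iter_transfer K n lv) (iter_transfer_bounded K n bv).
move: IH => /= h1 h2; apply: (le_trans _ (lerD h2 h1)).
set a := int01 _; set b := int01 _; set c := int01 _.
by rewrite (_ : a - b = (a - c) + (c - b)) ?ler_normD //; ring.
Qed.

(** v is within its oscillation l of its Gauss mean, and [gauss_mass] >= 1/2 gives the factor 2. *)
Lemma near_gauss_mean (l : R) v : lipschitz_on01 v ->
  (forall x y, 0 <= x <= 1 -> 0 <= y <= 1 -> `|v x - v y| <= l) ->
  forall x, 0 <= x <= 1 ->
  `|v x| <= l + 2 * `|int01 (fun x => v x * (1 + x)^-1)|.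
Proof.
move=> lv hl x x01; set I := int01 _; have Z := gauss_mass_ge.
have l1 := lipschitz_inv1.
have lc : lipschitz_on01 (fun y => v x * (1 + y)^-1).
  by apply: lipschitzM => //; apply: lipschitz_cst.
have lvy : lipschitz_on01 (fun y => v y * (1 + y)^-1) by apply: lipschitzM.
have e : v x * gauss_mass - I = int01 (fun y => (v x - v y) * (1 + y)^-1).
  rewrite -int01Z // -int01B //; apply: int01_eq => y _; ring.
have lB : lipschitz_on01 (fun y => (v x - v y) * (1 + y)^-1).
  by apply: lipschitzM => //; apply: lipschitzB => //; apply: lipschitz_cst.
have l0 : 0 <= l by apply: le_trans (hl x x x01 x01).
have h1 : `|v x * gauss_mass - I| <= l * gauss_mass.
  rewrite e ler_norml; apply/andP; split.
    rewrite -mulNr -int01Z //; apply: int01_le => //.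
      by apply: lipschitzM => //; apply: lipschitz_cst.
    move=> y y01; rewrite ler_wpM2r ?invr_ge0 //; first by have /andP[? _] := y01; lra.
    by have := hl x y x01 y01; rewrite ler_norml => /andP[].
  rewrite -int01Z //; apply: int01_le => //.
    by apply: lipschitzM => //; apply: lipschitz_cst.
  move=> y y01; rewrite ler_wpM2r ?invr_ge0 //; first by have /andP[? _] := y01; lra.
  by have := hl x y x01 y01; rewrite ler_norml => /andP[].
have Z0 : 0 < gauss_mass by lra.
have h2 : `|v x| * gauss_mass <= l * gauss_mass + `|I|.
  rewrite -{1}(gtr0_norm Z0) -normrM -(subrK I (v x * _)).
  by apply: le_trans (ler_normD _ _) _; rewrite lerD2r.
rewrite -(ler_pM2r Z0); apply: le_trans h2 _; rewrite mulrDl lerD2l.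
have := normr_ge0 I; nra.
Qed.

End Integrals.

(** * Farey sums of Lipschitz functions *)

Section FareySums.
Variable R : realType.
Implicit Types (x y X : R) (f : R -> R) (K N i k : nat).
Local Notation G := (@gauss R).
Local Notation mu := (@lebesgue_measure R).

(* Truncated sum of x f(x) over the Farey orbit segment of the points with
   first digit at most k and tail x. *)
Definition farey_sum f N k x : R :=
  \sum_(0 <= b < minn k N) (b.+1%:R + x)^-1 * f (b.+1%:R + x)^-1.

Lemma farey_sumS f N k x : farey_sum f N k.+1 x = farey_sum f N k x +
  (k < N)%:R * ((k.+1%:R + x)^-1 * f (k.+1%:R + x)^-1).
Proof.
rewrite /farey_sum; have [kN|Nk] := ltnP k N.
  by rewrite (minn_idPl kN) big_nat_recr //= mul1r.
by rewrite (minn_idPr (leqW Nk)) mul0r addr0.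
Qed.

Lemma farey_sum_lipschitz f N : lipschitz_on01 f ->
  exists L, forall k, lipschitz01 L (farey_sum f N k).
Proof.
move=> lf; have [L hL] := lipschitzM (@lipschitz_on01_id R) lf.
have L0 := lipschitz01_ge0 hL.
exists (N%:R * L) => k x y hx hy; rewrite /farey_sum -sumrB.
apply: le_trans (ler_norm_sum _ _ _) _.
apply: (@le_trans _ _ (\sum_(0 <= b < minn k N) L * `|x - y|)).
  by apply: ler_sum => b _; apply: (lipschitz01_comp_inv_digit b hL).
rewrite big_const_nat iter_addr_0 subn0 -[leLHS]mulr_natl -mulrA.
by rewrite ler_wpM2r ?mulr_ge0 // ler_nat geq_minr.
Qed.

Lemma farey_sum_bounded f N : lipschitz_on01 f ->
  exists B, forall k, bounded01 B (farey_sum f N k).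
Proof.
move=> lf; have [B hB] := lipschitz_bounded (lipschitzM (@lipschitz_on01_id R) lf).
have B0 := bounded01_ge0 hB.
exists (N%:R * B) => k x hx; rewrite /farey_sum.
apply: le_trans (ler_norm_sum _ _ _) _.
apply: (@le_trans _ _ (\sum_(0 <= b < minn k N) B)).
  by apply: ler_sum => b _; apply: hB; apply: inv_digit_itv.
rewrite big_const_nat iter_addr_0 subn0 -[leLHS]mulr_natl.
by rewrite ler_wpM2r // ler_nat geq_minr.
Qed.

(* Summation by parts: the weights telescope. *)
Lemma sum_farey_sum f N K x : 0 <= x ->
  \sum_(0 <= i < K) (i.+1%:R + x)^-1 * (i.+2%:R + x)^-1 * farey_sum f N i.+1 x =
  \sum_(0 <= b < minn K N) f (b.+1%:R + x)^-1 * (b.+1%:R + x) ^- 2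
   - farey_sum f N K x * (K.+1%:R + x)^-1.
Proof.
move=> x0; elim: K => [|K IH].
  by rewrite /farey_sum !min0n !big_geq // mul0r subrr.
rewrite big_nat_recr //= {}IH farey_sumS; set S := farey_sum _ _ _ _.
have -> : \sum_(0 <= b < minn K.+1 N) f (b.+1%:R + x)^-1 * (b.+1%:R + x) ^- 2 =
  \sum_(0 <= b < minn K N) f (b.+1%:R + x)^-1 * (b.+1%:R + x) ^- 2 +
  (K < N)%:R * (f (K.+1%:R + x)^-1 * (K.+1%:R + x) ^- 2).
  have [kN|Nk] := ltnP K N.
    by rewrite (minn_idPl kN) big_nat_recr //= mul1r.
  by rewrite (minn_idPr (leqW Nk)) mul0r addr0.
move: (f _) (\sum_(0 <= b < minn K N) _) => w T.
have : 0 <= K%:R :> R by [].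
have -> : K.+2%:R = K%:R + 2 :> R by rewrite -natrD addn2.
rewrite -(@natr1 R K); move: (K%:R : R) => t t0.
by field; rewrite !gt_eqF //; lra.
Qed.

Lemma sum_digit_weights K x : 0 <= x ->
  \sum_(0 <= i < K) (i.+1%:R + x)^-1 * (i.+2%:R + x)^-1 =
  (1 + x)^-1 - (K.+1%:R + x)^-1.
Proof.
move=> x0; elim: K => [|K IH]; first by rewrite big_geq // subrr.
rewrite big_nat_recr //= IH; have : 0 <= K%:R :> R by [].
have -> : K.+2%:R = K%:R + 2 :> R by rewrite -natrD addn2.
rewrite -(@natr1 R K); move: (K%:R : R) => t t0.
by field; rewrite !gt_eqF //; lra.
Qed.

(** The Gauss mean of w -> [farey_sum f N (dig w) (G w)]: summation by parts over the first digit
    leaves the Jacobians (b + x)^-2, which substitution turns into Lebesgue measure. *)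
Definition farey_mean f N : R :=
  (\int[mu]_(x in `[N.+1%:R^-1, 1]) f x) / gauss_mass R.

Lemma gauss_mass_gt0 : 0 < gauss_mass R.
Proof. by have := gauss_mass_ge R; lra. Qed.

(** The mean cancels the main terms; the boundary terms at K of the two telescoping sums survive,
    with the factor 1 / (K + 1 + x). *)
Lemma int01_transfer_farey_sum f N K (B : R) : (N <= K)%N -> lipschitz_on01 f ->
  (forall k, bounded01 B (farey_sum f N k)) ->
  `|int01 (fun x =>
     transfer_dig K (fun k y => farey_sum f N k y - farey_mean f N) x * (1 + x)^-1)|
  <= (`|farey_mean f N| + B) / K.+1%:R.
Proof.
move=> NK lf hB; set c := farey_mean f N.
have [Lh lh] := farey_sum_lipschitz N lf.
have lp : lipschitz_on01 (fun x => \sum_(0 <= b < N)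
    f (b.+1%:R + x)^-1 * (b.+1%:R + x) ^- 2).
  apply: lipschitz_sum => b; apply: lipschitzM; first exact: lipschitz_comp_inv_digit.
  apply: (@lipschitz_eq _ (fun x => (b.+1%:R + x)^-1 * (b.+1%:R + x)^-1)).
    by move=> x _; rewrite -invfM expr2.
  by apply: lipschitzM; apply: lipschitz_inv_digit.
have lq : lipschitz_on01 (fun x => c * (1 + x)^-1).
  by apply: lipschitzM; [apply: lipschitz_cst|apply: lipschitz_inv1].
have lr : lipschitz_on01 (fun x => (c - farey_sum f N K x) * (K.+1%:R + x)^-1).
  apply: lipschitzM (@lipschitz_inv_digit _ K).
  by apply: lipschitzB; [apply: lipschitz_cst|exists Lh].
rewrite (@int01_eq _ _ (fun x => (\sum_(0 <= b < N)
    f (b.+1%:R + x)^-1 * (b.+1%:R + x) ^- 2 - c * (1 + x)^-1)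
    + (c - farey_sum f N K x) * (K.+1%:R + x)^-1)); last first.
  move=> x /andP[x0 x1]; rewrite /transfer_dig mulr_suml.
  rewrite (eq_bigr (fun i =>
     (i.+1%:R + x)^-1 * (i.+2%:R + x)^-1 * farey_sum f N i.+1 x -
     (i.+1%:R + x)^-1 * (i.+2%:R + x)^-1 * c)); last first.
    move=> i _; rewrite gweightE // mulrAC [(1 + x) * _]mulrC mulfK ?mulrBr //.
    by rewrite gt_eqF //; lra.
  rewrite sumrB -mulr_suml sum_farey_sum // sum_digit_weights // (minn_idPr NK).
  by ring.
rewrite int01D //; last exact: lipschitzB.
rewrite int01B // int01Z; last exact: lipschitz_inv1.
rewrite int01_sum; last first.
  move=> b; apply: lipschitzM; first exact: lipschitz_comp_inv_digit.
  apply: (@lipschitz_eq _ (fun x => (b.+1%:R + x)^-1 * (b.+1%:R + x)^-1)).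
    by move=> x _; rewrite -invfM expr2.
  by apply: lipschitzM; apply: lipschitz_inv_digit.
have [Lf /lipschitz01_continuous cf] := lf.
rewrite (eq_bigr (fun i => \int[mu]_(x in `[i.+2%:R^-1, i.+1%:R^-1]) f x)); last first.
  by move=> i _; apply: Rintegral_inv_digit.
rewrite sum_Rintegral_digit // -/(gauss_mass R) /c /farey_mean divfK; last first.
  by rewrite gt_eqF // gauss_mass_gt0.
rewrite subrr add0r -/(farey_mean f N) -/c.
apply: int01_bounded => // x x01; rewrite normrM; have /andP[x0 x1] := x01.
have K0 : 0 < K.+1%:R + x by exact: digit_add_gt0.
apply: ler_pM => //.
  by apply: le_trans (ler_normB _ _) _; rewrite lerD2l hB.
rewrite gtr0_norm ?invr_gt0 // lef_pV2 ?posrE ?ltr0n //.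
by rewrite lerDl.
Qed.

(** The decay needed for [sum_LX_mean_zero]: the iterates have small oscillation by contraction and
    an almost vanishing Gauss integral, hence are uniformly small. *)
Lemma farey_sum_mean_zero f N : lipschitz_on01 f ->
  forall eps : R, 0 < eps -> exists X0, forall X, X0 <= X ->
    `|\sum_(w <- LX X) (farey_sum f N (dig w) (G w) - farey_mean f N)|
      <= eps * X ^+ 2.
Proof.
move=> lf; set c := farey_mean f N.
have [L lh] := farey_sum_lipschitz N lf; have [B bh] := farey_sum_bounded N lf.
have L0 := lipschitz01_ge0 (lh 0%N); have B0 := bounded01_ge0 (bh 0%N).
pose g k x := farey_sum f N k x - c.
pose C := `|c| + B; have C0 : 0 <= C by rewrite addr_ge0.
have gB k : bounded01 C (g k).
  move=> x x01; apply: le_trans (ler_normB _ _) _; rewrite addrC.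
  by rewrite lerD2l; apply: bh.
have gL k : lipschitz01 L (g k).
  by move=> x y hx hy; rewrite /g opprB addrA subrK; apply: lh.
pose M := L + 4 * C; have M0 : 0 <= M by rewrite addr_ge0 ?mulr_ge0.
apply: (@sum_LX_mean_zero _ g C L M) => //.
  by move=> i x /andP[/ltW x0 /ltW x1]; apply: gB; apply/andP.
move=> n eta eta0.
(* The coefficients of 1 / (K + 1): 8C from the Lipschitz constant, twice C + n C from the
   integral. *)
pose D := 8 * C + 2 * (C + n%:R * C).
exists (N + Num.truncn (D / eta))%N => K hK i x ni x01.
have x01' : 0 <= x <= 1 by have /andP[/ltW -> /ltW ->] := x01.
have NK : (N <= K)%N by apply: leq_trans hK; apply: leq_addr.
set u := transfer_dig K g.
have uL : lipschitz01 M u by apply: transfer_dig_lipschitz.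
have uC : bounded01 C u.
  move=> y y01; have /andP[y0 _] := y01.
  by apply: sum_gweight_bound => // j; apply: gB.
have lu : lipschitz_on01 u by exists M.
have hv := iter_transfer_lipschitz K i M0 uL uC.
have q0 : 0 <= (7 / 8 : R) ^+ i by apply: exprn_ge0; lra.
have e0 : 0 <= C / K.+1%:R by rewrite divr_ge0.
have := @near_gauss_mean R ((7 / 8) ^+ i * M + 8 * (C / K.+1%:R)) _
  (lipschitz_iter_transfer K i lu).
set l := (_ * M + _) => h; apply: le_trans (h _ x x01') _.
  move=> y z y01 z01; apply: le_trans (hv y z y01 z01) _; rewrite -/l.
  rewrite ler_piMr ?addr_ge0 ?mulr_ge0 //.
  have /andP[? ?] := y01; have /andP[? ?] := z01.
  by rewrite ler_norml; apply/andP; split; lra.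
have h1 := int01_iter_transfer K i lu uC.
have h2 := int01_transfer_farey_sum NK lf bh.
rewrite -/c -/C -/g -/u in h2.
have h3 : `|int01 (fun x => iter i (transfer K) u x * (1 + x)^-1)| <=
    C / K.+1%:R + n%:R * (C / K.+1%:R).
  move: h1 h2; set a := int01 _; set b := int01 _ => h1 h2.
  rewrite -(subrK b a) addrC; apply: le_trans (ler_normD _ _) _.
  apply: lerD => //; apply: le_trans h1 _.
  by rewrite ler_wpM2r // ler_nat ltnW.
have hD : D / K.+1%:R <= eta.
  rewrite ler_pdivrMr ?ltr0n // [leRHS]mulrC -ler_pdivrMr // ltW //.
  apply: (lt_le_trans (truncnS_gt (D / eta))).
  by rewrite ler_nat ltnS; apply: leq_trans hK; apply: leq_addl.
have eD : D / K.+1%:R = 8 * (C / K.+1%:R) + 2 * (C / K.+1%:R + n%:R * (C / K.+1%:R)).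
  by rewrite /D; ring.
by rewrite /l -addrA lerD2l; apply: le_trans hD; rewrite eD lerD2l ler_pM2l.
Qed.

Lemma sum_inv_sqr_tail N n : (0 < N)%N ->
  \sum_(N <= b < n) (b.+1%:R ^- 2 : R) <= N%:R^-1.
Proof.
move=> N0; have [nN|Nn] := leqP n N; first by rewrite big_geq // invr_ge0.
suff h : \sum_(N <= b < n) (b.+1%:R ^- 2 : R) <= N%:R^-1 - n%:R^-1.
  by apply: le_trans h _; rewrite gerBl invr_ge0.
rewrite -(subnKC (ltnW Nn)); elim: (n - N)%N => [|m IH].
  by rewrite addn0 big_geq // subrr.
rewrite addnS big_nat_recr ?leq_addr //=.
apply: le_trans (lerD IH (lexx _)) _.
have : 1 <= (N + m)%:R :> R by rewrite ler1n addn_gt0 N0.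
rewrite -(@natr1 R (N + m)); move: ((N + m)%:R : R) => t t1.
have : 0 <= t^-1 * (t + 1) ^- 2 by rewrite mulr_ge0 ?invr_ge0 ?exprn_ge0 //; lra.
have -> : t^-1 * (t + 1) ^- 2 = t^-1 - (t + 1)^-1 - (t + 1) ^- 2 :> R.
  by field; rewrite !gt_eqF //; lra.
lra.
Qed.

(* Only [dig w > b >= N] contributes, and few points have a large digit. *)
Lemma sum_LX_tail X N : (0 < N)%N -> 0 <= X ->
  \sum_(w <- LX X) \sum_(N <= b < dig w) (b.+1%:R^-1 : R) <= X ^+ 2 / N%:R.
Proof.
move=> N0 X0; pose D := \max_(w <- LX X) dig w.
apply: (@le_trans _ _ (\sum_(w <- LX X) \sum_(N <= b < D)
   ((b < dig w)%N%:R * b.+1%:R^-1 : R))).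
  rewrite big_seq [leRHS]big_seq; apply: ler_sum => w wX.
  have wD : (dig w <= D)%N by rewrite /D; apply: leq_bigmax_seq.
  have [dN|Nd] := leqP (dig w) N.
    by rewrite big_geq // sumr_ge0 // => b _; rewrite mulr_ge0 ?invr_ge0.
  rewrite (@big_cat_nat _ _ _ (dig w) N D) //= ?(ltnW Nd) //.
  rewrite -[leLHS]addr0; apply: lerD; last first.
    by rewrite sumr_ge0 // => b _; rewrite mulr_ge0 ?invr_ge0.
  rewrite big_nat [leRHS]big_nat; apply: ler_sum => b /andP[_ bd].
  by rewrite bd mul1r.
rewrite exchange_big /=.
apply: (@le_trans _ _ (\sum_(N <= b < D) X ^+ 2 * b.+1%:R ^- 2)).
  apply: ler_sum => b _; rewrite -mulr_suml.
  have -> : \sum_(w <- LX X) ((b < dig w)%N%:R : R) =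
     (size [seq w <- LX X | (b < dig w)%N])%:R.
    rewrite size_filter -sum1_count natr_sum [RHS]big_mkcond /=.
    by apply: eq_bigr => w _; case: (_ < _)%N.
  apply: (@le_trans _ _ (X ^+ 2 / b.+1%:R * b.+1%:R^-1)).
    rewrite ler_wpM2r ?invr_ge0 //; apply: size_QG_dig => //.
      by rewrite filter_uniq // LX_uniq.
    by move=> w; rewrite mem_filter => /andP[bw /mem_LX[Qw wX]].
  by rewrite -mulrA -invfM expr2.
by rewrite -mulr_sumr ler_wpM2l ?exprn_ge0 // sum_inv_sqr_tail.
Qed.

Definition farey_total f X : R :=
  \sum_(w <- LX X) \sum_(1 <= b < (dig w).+1)
     (b%:R + G w)^-1 * f (b%:R + G w)^-1.

Lemma farey_total_lipschitz f : lipschitz_on01 f ->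
  forall eps : R, 0 < eps -> exists X0, forall X, X0 <= X ->
    `|farey_total f X - (size (LX X))%:R * (int01 f / gauss_mass R)|
      <= eps * X ^+ 2.
Proof.
move=> lf eps eps0; have [B bf] := lipschitz_bounded lf.
have B0 := bounded01_ge0 bf; have [Lf /lipschitz01_continuous cf] := lf.
(* The errors are eps / 2 for the truncated sums, B / N <= eps / 6 for the digits above N, and 2B /
   N <= eps / 3 for the integral over [0, 1/(N+1)], divided by [gauss_mass] >= 1/2. *)
pose N := (Num.truncn (6 * B / eps)).+1.
have N0 : 0 < N%:R :> R by rewrite ltr0n.
have hN : B / N%:R <= eps / 6.
  have := truncnS_gt (6 * B / eps); rewrite -/N ltr_pdivrMr // => h.
  by rewrite ler_pdivrMr //; lra.
have e2 : 0 < eps / 2 by lra.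
have [X0 hX0] := farey_sum_mean_zero N lf e2.
exists (Num.max X0 1) => X; rewrite ge_max => /andP[/hX0 h1 X1].
have X00 : 0 <= X by lra.
have hI : int01 f = \int[lebesgue_measure]_(x in `[0, N.+1%:R^-1]) f x +
    \int[lebesgue_measure]_(x in `[N.+1%:R^-1, 1]) f x.
  by apply: Rintegral_cat; rewrite ?invr_ge0 // invf_le1 ?ler1n ?ltr0n.
have tail0 : `|\int[lebesgue_measure]_(x in `[0, N.+1%:R^-1]) f x| <= B / N%:R.
  apply: le_trans (Rintegral_bounded _ _ _ cf bf) _ => //.
    by rewrite invf_le1 ?ler1n ?ltr0n.
  by rewrite subr0 ler_wpM2l // lef_pV2 ?posrE ?ltr0n // ler_nat.
have split_w w : w \in LX X ->
  \sum_(1 <= b < (dig w).+1) (b%:R + G w)^-1 * f (b%:R + G w)^-1 =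
  farey_sum f N (dig w) (G w) +
  \sum_(N <= b < dig w) (b.+1%:R + G w)^-1 * f (b.+1%:R + G w)^-1.
  move=> _; rewrite big_add1 /= /farey_sum.
  have [dN|Nd] := leqP (dig w) N.
    by rewrite [X in _ = _ + X]big_geq ?addr0.
  by rewrite -big_cat_nat //= ltnW.
have -> : farey_total f X - (size (LX X))%:R * (int01 f / gauss_mass R) =
  \sum_(w <- LX X) (farey_sum f N (dig w) (G w) - farey_mean f N) +
  \sum_(w <- LX X) \sum_(N <= b < dig w) (b.+1%:R + G w)^-1 * f (b.+1%:R + G w)^-1
  - (size (LX X))%:R *
    ((\int[lebesgue_measure]_(x in `[0, N.+1%:R^-1]) f x) / gauss_mass R).
  rewrite /farey_total (eq_big_seq _ split_w) big_split /= sumrB.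
  rewrite big_const_seq count_predT iter_addr_0 -[_ *+ _]mulr_natl hI /farey_mean.
  by ring.
apply: le_trans (ler_normB _ _) _; apply: le_trans (lerD (ler_normD _ _) (lexx _)) _.
have h2 : `|\sum_(w <- LX X) \sum_(N <= b < dig w)
    (b.+1%:R + G w)^-1 * f (b.+1%:R + G w)^-1| <= B / N%:R * X ^+ 2.
  apply: le_trans (ler_norm_sum _ _ _) _.
  apply: (@le_trans _ _ (B * \sum_(w <- LX X) \sum_(N <= b < dig w) b.+1%:R^-1)).
    rewrite mulr_sumr; apply: ler_sum => w _; rewrite mulr_sumr.
    apply: le_trans (ler_norm_sum _ _ _) _; apply: ler_sum => b _.
    have g0 := gauss_ge0 w; have g1 := gauss_lt1 w.
    have d0 : 0 < b.+1%:R + G w by apply: digit_add_gt0.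
    rewrite normrM mulrC ler_pM //.
      by apply: bf; apply: inv_digit_itv; rewrite g0 ltW.
    by rewrite gtr0_norm ?invr_gt0 // lef_pV2 ?posrE ?ltr0n // lerDl.
  rewrite -mulrA ler_wpM2l // [leRHS]mulrC; exact: sum_LX_tail.
have h3 : `|(size (LX X))%:R *
    ((\int[lebesgue_measure]_(x in `[0, N.+1%:R^-1]) f x) / gauss_mass R)|
    <= 2 * (B / N%:R) * X ^+ 2.
  rewrite normrM ger0_norm // mulrC ler_pM // ?size_LX_le //.
  have := gauss_mass_ge R => Z.
  rewrite normrM mulrC ler_pM // gtr0_norm ?invr_gt0 ?gauss_mass_gt0 //.
  by rewrite -[leRHS]invrK lef_pV2 ?posrE ?gauss_mass_gt0 ?invr_gt0.
have h4 : B / N%:R * X ^+ 2 <= eps / 6 * X ^+ 2 by rewrite ler_wpM2r ?sqr_ge0.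
rewrite -mulrA in h3.
move: h1 h2 h3 h4; rewrite ![eps / _ * _]mulrAC.
move: (B / _ * _) (eps * _) => p q; lra.
Qed.

End FareySums.

(** * Continuous functions *)

Section LipschitzApproximation.
Variable R : realType.
Implicit Types (x y X : R) (f : R -> R).

(** Heine-Cantor, from compactness as a near-covering property with d tending to 0 from the
    right. *)
Lemma within01_uniform f (eps : R) : {within `[0, 1], continuous f} -> 0 < eps ->
  exists2 d : R, 0 < d & forall x y, 0 <= x <= 1 -> 0 <= y <= 1 ->
    `|x - y| <= d -> `|f x - f y| <= eps.
Proof.
move=> /subspace_continuousP cf e0.
have nc : near_covering (`[0, 1] : set R).
  by apply/compact_near_coveringP; apply: segment_compact.
pose P (d x : R) := 0 <= x <= 1 ->
  forall y, 0 <= y <= 1 -> `|x - y| <= d -> `|f x - f y| <= eps.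
have : \forall d \near 0^'+, `[0, 1]%classic `<=` P d.
  apply: nc => x x01.
  have : 0 < eps / 2 by lra.
  move: (cf x x01) => /cvgrPdist_le /[apply]; rewrite near_withinE.
  move=> /nbhs_ballP[r /= r0 hr].
  have r2 : 0 < r / 2 by lra.
  exists (ball x (r / 2), [set d : R | d < r / 2]) => /=.
    split; first exact: nbhsx_ballx.
    exact: nbhs_right_lt.
  move=> [z d] /= [xz dr] z01 y y01 zy.
  have h1 := hr z; have h2 := hr y.
  have {}h1 : `|f x - f z| <= eps / 2.
    apply: h1; first by rewrite /ball /= in xz *; lra.
    by rewrite in_itv.
  have {}h2 : `|f x - f y| <= eps / 2.
    apply: h2; last by rewrite in_itv.
    rewrite /ball /= in xz *; rewrite (_ : x - y = (x - z) + (z - y)); last by ring.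
    by apply: le_lt_trans (ler_normD _ _) _; lra.
  rewrite (_ : f z - f y = (f x - f y) - (f x - f z)); last by ring.
  by apply: le_trans (ler_normB _ _) _; lra.
move=> [r /= r0 hr]; exists (r / 2); first by lra.
move=> x y x01 y01; apply: (hr (r / 2)) => //=.
- by rewrite sub0r normrN gtr0_norm; lra.
- by lra.
Qed.

(* Infimal convolution with a multiple of the distance. *)
Lemma lipschitz_approx f (eps : R) : {within `[0, 1], continuous f} -> 0 < eps ->
  exists2 h, lipschitz_on01 h & forall x, 0 <= x <= 1 -> `|f x - h x| <= eps.
Proof.
move=> cf e0; have [d d0 hd] := within01_uniform cf e0.
have [a a01 fmin] := EVT_min ler01 cf; have [b b01 fmax] := EVT_max ler01 cf.
(* With this slope a distance above d costs at least the whole range of f, so a far y cannot bring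
   the infimum below f x. *)
pose n := (f b - f a) / d.
have n0 : 0 <= n by rewrite divr_ge0 ?(ltW d0) // subr_ge0 fmax.
pose E x := [set f y + n * `|x - y| | y in `[0, 1]%classic].
pose h x := inf (E x).
have ne x : E x !=set0 by exists (f a + n * `|x - a|); exists a.
have lb x : has_lbound (E x).
  exists (f a) => _ [y /= y01 <-]; apply: le_trans (fmin y y01) _.
  by rewrite lerDl mulr_ge0.
have hle x y : 0 <= y <= 1 -> h x <= f y + n * `|x - y|.
  by move=> y01; apply: ge_inf => //; exists y => //=; rewrite in_itv.
exists h => [|x x01].
  exists n => x y _ _.
  have half u v : h u - h v <= n * `|u - v|.
    rewrite lerBlDr -lerBlDl; apply: lb_le_inf => // _ [z /= z01 <-].
    rewrite lerBlDl; apply: le_trans (hle u z _) _; first by rewrite in_itv in z01.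
    rewrite addrCA lerD2l -mulrDr ler_wpM2l //.
    by rewrite (_ : u - z = (u - v) + (v - z)) ?ler_normD //; ring.
  rewrite ler_norml half andbT lerNl opprB distrC; exact: half.
have h1 : h x <= f x by have := hle x x x01; rewrite subrr normr0 mulr0 addr0.
have h2 : f x - eps <= h x.
  apply: lb_le_inf => // _ [y /= y01 <-].
  have y01' : 0 <= y <= 1 by rewrite in_itv in y01.
  have [xy|xy] := leP `|x - y| d.
    have := hd x y x01 y01' xy; rewrite ler_norml => /andP[_ h3].
    by have : 0 <= n * `|x - y| by [rewrite mulr_ge0]; lra.
  have h3 : f b - f a <= n * `|x - y|.
    apply: (@le_trans _ _ (n * d)); first by rewrite /n divfK // gt_eqF.
    by rewrite ler_wpM2l // ltW.
  have := fmin y y01; have := fmax x; rewrite in_itv => /(_ x01); lra.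
by rewrite ger0_norm; lra.
Qed.

End LipschitzApproximation.

(** * Ratio of the Farey sums for continuous functions *)

Section Ratio.
Variable R : realType.
Implicit Types (x y X T : R) (f : R -> R).

Lemma gauss_mass_le1 : gauss_mass R <= 1.
Proof.
apply: le_trans (ler_norm _) _; apply: int01_bounded; first exact: lipschitz_inv1.
move=> x /andP[x0 x1]; rewrite ger0_norm ?invr_ge0; last lra.
by rewrite invf_le1; lra.
Qed.

Lemma int01_dist f h (eps : R) : {within `[0, 1], continuous f} ->
  lipschitz_on01 h -> (forall x, 0 <= x <= 1 -> `|f x - h x| <= eps) ->
  `|int01 f - int01 h| <= eps.
Proof.
move=> cf lh fh; have [L /lipschitz01_continuous ch] := lh.
have i_f : (@lebesgue_measure R).-integrable `[0, 1] (EFin \o f).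
  by apply: continuous_compact_integrable => //; apply: segment_compact.
rewrite /int01 -RintegralB //; last exact: integrable_lipschitz.
rewrite -[leRHS]mulr1 -[X in eps * X]subr0; apply: Rintegral_bounded => //.
by move=> x; apply: cvgB; [apply: cf|apply: ch].
Qed.

(** The weights are positive, so a uniform error passes to the sums relative to the total weight,
    however long the segments are. *)
Lemma farey_total_dist f h (eps X : R) :
  (forall x, 0 <= x <= 1 -> `|f x - h x| <= eps) ->
  `|farey_total f X - farey_total h X| <= eps * farey_total (fun=> 1) X.
Proof.
move=> fh; rewrite /farey_total -sumrB mulr_sumr.
apply: le_trans (ler_norm_sum _ _ _) _; apply: ler_sum => w _.
rewrite -sumrB mulr_sumr; apply: le_trans (ler_norm_sum _ _ _) _.
rewrite big_nat [leRHS]big_nat; apply: ler_sum => -[|b] // _.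
have d0 : 0 < b.+1%:R + gauss w by apply: digit_add_gt0; apply: gauss_ge0.
rewrite -mulrBr normrM mulr1 gtr0_norm ?invr_gt0 // mulrC.
rewrite ler_wpM2r ?invr_ge0 ?(ltW d0) //; apply: fh; apply: inv_digit_itv.
by rewrite gauss_ge0 ltW // gauss_lt1.
Qed.

Lemma farey_total_ratio f : {within `[0, 1], continuous f} ->
  forall eps : R, 0 < eps -> exists X0, forall X, X0 <= X ->
  0 < farey_total (fun=> 1) X /\
  `|farey_total f X / farey_total (fun=> 1) X - int01 f| <= eps.
Proof.
move=> cf eps e0; have e4 : 0 < eps / 4 by lra.
have [h lh fh] := lipschitz_approx cf e4.
(* The 256: s >= X^2 / 128 and 1 / [gauss_mass] >= 1, so an error of X^2 / 256 still leaves the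
   total weight at least X^2 / 256. *)
have [c ce] : exists c : R, c = eps / 4 / (256 * (1 + `|int01 f|)) by eexists.
have I0 : 0 < 1 + `|int01 f| by rewrite ltr_pwDl.
have p256 : 0 < 256 :> R by rewrite ltr0n.
have c0 : 0 < c by rewrite ce (divr_gt0 e4 (mulr_gt0 p256 I0)).
have [c' ce'] : exists c' : R, c' = Num.min c 256^-1 by eexists.
have c'0 : 0 < c' by rewrite ce' lt_min c0 invr_gt0 ltr0n.
have [X1 hX1] := farey_total_lipschitz lh c'0.
have [X2 hX2] := farey_total_lipschitz (@lipschitz_cst R 1) c'0.
exists (Num.max (300 ^+ 2) (Num.max X1 X2)) => X.
rewrite !ge_max => /and3P[X3 /hX1 h1 /hX2 h2].
have h3 := size_LX_ge X3.
have p300 : 0 < 300 :> R by rewrite ltr0n.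
have X0 : 0 < X := lt_le_trans (exprn_gt0 2 p300) X3.
have XX : 0 < X ^+ 2 by rewrite exprn_gt0.
move: h1 h2 h3; rewrite int01_cst div1r.
have Z0 := gauss_mass_gt0 R; have Z1 := gauss_mass_le1.
have Zi : 1 <= (gauss_mass R)^-1 by rewrite invf_ge1.
set s : R := (size (LX X))%:R; set D := farey_total (fun=> 1) X.
set Z := (gauss_mass R)^-1 in Zi *.
have e1 := farey_total_dist X fh; rewrite -/D in e1.
have e2 := int01_dist cf lh fh.
have s0 : 0 <= s by [].
set Nf := farey_total f X in e1 *; set Nh := farey_total h X in e1 *.
set If := int01 f in e2 I0 ce *; set Ih := int01 h in e2 *.
set Y := X ^+ 2 in XX * => h1 h2 h3.
have cc : c' <= c by rewrite ce' ge_min lexx.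
have c256 : c' <= 256^-1 by rewrite ce' ge_min lexx orbT.
have sZ : s <= s * Z by rewrite ler_peMr.
have cY : c' * Y <= 256^-1 * Y by rewrite ler_wpM2r // ltW.
have [h2a h2b] : D - s * Z <= c' * Y /\ s * Z - D <= c' * Y.
  by move: h2; rewrite ler_norml => /andP[? ?]; split; lra.
have DY : 256^-1 * Y <= D by lra.
have D0 : 0 < D by apply: lt_le_trans DY; rewrite pmulr_rgt0 ?invr_gt0.
split => //.
rewrite -[If](@mulfK _ D) ?gt_eqF // -mulrBl normrM [`|D^-1|]gtr0_norm ?invr_gt0 //.
rewrite ler_pdivrMr //.
have k1 : c' * Y * (1 + `|If|) <= eps / 4 * D.
  apply: (@le_trans _ _ (c * (256 * D) * (1 + `|If|))).
    rewrite ler_wpM2r ?(ltW I0) // ler_pM ?(ltW c'0) ?(ltW XX) //; lra.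
  rewrite ce le_eqVlt; apply/orP; left; apply/eqP.
  by field; rewrite gt_eqF.
have k2 : `|Ih - If| * (s * Z) <= eps / 4 * (2 * D).
  by rewrite ler_pM ?mulr_ge0 //; [lra|rewrite distrC|lra].
(* The first term costs eps/4 of [D], the third eps/2 because s Z <= 2 [D], and the two asymptotic
   errors together eps/4. *)
have -> : Nf - If * D = (Nf - Nh) + (Nh - s * (Ih * Z)) + (Ih - If) * (s * Z)
   + If * (s * Z - D) by ring.
apply: le_trans (ler_normD _ _) _.
apply: le_trans (lerD (ler_normD _ _) (lexx _)) _.
apply: le_trans (lerD (lerD (ler_normD _ _) (lexx _)) (lexx _)) _.
rewrite !normrM (ger0_norm s0) [`|Z|]ger0_norm; last by lra.
have k3 : `|If| * `|s * Z - D| <= `|If| * (c' * Y).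
  by rewrite ler_wpM2l // distrC.
have k1' : c' * Y + `|If| * (c' * Y) <= eps / 4 * D.
  by apply: le_trans k1; rewrite mulrDr mulr1 [`|If| * _]mulrC.
by move: k1' k2 k3 e1 h1; lra.
Qed.

End Ratio.

Theorem theorem2p2 (R : realType) (f : R -> R)
    (hf : {within `[0, 1], continuous f}) :
  ((\sum_(w \in QFT T) w * f w) / (\sum_(w \in QFT T) w)
     @[T --> (+oo : set_system R)]
     --> \int[@lebesgue_measure R]_(x in `[0, 1]) f x)
  /\
  (forall m : R -> probability (measurableTypeR R) R,
     (forall T : R, QFT T !=set0 -> is_mT T (m T)) ->
     (\int[m T]_(x in `[0, 1]) f x) @[T --> (+oo : set_system R)]
       --> \int[@lebesgue_measure R]_(x in `[0, 1]) f x).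
Proof.
have expR_ge (X0 T : R) : X0 * 2 <= T -> X0 <= expR (T / 2).
  by move=> h; apply: le_trans (expR_ge1Dx _); lra.
have sumE T (g : R -> R) :
    \sum_(w \in QFT T) w * g w = farey_total g (expR (T / 2)).
  exact: sum_QFT.
have sum1E T : \sum_(w \in QFT T) w = farey_total (fun=> 1) (expR (T / 2)) :> R.
  by rewrite -sumE; apply: eq_fsbigr => w _; rewrite mulr1.
have lim1 : ((\sum_(w \in QFT T) w * f w) / (\sum_(w \in QFT T) w)
     @[T --> (+oo : set_system R)]
     --> \int[@lebesgue_measure R]_(x in `[0, 1]) f x).
  apply/cvgrPdist_le => eps e0.
  have [X0 hX0] := farey_total_ratio hf e0.
  near=> T; rewrite sumE sum1E distrC; apply: (hX0 _ _).2; apply: expR_ge.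
  by near: T; apply: nbhs_pinfty_ge; apply: num_real.
split=> // m hm; apply: cvg_trans lim1; apply: near_eq_cvg.
(* A positive total weight shows that [QFT T] is nonempty for large T, so that the hypothesis on
   [m T] applies. *)
have [X0 hX0] := farey_total_ratio hf ltr01.
near=> T; rewrite hm //.
have /expR_ge/hX0[D0 _] : X0 * 2 <= T.
  by near: T; apply: nbhs_pinfty_ge; apply: num_real.
have [e|/set0P //] := eqVneq (QFT T) set0.
by move: D0; rewrite -sum1E e fsbig_set0 ltxx.
Unshelve. all: by end_near.
Qed.
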